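(* The parametrized problem \textsc{Ordered Erasibility Expansion Height} is in $\mathbf{W[P]}$.
   Context: **Simplicial complexes.** A (finite abstract) simplicial complex is a finite collection $K$ of nonempty finite sets (faces) such that every nonempty subset of a face is a face. The dimension of a face is its cardinality minus one; the dimension of $K$ is the largest dimension of its faces. A $d$-complex is a $d$-dimensional simplicial complex; a $d$-face is a face of dimension $d$. An $(m-1)$-face $\sigma\in K$ contained in exactly one $m$-face of $K$ is called free. **Elementary moves.** Let $m\ge 1$, let $K_0$ be a simplicial complex, $\tau\in K_0$ an $m$-face and $\sigma\subset\tau$ an $(m-1)$-face that is free in $K_0$. Then $K_1=K_0\setminus\{\tau,\sigma\}$ arises from $K_0$ by an elementary collapse (of dimension $m$, or $m$-collapse), and the inverse operation, passing from $K_1$ to $K_0=K_1\cup\{\tau,\sigma\}$, is an elementary expansion (of dimension $m$, or $m$-expansion). (In particular a $1$-expansion adds a new vertex together with an edge joining it to an existing vertex.) The simple-homotopy graph has simplicial complexes as nodes, two being adjacent if they are related by an elementary collapse; a path in it is thus a finite sequence of elementary collapses and expansions. Expansions and collapses of any dimension are allowed. **Problem.** \textsc{Ordered Erasibility Expansion Height}: the instance is a $2$-dimensional simplicial complex $K$ and a natural number $p$; the parameter is $p$; the question is whether there is a path in the simple-homotopy graph connecting $K$ to a $1$-complex using first at most $p$ expansions, followed by a sequence of only collapses. **Parametrized complexity.** A parametrized problem over a finite alphabet $\Sigma$ is a pair $(P,\rho)$ with $P\subseteq\Sigma^*$ and $\rho:\Sigma^*\to\mathbb{N}$. A nondeterministic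 Turing machine with input alphabet $\Sigma$ is $\rho$-restricted if there are computable functions $f,h:\mathbb{N}\to\mathbb{N}$ and a polynomial $q$ with natural number coefficients such that on every run with input $x\in\Sigma^*$ it performs at most $f(k)\cdot q(|x|)$ steps, at most $h(k)\cdot\log|x|$ of them nondeterministic, where $k=\rho(x)$. $\mathbf{W[P]}$ is the class of parametrized problems $(P,\rho)$ decidable by a $\rho$-restricted nondeterministic Turing machine. *)

(* Defs.v *)
From HB Require Import structures.
From mathcomp Require Import all_boot all_algebra.
From mathcomp Require Import finmap.

Set Implicit Arguments.
Unset Strict Implicit.
Unset Printing Implicit Defensive.

Local Open Scope fset_scope.
Local Open Scope nat_scope.

(** * Computable functions *)

(* The total general recursive functions.  [gr_min] is minimisation restricted
   to the regular case, where the search terminates for every argument. *)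
Inductive general_recursive : forall n, (n.-tuple nat -> nat) -> Prop :=
| gr_zero n : general_recursive (fun _ : n.-tuple nat => 0)
| gr_succ : general_recursive (fun v : 1.-tuple nat => (thead v).+1)
| gr_proj n (i : 'I_n) : general_recursive (fun v : n.-tuple nat => tnth v i)
| gr_comp n m (g : m.-tuple nat -> nat) (h : 'I_m -> n.-tuple nat -> nat) :
    general_recursive g -> (forall i, general_recursive (h i)) ->
    general_recursive (fun v : n.-tuple nat => g [tuple h i v | i < m])
| gr_prec n (g : n.-tuple nat -> nat) (h : n.+2.-tuple nat -> nat)
    (f : n.+1.-tuple nat -> nat) :
    general_recursive g -> general_recursive h ->
    (forall v : n.-tuple nat, f [tuple of 0 :: v] = g v) ->
    (forall k (v : n.-tuple nat),
       f [tuple of k.+1 :: v] = h [tuple of k :: f [tuple of k :: v] :: v]) ->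
    general_recursive f
| gr_min n (g : n.+1.-tuple nat -> nat) (f : n.-tuple nat -> nat) :
    general_recursive g ->
    (forall v : n.-tuple nat, g [tuple of f v :: v] = 0) ->
    (forall (v : n.-tuple nat) k, k < f v -> g [tuple of k :: v] <> 0) ->
    general_recursive f.

Definition computable (f : nat -> nat) : Prop :=
  general_recursive (fun v : 1.-tuple nat => f (thead v)).

(** * Nondeterministic Turing machines *)

Inductive move := MoveLeft | Stay | MoveRight.

Definition ord_of_move (d : move) : 'I_3 :=
  match d with MoveLeft => inord 0 | Stay => inord 1 | MoveRight => inord 2 end.
Definition move_of_ord (i : 'I_3) : move :=
  match val i with 0 => MoveLeft | 1 => Stay | _ => MoveRight end.
Lemma ord_of_moveK : cancel ord_of_move move_of_ord.
Proof. by case; rewrite /move_of_ord /= inordK. Qed.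
HB.instance Definition _ := Finite.copy move (can_type ord_of_moveK).

(* A two-way infinite tape: the cells left of the head (nearest first), the
   scanned cell, the cells right of the head (nearest first).  Cells beyond the
   two lists are blank, the blank being [None]. *)
Definition tape (A : Type) : Type := (seq (option A) * option A * seq (option A))%type.

Section Tape.
Variable A : Type.

Definition tape_read (t : tape A) : option A := let: (_, a, _) := t in a.

Definition tape_write (a : option A) (t : tape A) : tape A :=
  let: (l, _, r) := t in (l, a, r).

Definition tape_move (d : move) (t : tape A) : tape A :=
  let: (l, a, r) := t in
  match d with
  | MoveLeft => (behead l, head None l, a :: r)
  | Stay => t
  | MoveRight => (a :: l, head None r, behead r)
  end.

Definition tape_of_word (w : seq A) : tape A :=
  ([::], ohead w, [seq Some a | a <- behead w]).

End Tape.

(* Tapes are indexed by ['I_ntm_aux.+1]; tape [ord0] holds the input.  The tape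
   symbols are the input letters, the work symbols and the blank. *)
Record ntm (Sigma : finType) := NTM {
  ntm_aux : nat;
  ntm_work : finType;
  ntm_state : finType;
  ntm_start : ntm_state;
  ntm_accept : {set ntm_state};
  ntm_trans : ntm_state -> {ffun 'I_ntm_aux.+1 -> option (Sigma + ntm_work)} ->
    {set ntm_state * {ffun 'I_ntm_aux.+1 -> option (Sigma + ntm_work) * move}}
}.

Section Runs.
Variables (Sigma : finType) (M : ntm Sigma).

Definition ntm_index : finType := 'I_(ntm_aux M).+1.
Definition ntm_letter : finType := (Sigma + ntm_work M)%type.
Definition ntm_action : finType :=
  (ntm_state M * {ffun ntm_index -> option ntm_letter * move})%type.

Definition config : Type := (ntm_state M * {ffun ntm_index -> tape ntm_letter})%type.

Definition init_config (x : seq Sigma) : config :=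
  (ntm_start M,
   [ffun i : ntm_index =>
      tape_of_word (if i == ord0 then [seq inl a : ntm_letter | a <- x] else [::])]).

Definition available (c : config) : {set ntm_action} :=
  ntm_trans c.1 [ffun i => tape_read (c.2 i)].

Definition apply_action (a : ntm_action) (c : config) : config :=
  (a.1, [ffun i => tape_move (a.2 i).2 (tape_write (a.2 i).1 (c.2 i))]).

(* [run c n m c']: a (possibly partial) run of [n] steps from [c] to [c'], of
   which [m] are nondeterministic, i.e. offer at least two transitions. *)
Inductive run : config -> nat -> nat -> config -> Prop :=
| run_refl c : run c 0 0 c
| run_step c a n m c' :
    a \in available c -> run (apply_action a c) n m c' ->
    run c n.+1 ((1 < #|available c|) + m) c'.

Definition halting (c : config) : Prop := available c = set0.

Definition accepts (x : seq Sigma) : Prop :=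
  exists n m c, [/\ run (init_config x) n m c, halting c & c.1 \in ntm_accept M].

End Runs.

(** * Parametrized problems and W[P] *)

Record parametrized_problem (Sigma : finType) := ParametrizedProblem {
  language : seq Sigma -> Prop;
  parameter : seq Sigma -> nat
}.

(* The bounds are imposed on all partial runs, so every run halts.  Logarithms
   are binary and rounded down, with log 0 = 0; other roundings or bases only
   change [h] by a constant factor. *)
Definition restricted (Sigma : finType) (rho : seq Sigma -> nat) (M : ntm Sigma) :
    Prop :=
  exists (f h : nat -> nat) (q : {poly nat}),
    [/\ computable f, computable h
      & forall x n m c, run (init_config M x) n m c ->
          n <= f (rho x) * q.[size x]%R /\ m <= h (rho x) * trunc_log 2 (size x)].

Definition in_WP (Sigma : finType) (Q : parametrized_problem Sigma) : Prop :=
  exists M : ntm Sigma,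
    restricted (parameter Q) M /\ forall x, accepts M x <-> language Q x.

(** * Simplicial complexes and elementary moves *)

(* Vertices are natural numbers, so there is always a fresh vertex. *)
Definition collection : Type := {fset {fset nat}}.

Definition simplicial_complex (K : collection) : Prop :=
  (forall s, s \in K -> s != fset0) /\
  (forall s t : {fset nat}, t \in K -> s `<=` t -> s != fset0 -> s \in K).

Definition dim_face (s : {fset nat}) : nat := #|` s|.-1.

Definition dim (K : collection) : nat := \max_(s <- K) dim_face s.

(* Nonemptiness is explicit because [dim fset0 = 0]. *)
Definition d_complex (d : nat) (K : collection) : Prop :=
  [/\ simplicial_complex K, K != fset0 & dim K = d].

Definition d_face (K : collection) (d : nat) (s : {fset nat}) : Prop :=
  s \in K /\ dim_face s = d.

Definition free_face (K : collection) (m : nat) (sigma : {fset nat}) : Prop :=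
  d_face K m.-1 sigma /\
  exists! tau : {fset nat}, d_face K m tau /\ sigma `<=` tau.

Definition m_collapse (m : nat) (K0 K1 : collection) : Prop :=
  [/\ 1 <= m, simplicial_complex K0 &
    exists tau sigma : {fset nat},
      [/\ d_face K0 m tau, sigma `<=` tau, free_face K0 m sigma
        & K1 = K0 `\` [fset tau; sigma]]].

Definition collapse (K0 K1 : collection) : Prop := exists m, m_collapse m K0 K1.

Definition expansion (K1 K0 : collection) : Prop := collapse K0 K1.

Inductive walk (step : collection -> collection -> Prop) :
    nat -> collection -> collection -> Prop :=
| walk_nil K : walk step 0 K K
| walk_cons n K K' L : step K K' -> walk step n K' L -> walk step n.+1 K L.

Definition ordered_erasible (K : collection) (p : nat) : Prop :=
  exists (K' L : collection) (a b : nat),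
    [/\ a <= p, walk expansion a K K', walk collapse b K' L & d_complex 1 L].

(** * Encoding of instances *)

Inductive symbol := Bit of bool | Comma | Semicolon.

Definition code_symbol (a : symbol) : option (option bool) :=
  match a with Bit b => Some (Some b) | Comma => Some None | Semicolon => None end.
Definition decode_symbol (a : option (option bool)) : symbol :=
  match a with Some (Some b) => Bit b | Some None => Comma | None => Semicolon end.
Lemma code_symbolK : cancel code_symbol decode_symbol.
Proof. by case. Qed.
HB.instance Definition _ := Finite.copy symbol (can_type code_symbolK).

(* Binary numerals, most significant bit first, without leading zeros; the
   numeral of 0 is "0". *)
Fixpoint bits_rec (fuel n : nat) : seq bool :=
  if fuel is fuel'.+1 then
    if n < 2 then [:: odd n] else rcons (bits_rec fuel' n./2) (odd n)
  else [:: odd n].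

Definition bits_of_nat (n : nat) : seq bool := bits_rec n n.

Definition nat_of_bits (s : seq bool) : nat := foldl (fun (n : nat) (b : bool) => n.*2 + b) 0 s.

Definition encode_nat (n : nat) : seq symbol := [seq Bit b | b <- bits_of_nat n].

Definition encode_face (s : seq nat) : seq symbol :=
  Semicolon :: flatten [seq Comma :: encode_nat v | v <- s].

(* The number p, followed by the list of all faces, each given by the list of
   its vertices. *)
Definition encode (F : seq (seq nat)) (p : nat) : seq symbol :=
  encode_nat p ++ flatten [seq encode_face s | s <- F].

(* The order of the two kinds of lists and repetitions in them are immaterial. *)
Definition complex_of (F : seq (seq nat)) : collection :=
  [fset [fset v | v in s] | s : seq nat in F].

Fixpoint leading_bits (w : seq symbol) : seq bool :=
  if w is Bit b :: w' then b :: leading_bits w' else [::].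

(* On words that do not encode an instance the parameter is still read off the
   leading block of bits; on instances see [parameter_encode]. *)
Definition ordered_erasibility_expansion_height : parametrized_problem symbol :=
  {| language := fun w => exists (F : seq (seq nat)) (p : nat),
       [/\ w = encode F p, d_complex 2 (complex_of F)
         & ordered_erasible (complex_of F) p];
     parameter := fun w => nat_of_bits (leading_bits w) |}.

Lemma bits_of_natK : cancel bits_of_nat nat_of_bits.
Proof.
have rec_ok k n : n <= k -> nat_of_bits (bits_rec k n) = n.
  elim: k n => [|k IH] [|[|n]] //; rewrite !ltnS => lenk.
  rewrite /= /nat_of_bits foldl_rcons -/(nat_of_bits _) IH.
    by rewrite addnC -/(odd n.+2) -/(n.+2./2) odd_double_half.
  by rewrite (leq_ltn_trans _ lenk) // -divn2 leq_div.
by move=> n; apply: rec_ok.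
Qed.

Lemma parameter_encode F p :
  parameter ordered_erasibility_expansion_height (encode F p) = p.
Proof.
rewrite /= -[RHS]bits_of_natK /encode /encode_nat; congr nat_of_bits.
elim: (bits_of_nat p) => [|b s IH] /=; last by rewrite IH.
by case: F.
Qed.

(* Main.v *)
From HB Require Import structures.
From mathcomp Require Import all_boot all_algebra.
From mathcomp Require Import finmap zify.
From Stdlib Require Import FunctionalExtensionality.
Require Import Defs.

(* A guess-and-check machine.  The instance has at most |x| faces, and after at
   most p expansions at most |x| + 2p, so an expansion is described by three
   choices from lists of length |x| + 2p (an old facet [t] of the new simplex
   [v :: t], the vertex [v], and the vertex [u] opposite to the free face), and a
   collapse by two.  Collapses of dimension at least 3 may be performed first, and
   there are at most 2p of them because every expansion adds only two faces.  For
   the remaining 2-dimensional complex the greedy collapse of triangles is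
   optimal: if it gets stuck, the remaining triangles form a set in which no
   triangle has a free edge, and no sequence of collapses can remove the first
   triangle of such a set.  Hence O(p^2) blocks of log |x| guessed bits suffice,
   followed by a computation that is polynomial in |x| + p.

   Machines come from a small structured language on stacks.  Binary trees are
   written on the stacks in preorder, and the functions on trees computed in
   polynomial time are closed under pairing, branching and folds over lists as
   long as all intermediate values stay polynomially small; the verifier is
   obtained from these closure properties. *)

Set Implicit Arguments.
Unset Strict Implicit.
Unset Printing Implicit Defensive.
Local Open Scope fset_scope.
Local Open Scope nat_scope.

(** * A structured language for multi-stack machines *)

(** The resource bounds must hold on every run, also on words that encode no instance. What follows
    the guessing is a deterministic function, to which closure properties apply. Numbers are kept in
    unary. The parameter, given in binary, may be exponential in |x|; this is tolerable because the
    running time may depend on |x| + p. Vertex names may be exponential too, and no parameter pays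
    for them: they are replaced by their positions in the input, which is legitimate because
    erasibility is invariant under injective renaming. The same invariance confines new vertices to
    p fixed numbers. High collapses can come first because freeness below a simplex with more than
    three vertices only concerns simplices of the same size, which postponed lower collapses leave
    alone. The target must have dimension exactly 1; this holds because collapsing a simplex of
    dimension at least 2 leaves another facet of it, hence an edge. *)

Definition letter : finType := (symbol + option bool)%type.
Definition Nd_letter : letter := inr (Some true).
Definition Lf_letter : letter := inr (Some false).
Definition mark : letter := inr None.

(** [RI] is the input tape, [RM] the main stack carrying the trees, [RA] and [RB] hold trees put
    aside, and [RC] is the counter of [stash]. During the guessing loop [RA] holds the number of
    bits still to be guessed, in unary. *)
Inductive reg := RI | RM | RA | RB | RC.
Definition reg_eq_dec (r r' : reg) : {r = r'} + {r <> r'}.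
Proof. by decide equality. Defined.

Definition reg_index (r : reg) : 'I_5 :=
  match r with
  | RI => ord0 | RM => inord 1 | RA => inord 2 | RB => inord 3 | RC => inord 4
  end.

Lemma reg_index_inj : injective reg_index.
Proof. by case; case=> // /(congr1 val) /=; rewrite ?inordK. Qed.

Record store := Store {
  stI : seq letter; stM : seq letter; stA : seq letter; stB : seq letter;
  stC : seq letter }.

Definition get (r : reg) (S : store) : seq letter :=
  match r with
  | RI => stI S | RM => stM S | RA => stA S | RB => stB S | RC => stC S
  end.

Definition put (r : reg) (s : seq letter) (S : store) : store :=
  let: Store i m a b c := S in
  match r with
  | RI => Store s m a b c | RM => Store i s a b c | RA => Store i m s b c
  | RB => Store i m a s c | RC => Store i m a b s
  end.

Lemma get_put r s S : get r (put r s S) = s.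
Proof. by case: r; case: S. Qed.

Lemma get_put_neq r r' s S : r' <> r -> get r' (put r s S) = get r' S.
Proof. by case: r; case: r'; case: S. Qed.

Inductive cmd :=
| Skip
| Push (r : reg) (a : letter)
| Copy (x y : reg)
| Pop (r : reg)
| Seq (c1 c2 : cmd)
| If (r : reg) (b : option letter -> bool) (c1 c2 : cmd)
| While (r : reg) (b : option letter -> bool) (c : cmd).

(* The number is an upper bound on the number of machine steps. *)
Inductive ex : cmd -> store -> nat -> store -> Prop :=
| ex_skip S : ex Skip S 0 S
| ex_push r a S : ex (Push r a) S 2 (put r (a :: get r S) S)
| ex_copy x y a s S : x <> y -> get x S = a :: s ->
    ex (Copy x y) S 2 (put y (a :: get y S) S)
| ex_pop r S : ex (Pop r) S 1 (put r (behead (get r S)) S)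
| ex_seq c1 c2 S n S1 m S2 :
    ex c1 S n S1 -> ex c2 S1 m S2 -> ex (Seq c1 c2) S (n + m) S2
| ex_if_true r (b : option letter -> bool) c1 c2 S n S' :
    b (ohead (get r S)) -> ex c1 S n S' -> ex (If r b c1 c2) S n.+2 S'
| ex_if_false r (b : option letter -> bool) c1 c2 S n S' :
    b (ohead (get r S)) = false -> ex c2 S n S' -> ex (If r b c1 c2) S n.+2 S'
| ex_while_true r (b : option letter -> bool) c S n S1 m S2 :
    b (ohead (get r S)) -> ex c S n S1 -> ex (While r b c) S1 m S2 ->
    ex (While r b c) S (n + m + 2) S2
| ex_while_false r (b : option letter -> bool) c S :
    b (ohead (get r S)) = false -> ex (While r b c) S 1 S
| ex_le c S n m S' : ex c S n S' -> n <= m -> ex c S m S'.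

Inductive instr :=
| Act (r x : reg) (g : option letter -> option letter -> option letter) (d : move)
| Br (r : reg) (b : option letter -> bool) (t : nat)
| Flip (t : nat)
| Stop.

Definition Jmp (t : nat) : instr := Br RI xpredT t.

Fixpoint clen (c : cmd) : nat :=
  match c with
  | Skip => 0
  | Push _ _ | Copy _ _ => 2
  | Pop _ => 1
  | Seq c1 c2 => clen c1 + clen c2
  | If _ _ c1 c2 => (clen c2 + clen c1).+2
  | While _ _ c => (clen c).+2
  end.

(** Stacks grow to the left. A transition writes before it moves, so a push takes two instructions:
    move left keeping the scanned letter, then write on the blank cell. A pop blanks the cell and
    moves right. In a conditional the code of the else-branch comes first. *)
Fixpoint compile (c : cmd) (pc : nat) : seq instr :=
  match c with
  | Skip => [::]
  | Push r a =>
      [:: Act r r (fun o _ => o) MoveLeft; Act r r (fun _ _ => Some a) Stay]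
  | Copy x y => [:: Act y y (fun o _ => o) MoveLeft; Act y x (fun _ o => o) Stay]
  | Pop r => [:: Act r r (fun _ _ => None) MoveRight]
  | Seq c1 c2 => compile c1 pc ++ compile c2 (pc + clen c1)
  | If r b c1 c2 =>
      Br r b (pc + (clen c2).+2) :: compile c2 pc.+1 ++
      Jmp (pc + (clen c2 + clen c1).+2) :: compile c1 (pc + (clen c2).+2)
  | While r b c =>
      Br r (fun o => ~~ b o) (pc + (clen c).+2) :: rcons (compile c pc.+1) (Jmp pc)
  end.

Lemma size_compile c pc : size (compile c pc) = clen c.
Proof.
elim: c pc => //= [c1 IH1 c2 IH2|r b c1 IH1 c2 IH2|r b c IH] pc.
- by rewrite size_cat IH1 IH2.
- by rewrite size_cat /= IH1 IH2 addnS.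
- by rewrite size_rcons IH.
Qed.

(** * The Turing machine of a code *)

(** The extra state [size C] reads the default [Stop] of [nth]. Only [Flip] can offer two
    transitions, and it offers one if its targets coincide. *)
Definition code_trans (C : seq instr) (q : 'I_(size C).+1)
    (rd : {ffun 'I_5 -> option letter}) :
    {set 'I_(size C).+1 * {ffun 'I_5 -> option letter * move}} :=
  match nth Stop C q with
  | Act r x g d =>
      [set (inord q.+1, [ffun j => if j == reg_index r
              then (g (rd j) (rd (reg_index x)), d) else (rd j, Stay)])]
  | Br r b t =>
      [set (inord (if b (rd (reg_index r)) then t else q.+1),
            [ffun j => (rd j, Stay)])]
  | Flip t =>
      [set (inord q.+1, [ffun j => (rd j, Stay)]); (inord t, [ffun j => (rd j, Stay)])]
  | Stop => set0
  end.

Definition code_ntm (C : seq instr) (e : nat) : ntm symbol :=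
  @NTM symbol 4 (option bool) 'I_(size C).+1 ord0 [set inord e] (@code_trans C).

(** * Deterministic stretches of runs, and bounds on all runs *)

Section Machine.
Variables (Sigma : finType) (M : ntm Sigma).

Inductive dreach : config M -> nat -> config M -> Prop :=
| dreach_refl c : dreach c 0 c
| dreach_step c a n c' :
    available c = [set a] -> dreach (apply_action a c) n c' -> dreach c n.+1 c'.

(** Restrictedness speaks of every partial run, so the bounds range over all of them. [Q] is
    required of halting configurations only; it will say that acceptance yields a witness. *)
Definition bounded (Q : config M -> Prop) (c : config M) (t m : nat) : Prop :=
  forall n m' c', run c n m' c' -> [/\ n <= t, m' <= m & halting c' -> Q c'].

Lemma dreach_trans c1 n1 c2 n2 c3 :
  dreach c1 n1 c2 -> dreach c2 n2 c3 -> dreach c1 (n1 + n2) c3.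
Proof.
elim=> // c a n c' Ha _ IH H; rewrite addSn.
exact: dreach_step Ha (IH H).
Qed.

Lemma run_dreach (c : config M) n (c' : config M) n' m (d : config M) : dreach c n c' -> run c' n' m d -> run c (n + n') m d.
Proof.
elim=> // {}c a k {}c' Ha _ IH H.
have := run_step (a := a) _ (IH H); rewrite Ha set11 cards1 /= => /(_ isT).
by [].
Qed.

Lemma run_trans (c : config M) n m (c' : config M) n' m' (d : config M) :
  run c n m c' -> run c' n' m' d -> run c (n + n') (m + m') d.
Proof.
elim=> // {}c a k l {}c' Ha _ IH H; rewrite addSn -addnA.
exact: run_step Ha (IH H).
Qed.

Lemma bounded_le Q c t m t' m' :
  bounded Q c t m -> t <= t' -> m <= m' -> bounded Q c t' m'.
Proof.
move=> H le1 le2 n k c' /H [h1 h2 h3]; split=> //; first exact: leq_trans h1 le1.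
exact: leq_trans h2 le2.
Qed.

Lemma run_inv (c : config M) n m (c' : config M) : run c n m c' ->
  [/\ n = 0, m = 0 & c' = c] \/ exists a n' m', [/\ a \in available c,
    run (apply_action a c) n' m' c', n = n'.+1 & m = (1 < #|available c|) + m'].
Proof. by case=> [|{}c a k l {}c' Ha H]; [left | right; exists a, k, l]. Qed.

Lemma bounded_dreach Q c n c' t m :
  dreach c n c' -> bounded Q c' t m -> bounded Q c (n + t) m.
Proof.
elim=> // {}c a k {}c' Ha _ IH H k1 m1 d /run_inv [[-> -> ->]|[a0 [n0 [m0 []]]]].
  by split=> //; rewrite /halting Ha => /setP/(_ a); rewrite !inE eqxx.
rewrite Ha inE => /eqP -> Hr -> ->.
have [h1 h2 h3] := IH H _ _ _ Hr.
by rewrite cards1 /= addSn ltnS.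
Qed.

Lemma bounded_halting (Q : config M -> Prop) c : halting c -> Q c -> bounded Q c 0 0.
Proof.
move=> H HQ n m c' /run_inv [[-> -> ->]//|[a0 [n0 [m0 []]]]].
by rewrite /halting in H; rewrite H inE.
Qed.

Lemma bounded_branch Q c t m : ~ halting c ->
  (forall a, a \in available c -> bounded Q (apply_action a c) t m) ->
  bounded Q c t.+1 m.+1.
Proof.
move=> Hh H n k c' /run_inv [[-> -> ->]//|[a0 [n0 [m0 [Ha Hr -> ->]]]]].
have [h1 h2 h3] := H _ Ha _ _ _ Hr; split=> //.
by rewrite -(add1n m) leq_add // leq_b1.
Qed.

End Machine.

(* Every cell outside [s] is blank. *)
Definition is_stack (t : tape letter) (s : seq letter) : Prop :=
  let: (l, a, r) := t in
  all (eq_op^~ None) l /\ exists k, a :: r = map Some s ++ nseq k None.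

Lemma is_stack_read t s : is_stack t s -> tape_read t = ohead s.
Proof. by case: t => [[l a] r] [_ [[|k]]]; case: s => [|x s] //= [->]. Qed.

Lemma is_stack_write t s a o : is_stack t s ->
  is_stack (tape_move Stay (tape_write (Some a) (tape_move MoveLeft (tape_write o t))))
    (a :: s) \/ o <> tape_read t.
Proof.
case: t => [[l x] r] [Hl [k Hk]].
have [->|ne] := eqVneq o x; last by right; apply/eqP.
left; split; first by case: l Hl => //= y l /andP [].
by exists k; rewrite /= Hk.
Qed.

Lemma is_stack_push t s a : is_stack t s ->
  is_stack (tape_move Stay (tape_write (Some a)
     (tape_move MoveLeft (tape_write (tape_read t) t)))) (a :: s).
Proof. by move=> /(is_stack_write a (tape_read t)) []. Qed.

Lemma is_stack_pop t s : is_stack t s ->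
  is_stack (tape_move MoveRight (tape_write None t)) (behead s).
Proof.
case: t => [[l x] r] [Hl [k Hk]]; split; first by rewrite /= Hl.
case: s Hk => [|y s] /=.
  by case: k => [|[|k]] //= [_ ->]; [exists 1 | exists k.+1].
move=> [_ ->]; case: s => [|z s] /=; last by exists k.
by case: k => [|k]; [exists 1 | exists k.+1].
Qed.

(** * Simulation of commands by the machine *)

Section CodeRuns.
Variables (C : seq instr) (e : nat).
Let M := code_ntm C e.

Definition tapes : Type := {ffun ntm_index M -> tape (ntm_letter M)}.

Definition cfg (pc : nat) (T : tapes) : config M := (inord pc : 'I_(size C).+1, T).

Definition represents (T : tapes) (S : store) : Prop :=
  forall r, is_stack (T (reg_index r)) (get r S).

Definition code_at (pc : nat) (k : seq instr) : Prop :=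
  exists C1 C2, C = C1 ++ k ++ C2 /\ size C1 = pc.

Lemma code_at_cat pc k1 k2 :
  code_at pc (k1 ++ k2) -> code_at pc k1 /\ code_at (pc + size k1) k2.
Proof.
move=> [C1 [C2 [E <-]]]; rewrite /code_at E.
split; first by exists C1, (k2 ++ C2); rewrite -!catA.
by exists (C1 ++ k1), C2; rewrite size_cat !catA.
Qed.

Lemma code_at_cons pc i k : code_at pc (i :: k) ->
  [/\ pc < size C, nth Stop C pc = i & code_at pc.+1 k].
Proof.
move=> [C1 [C2 [E <-]]]; rewrite /code_at E; split.
- by rewrite size_cat /= addnS ltnS leq_addr.
- by rewrite nth_cat ltnn subnn.
- by exists (rcons C1 i), C2; rewrite cat_rcons size_rcons.
Qed.

Lemma keep_tape (t : tape letter) : tape_move Stay (tape_write (tape_read t) t) = t.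
Proof. by case: t => [[]]. Qed.

Lemma available_cfg pc T : pc < size C ->
  available (cfg pc T) = @code_trans C (inord pc) [ffun i => tape_read (T i)].
Proof. by []. Qed.

Lemma cfg_act pc T r x g d : pc < size C -> nth Stop C pc = Act r x g d ->
  exists T', [/\ dreach (cfg pc T) 1 (cfg pc.+1 T'),
    T' (reg_index r) = tape_move d (tape_write
       (g (tape_read (T (reg_index r))) (tape_read (T (reg_index x)))) (T (reg_index r)))
    & forall r', r' <> r -> T' (reg_index r') = T (reg_index r')].
Proof.
move=> lt_pc E.
set rd : {ffun 'I_5 -> option letter} := [ffun i => tape_read (T i)].
set a : ntm_action M := (inord pc.+1 : 'I_(size C).+1,
  [ffun j => if j == reg_index r
     then (g (rd j) (rd (reg_index x)), d) else (rd j, Stay)]).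
have Ha : available (cfg pc T) = [set a].
  by rewrite available_cfg // /code_trans inordK ?E // ltnS ltnW.
exists (apply_action a (cfg pc T)).2; split.
- apply: dreach_step Ha _; exact: dreach_refl.
- by rewrite /= !ffunE eqxx /=.
- move=> r' ne; rewrite /= !ffunE.
  case: eqP => [/reg_index_inj //|_]; exact: keep_tape.
Qed.

Lemma apply_keep pc (T : tapes) q : apply_action (M := M)
    (inord q : 'I_(size C).+1,
     [ffun j => (([ffun i => tape_read (T i)] : {ffun 'I_5 -> option letter}) j, Stay)])
    (cfg pc T) = cfg q T.
Proof.
congr pair; apply/ffunP => j; rewrite !ffunE; exact: keep_tape.
Qed.

Lemma cfg_br pc T S r b t : pc < size C -> nth Stop C pc = Br r b t ->
  represents T S ->
  dreach (cfg pc T) 1 (cfg (if b (ohead (get r S)) then t else pc.+1) T).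
Proof.
move=> lt_pc E HT; rewrite -(is_stack_read (HT r)).
set q := if _ then _ else _.
apply: dreach_step; last by rewrite -(apply_keep pc T q); apply: dreach_refl.
by rewrite available_cfg // /code_trans inordK ?E ?ffunE // ltnS ltnW.
Qed.

Lemma cfg_flip pc T t : pc < size C -> nth Stop C pc = Flip t ->
  (exists m, run (cfg pc T) 1 m (cfg pc.+1 T)) /\
  (exists m, run (cfg pc T) 1 m (cfg t T)) /\
  (forall Q n m, bounded Q (cfg pc.+1 T) n m -> bounded Q (cfg t T) n m ->
     bounded Q (cfg pc T) n.+1 m.+1).
Proof.
move=> lt_pc E; rewrite -(apply_keep pc T pc.+1) -(apply_keep pc T t).
have Ha : available (cfg pc T) = @code_trans C (inord pc) [ffun i => tape_read (T i)] by [].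
rewrite /code_trans inordK ?E in Ha; last by rewrite ltnS ltnW.
split; [|split].
- by eexists; apply: run_step (run_refl _); rewrite Ha !inE eqxx.
- by eexists; apply: run_step (run_refl _); rewrite Ha !inE eqxx orbT.
- move=> Q n m H1 H2; apply: bounded_branch.
    by rewrite /halting Ha => /eqP; rewrite -subset0 subUset sub1set inE.
  by move=> a; rewrite Ha !inE; case/orP => /eqP ->.
Qed.

Lemma cfg_jmp pc T t : pc < size C -> nth Stop C pc = Jmp t ->
  dreach (cfg pc T) 1 (cfg t T).
Proof.
move=> lt_pc E.
apply: dreach_step; last by rewrite -(apply_keep pc T t); apply: dreach_refl.
by rewrite available_cfg // /code_trans inordK ?E ?ffunE // ltnS ltnW.
Qed.

(** Induction on the derivation of [ex], not on the command: the last premise of [ex_while_true] is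
    the same loop again, whose code is still located at [pc]. The step count is only bounded because
    the costs in [ex] are upper bounds. *)
Lemma compile_correct c S n S' : ex c S n S' -> forall pc T,
  code_at pc (compile c pc) -> represents T S ->
  exists T' n', [/\ n' <= n, represents T' S' & dreach (cfg pc T) n' (cfg (pc + clen c) T')].
Proof.
elim=> {c S n S'}.
- move=> S pc T _ HT; exists T, 0; rewrite addn0; split=> //; exact: dreach_refl.
- move=> r a S pc T /= /code_at_cons [l1 e1 /code_at_cons [l2 e2 _]] HT.
  have [T1 [d1 h1 k1]] := cfg_act T l1 e1; have [T2 [d2 h2 k2]] := cfg_act T1 l2 e2.
  exists T2, 2; rewrite addn2; split=> //; last exact: dreach_trans d1 d2.
  move=> r'; case: (reg_eq_dec r' r) => [->|ne].
    by rewrite get_put h2 h1; apply: is_stack_push; apply: HT.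
  by rewrite get_put_neq // k2 // k1.
- move=> x y a s S ne_xy Ex pc T /= /code_at_cons [l1 e1 /code_at_cons [l2 e2 _]] HT.
  have [T1 [d1 h1 k1]] := cfg_act T l1 e1; have [T2 [d2 h2 k2]] := cfg_act T1 l2 e2.
  exists T2, 2; rewrite addn2; split=> //; last exact: dreach_trans d1 d2.
  move=> r'; case: (reg_eq_dec r' y) => [->|ne].
    rewrite get_put h2 h1 k1 // (is_stack_read (HT x)) Ex.
    by apply: is_stack_push; apply: HT.
  by rewrite get_put_neq // k2 // k1.
- move=> r S pc T /= /code_at_cons [l1 e1 _] HT.
  have [T1 [d1 h1 k1]] := cfg_act T l1 e1.
  exists T1, 1; rewrite addn1; split=> //.
  move=> r'; case: (reg_eq_dec r' r) => [->|ne].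
    by rewrite get_put h1; apply: is_stack_pop; apply: HT.
  by rewrite get_put_neq // k1.
- move=> c1 c2 S n S1 m S2 _ IH1 _ IH2 pc T /= /code_at_cat [].
  rewrite size_compile => a1 a2 HT.
  have [T1 [n1 [le1 HT1 d1]]] := IH1 _ _ a1 HT.
  have [T2 [n2 [le2 HT2 d2]]] := IH2 _ _ a2 HT1.
  exists T2, (n1 + n2); rewrite addnA leq_add //; split=> //.
  exact: dreach_trans d1 d2.
- move=> r b c1 c2 S n S' Hb _ IH pc T /= /code_at_cons [l1 e1] /code_at_cat [_].
  rewrite size_compile => /code_at_cons [_ _]; rewrite addSn -!addnS => a1 HT.
  have := cfg_br l1 e1 HT; rewrite Hb => d1.
  have [T1 [n1 [le1 HT1 d2]]] := IH _ _ a1 HT.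
  exists T1, n1.+1; split=> //; first by rewrite ltnW.
  rewrite -add1n; apply: dreach_trans d1 _.
  by move: d2; congr (dreach _ _ (cfg _ _)); lia.
- move=> r b c1 c2 S n S' Hb _ IH pc T /= /code_at_cons [l1 e1] /code_at_cat [a1].
  rewrite size_compile => /code_at_cons [l2 e2 _] HT.
  have := cfg_br l1 e1 HT; rewrite Hb => d1.
  have [T1 [n1 [le1 HT1 d2]]] := IH _ _ a1 HT.
  exists T1, (1 + (n1 + 1)); split=> //; first by lia.
  by apply: dreach_trans d1 _; apply: dreach_trans d2 _; apply: cfg_jmp.
- move=> r b c S n S1 m S2 Hb _ IH1 _ IH2 pc T Hc HT; have := Hc.
  rewrite /= => /code_at_cons [l1 e1]; rewrite -cats1 => /code_at_cat [a1].
  rewrite size_compile => /code_at_cons [l2 e2 _].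
  have := cfg_br l1 e1 HT; rewrite Hb /= => d1.
  have [T1 [n1 [le1 HT1 d2]]] := IH1 _ _ a1 HT.
  have [T2 [n2 [le2 HT2 d3]]] := IH2 _ _ Hc HT1.
  exists T2, (1 + (n1 + (1 + n2))); split=> //; first by lia.
  apply: dreach_trans d1 _; apply: dreach_trans d2 _; apply: dreach_trans d3.
  exact: cfg_jmp.
- move=> r b c S Hb pc T /= /code_at_cons [l1 e1 _] HT.
  have := cfg_br l1 e1 HT; rewrite Hb /= => d1.
  by exists T, 1.
- move=> c S n m S' _ IH le pc T a HT.
  have [T' [n' [le' HT' d']]] := IH pc T a HT.
  by exists T', n'; rewrite (leq_trans le').
Qed.

(** * The guessing loop *)

(** The preorder code of [b] under the later encoding [enc_bool]; preceded by a [Node] letter it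
    conses [b] onto the list of guesses on [RM]. *)
Definition bit_letters (b : bool) : seq letter :=
  if b then [:: Nd_letter; Lf_letter; Lf_letter] else [:: Lf_letter].

Definition push_bit (b : bool) : cmd :=
  if b then Seq (Seq (Push RM Lf_letter) (Push RM Lf_letter))
                (Seq (Push RM Nd_letter) (Push RM Nd_letter))
  else Seq (Push RM Lf_letter) (Push RM Nd_letter).

(** One round leaves the loop if [RA] is empty, and otherwise pops it, flips, pushes [false] (from
    [pc + 3]) or [true] (from [pc + 8]) and jumps back. The code has 1 + 1 + 1 + 4 + 1 + 8 + 1 = 17
    instructions. *)
Definition guess_code (pc : nat) : seq instr :=
  Br RA (fun o => o == None) (pc + 17) :: compile (Pop RA) pc.+1 ++
  Flip (pc + 8) :: compile (push_bit false) (pc + 3) ++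
  Jmp pc :: compile (push_bit true) (pc + 8) ++ [:: Jmp pc].

Definition guessed (bs : seq bool) (S : store) : store :=
  put RA [::] (put RM (foldl (fun s b => Nd_letter :: bit_letters b ++ s) (stM S) bs) S).

Lemma ex_push_bit b S :
  ex (push_bit b) S 8 (put RM (Nd_letter :: bit_letters b ++ stM S) S).
Proof.
case: S => i m a bb c; have p := ex_push; case: b.
  exact: (ex_seq (ex_seq (p _ _ _) (p _ _ _)) (ex_seq (p _ _ _) (p _ _ _))).
by apply: (@ex_le _ _ (2 + 2)) => //; apply: (ex_seq (p _ _ _) (p _ _ _)).
Qed.

Lemma guess_body pc : code_at pc (guess_code pc) ->
  [/\ pc < size C, nth Stop C pc = Br RA (fun o => o == None) (pc + 17),
    code_at pc.+1 (compile (Pop RA) pc.+1),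
    pc + 2 < size C /\ nth Stop C (pc + 2) = Flip (pc + 8) &
    forall b T S, represents T S -> exists T' n, [/\ n <= 9,
      represents T' (put RM (Nd_letter :: bit_letters b ++ stM S) S)
      & dreach (cfg (if b then pc + 8 else pc + 3) T) n (cfg pc T')]].
Proof.
rewrite /guess_code => /code_at_cons [l1 e1] /code_at_cat [a1].
rewrite size_compile addSnnS => /code_at_cons [l2 e2].
rewrite -addnS => /code_at_cat [a2]; rewrite size_compile -addnA.
move=> /code_at_cons [l3 e3]; rewrite -addnS => /code_at_cat [a3].
rewrite size_compile -addnA => /code_at_cons [l4 e4 _].
have {}a2 := compile_correct (ex_push_bit false _) a2.
have {}a3 := compile_correct (ex_push_bit true _) a3.
move: l1 e1 a1 l2 e2 l3 e3 l4 e4 a2 a3.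
rewrite !(addnS, addSn, addn0) /= => l1 e1 a1 l2 e2 l3 e3 l4 e4 a2 a3.
split=> // -[] T S HT.
- have [T1 [n1 [le1 H1 d1]]] := a3 _ _ HT.
  exists T1, (n1 + 1); split; [by lia | done | apply: dreach_trans d1 _].
  by rewrite /= ?(addnS, addSn, addn0); apply: cfg_jmp.
- have [T1 [n1 [le1 H1 d1]]] := a2 _ _ HT.
  exists T1, (n1 + 1); split; [by lia | done | apply: dreach_trans d1 _].
  by rewrite /= ?(addnS, addSn, addn0); apply: cfg_jmp.
Qed.

Lemma guess_run pc bs T S : code_at pc (guess_code pc) -> represents T S ->
  size (stA S) = size bs ->
  exists T' n m, represents T' (guessed bs S) /\ run (cfg pc T) n m (cfg (pc + 17) T').
Proof.
move=> Hc; have [l1 e1 a1 [l2 e2] Hb] := guess_body Hc.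
elim: bs T S => [|b bs IH] T [i m a bb c] HT /=.
  move=> /eqP/nilP ea; subst a; exists T, 1, 0; split=> //.
  have := cfg_br l1 e1 HT; rewrite /= => d; rewrite -[1]addn0.
  exact: run_dreach d (run_refl _).
case: a HT => //= x a HT [Es].
have := cfg_br l1 e1 HT; rewrite /= => d1.
have [T1 [n1 [_ H1 d2]]] := compile_correct (ex_pop RA _) a1 HT.
have [f1 [f2 _]] := cfg_flip T1 l2 e2.
have [T2 [n2 [_ H2 d3]]] := Hb b _ _ H1.
have [T3 [n3 [m3 [H3 r3]]]] := IH _ _ H2 Es.
have {f1 f2} [k rk] : exists k, run (cfg (pc + 2) T1) 1 k
    (cfg (if b then pc + 8 else pc + 3) T1).
  by move: f1 f2; rewrite -addnS; case: (b).
exists T3, (1 + (n1 + (1 + (n2 + n3)))), (k + m3); split=> //.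
apply: run_dreach d1 _; apply: run_dreach d2 _; rewrite /= addn1 -addn2.
exact: run_trans rk (run_dreach d3 r3).
Qed.

(** A round costs at most 12 steps: branch, pop, flip, at most 8 for the push, and the jump back. It
    contains one flip. The final 1 is the branch that leaves the loop. *)
Lemma guess_bounded Q pc t m T S : code_at pc (guess_code pc) -> represents T S ->
  (forall bs T', size bs = size (stA S) -> represents T' (guessed bs S) ->
     bounded Q (cfg (pc + 17) T') t m) ->
  bounded Q (cfg pc T) (t + 12 * size (stA S) + 1) (m + size (stA S)).
Proof.
move=> Hc; have [l1 e1 a1 [l2 e2] Hb] := guess_body Hc.
case: S => i s a bb c; elim: a T s => [|x a IH] T s HT /= H.
  have := cfg_br l1 e1 HT; rewrite /= => d.
  rewrite addnC !addn0; apply: bounded_dreach d _; exact: (H [::]).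
have := cfg_br l1 e1 HT; rewrite /= => d1.
have [T1 [n1 [l3 H1 d2]]] := compile_correct (ex_pop RA _) a1 HT.
have [_ [_ f]] := cfg_flip T1 l2 e2.
have {}Hb b : bounded Q (cfg (if b then pc + 8 else pc + 3) T1)
    (9 + (t + 12 * size a + 1)) (m + size a).
  have [T2 [n2 [l4 H2 d3]]] := Hb b _ _ H1.
  apply: (bounded_le (t := n2 + (t + 12 * size a + 1)) (m := m + size a)) => //.
  - apply: bounded_dreach d3 _; apply: (IH T2 _ H2) => bs T' Es.
    by apply: (H (b :: bs)); rewrite /= Es.
  - by rewrite leq_add2r.
have B := f _ _ _ _ (Hb true).
apply: bounded_le (bounded_dreach d1 (bounded_dreach d2 _)) _ _.
- by rewrite /= addn1 -addn2; apply: B; rewrite -addnS; apply: (Hb false).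
- by move: l3 => /=; lia.
- by rewrite addnS.
Qed.

Lemma cfg_stop pc T : nth Stop C pc = Stop -> pc <= size C -> halting (cfg pc T).
Proof.
move=> E le; have Ha : available (cfg pc T) =
  @code_trans C (inord pc) [ffun i => tape_read (T i)] by [].
by rewrite /halting Ha /code_trans inordK ?E // ltnS.
Qed.

End CodeRuns.

(** * The machine that prepares, guesses and checks *)

Section GuessAndCheck.
Variables (P1 P3 : cmd) (S1 : seq symbol -> store) (g t1 t3 : seq symbol -> nat).
Variable v : seq symbol -> seq bool -> bool.
Hypothesis P1_ok : forall x, ex P1 (Store [seq inl a | a <- x] [::] [::] [::] [::]) (t1 x) (S1 x).
Hypothesis S1_size : forall x, size (stA (S1 x)) = g x.
Hypothesis P3_ok : forall x bs, size bs = g x -> exists S,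
  ex P3 (guessed bs (S1 x)) (t3 x) S /\ (ohead (stM S) == Some Nd_letter) = v x bs.

(** The verdict is the top letter of [RM]. There are two [Stop] instructions so that rejection, at
    [whole_end + 1], and acceptance, at [whole_end + 2], are different states. *)
Definition whole_code : seq instr :=
  compile P1 0 ++ guess_code (clen P1) ++ compile P3 (clen P1 + 17) ++
  [:: Br RM (fun o => o == Some Nd_letter) (clen P1 + 17 + clen P3 + 2); Stop; Stop].

Definition whole_end : nat := clen P1 + 17 + clen P3.

Definition guess_ntm : ntm symbol := code_ntm whole_code (whole_end + 2).

Lemma whole_codeP :
  [/\ code_at whole_code 0 (compile P1 0),
    code_at whole_code (clen P1) (guess_code (clen P1)),
    code_at whole_code (clen P1 + 17) (compile P3 (clen P1 + 17)),
    size whole_code = whole_end + 3 &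
    nth Stop whole_code whole_end = Br RM (fun o => o == Some Nd_letter) (whole_end + 2) /\
    forall i, nth Stop whole_code (whole_end + i.+1) = Stop].
Proof.
have sg : size (guess_code (clen P1)) = 17 by [].
have a0 : code_at whole_code 0 whole_code by exists [::], [::]; rewrite cats0.
have [a1] := code_at_cat a0; rewrite size_compile add0n => /code_at_cat [a2].
rewrite sg => /code_at_cat [a3]; rewrite size_compile => a4.
have [l5 e5 _] := code_at_cons a4.
have es : size whole_code = whole_end + 3.
  by rewrite !size_cat !size_compile sg /= /whole_end !addnA.
split=> //; split=> // i.
have -> : whole_code = (compile P1 0 ++ guess_code (clen P1) ++
    compile P3 (clen P1 + 17)) ++ [:: Br RM (fun o => o == Some Nd_letter)
      (whole_end + 2); Stop; Stop] by rewrite -!catA.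
rewrite nth_cat !size_cat sg !size_compile addnA ltnNge leq_addr addKn /=.
by rewrite (nth_nseq Stop 2 Stop i) if_same.
Qed.

Lemma represents_init x : represents (init_config guess_ntm x).2
  (Store [seq inl a | a <- x] [::] [::] [::] [::]).
Proof.
have blank : is_stack (tape_of_word [::]) [::] by split=> //; exists 1.
by case; rewrite ffunE; try (rewrite -val_eqE /= inordK //; exact: blank);
  case: x => [|a x]; split=> //; [exists 1 | exists 0; rewrite cats0].
Qed.

Lemma init_cfg x : exists T,
  init_config guess_ntm x = cfg (C := whole_code) (e := whole_end + 2) 0 T /\
  represents T (Store [seq inl a | a <- x] [::] [::] [::] [::]).
Proof.
exists (init_config guess_ntm x).2; split; last exact: represents_init.
by congr pair; apply: val_inj; rewrite /= inordK.
Qed.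

Lemma guess_ntm_end x bs T : size bs = g x -> represents T (guessed bs (S1 x)) ->
  exists n q T', [/\ n <= t3 x + 1,
    dreach (cfg (C := whole_code) (e := whole_end + 2) (clen P1 + 17) T) n
      (cfg q T'), halting (cfg (C := whole_code) (e := whole_end + 2) q T') &
    ((cfg (C := whole_code) (e := whole_end + 2) q T').1 \in ntm_accept guess_ntm) = v x bs].
Proof.
move=> sz HT; have [S [H3 Hv]] := P3_ok sz.
have [_ _ a3 es [e1 e2]] := whole_codeP.
have [T3 [n3 [le3 H3T d3]]] := compile_correct (e := whole_end + 2) H3 a3 HT.
have lt_end : whole_end < size whole_code by rewrite es -addn1 leq_add2l.
have := cfg_br (e := whole_end + 2) lt_end e1 H3T; rewrite /= Hv => d4.
exists (n3 + 1), (if v x bs then whole_end + 2 else whole_end.+1), T3; split.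
- by rewrite leq_add2r.
- exact: dreach_trans d3 d4.
- case: ifP => _; apply: cfg_stop; rewrite ?es ?leq_add2l //; last by lia.
  by rewrite -addn1.
- rewrite inE -val_eqE /= !inordK ?es //; try by (case: ifP => _; lia).
  by case: (v x bs); rewrite ?eqxx //; apply/eqP; lia.
Qed.

Lemma guess_ntm_bounded x : bounded
  (fun c => c.1 \in ntm_accept guess_ntm -> exists2 bs, size bs = g x & v x bs)
  (init_config guess_ntm x) (t1 x + t3 x + 12 * g x + 2) (g x).
Proof.
have [T [-> HT]] := init_cfg x; have [a1 a2 _ _ _] := whole_codeP.
have [T1 [n1 [le1 H1 d1]]] := compile_correct (e := whole_end + 2) (P1_ok x) a1 HT.
have B : bounded
  (fun c => c.1 \in ntm_accept guess_ntm -> exists2 bs, size bs = g x & v x bs)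
  (cfg (C := whole_code) (e := whole_end + 2) (clen P1) T1)
  (t3 x + 1 + 12 * size (stA (S1 x)) + 1) (0 + size (stA (S1 x))).
  apply: guess_bounded => // bs T2; rewrite S1_size => sz H2.
  have [n [q [T3 [le3 d3 h3 ac]]]] := guess_ntm_end sz H2.
  apply: bounded_le (bounded_dreach d3 (bounded_halting h3 _)) _ _ => //.
    by rewrite ac => Hv; exists bs.
  by rewrite addn0.
apply: bounded_le (bounded_dreach d1 B) _ _; rewrite S1_size //.
by rewrite !addnA; lia.
Qed.

Lemma guess_ntm_accepts x : accepts guess_ntm x <-> exists2 bs, size bs = g x & v x bs.
Proof.
split=> [[n [m [c [r h a]]]]|[bs sz Hv]].
  by have [_ _ H] := guess_ntm_bounded r; apply: H.
have [T [Ei HT]] := init_cfg x; have [a1 a2 _ _ _] := whole_codeP.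
have [T1 [n1 [_ H1 d1]]] := compile_correct (e := whole_end + 2) (P1_ok x) a1 HT.
have [T2 [n2 [m2 [H2 r2]]]] := guess_run a2 H1 (esym (etrans sz (esym (S1_size x)))).
have [n3 [q [T3 [_ d3 h3 ac]]]] := guess_ntm_end sz H2.
exists (n1 + (n2 + (n3 + 0))), (m2 + 0), (cfg q T3); split=> //; last by rewrite ac.
rewrite Ei; apply: run_dreach d1 (run_trans r2 _).
exact: run_dreach d3 (run_refl _).
Qed.
End GuessAndCheck.

(** * Programs on binary trees *)

Inductive tree := Leaf | Node (l r : tree).

(* Preorder, hence self-delimiting. *)
Fixpoint code (t : tree) : seq letter :=
  if t is Node l r then Nd_letter :: code l ++ code r else [:: Lf_letter].

Definition tsize (t : tree) : nat := size (code t).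

Lemma tsize_Node l r : tsize (Node l r) = (tsize l + tsize r).+1.
Proof. by rewrite /tsize /= size_cat. Qed.

Lemma tsize_gt0 t : 0 < tsize t.
Proof. by case: t. Qed.

Lemma mark_code t : mark \notin code t.
Proof. by elim: t => // l Hl r Hr; rewrite /= inE /= mem_cat negb_or Hl Hr. Qed.

Definition is_node (o : option letter) : bool := o == Some Nd_letter.
Definition not_mark (o : option letter) : bool := o != Some mark.

Lemma ex_seq_le c1 c2 S n S1 m S2 k :
  ex c1 S n S1 -> ex c2 S1 m S2 -> n + m <= k -> ex (Seq c1 c2) S k S2.
Proof. by move=> H1 H2; apply: ex_le; apply: ex_seq H1 H2. Qed.

(** Codes of trees do not contain [mark], so a mark delimits a stashed tree. The transfer reverses
    the segment, undoing the reversal made by [stash]. *)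
Definition shift (x y : reg) : cmd :=
  Seq (While x not_mark (Seq (Copy x y) (Pop x))) (Pop x).

Definition reg_of (y : bool) : reg := if y then RA else RB.
Definition store_of (y : bool) (i m u v c : seq letter) : store :=
  if y then Store i m u v c else Store i m v u c.

Lemma ex_shift_main y w i m u v c : mark \notin w ->
  ex (shift (reg_of y) RM) (store_of y i m (w ++ mark :: u) v c) (5 * size w + 2)
     (store_of y i (rev w ++ m) u v c).
Proof.
move=> Hw; apply: (ex_seq_le (n := 5 * size w + 1) (m := 1)
  (S1 := store_of y i (rev w ++ m) (mark :: u) v c)); last by rewrite -addnA.
  elim: w m Hw => [|x w IH] m Hw; first by apply: ex_while_false; case: y.
  move: Hw; rewrite inE negb_or => /andP [nx nw].
  apply: (ex_le (n := (2 + 1) + (5 * size w + 1) + 2)); last by rewrite /=; lia.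
  apply: ex_while_true; last by rewrite rev_cons cat_rcons; apply: IH.
    by case: y {IH}; rewrite /not_mark; apply: contra nx => /eqP [->].
  by case: y {IH}; apply: ex_seq (ex_copy _ _) (ex_pop _ _).
by case: y; apply: ex_pop.
Qed.

Lemma ex_shift_BA w i m a b c : mark \notin w ->
  ex (shift RB RA) (Store i m a (w ++ mark :: b) c) (5 * size w + 2)
     (Store i m (rev w ++ a) b c).
Proof.
move=> Hw; apply: (ex_seq_le (n := 5 * size w + 1) (m := 1)
  (S1 := Store i m (rev w ++ a) (mark :: b) c)); last by rewrite -addnA.
  elim: w a Hw => [|x w IH] a Hw; first exact: ex_while_false.
  move: Hw; rewrite inE negb_or => /andP [nx nw].
  apply: (ex_le (n := (2 + 1) + (5 * size w + 1) + 2)); last by rewrite /=; lia.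
  apply: ex_while_true; last by rewrite rev_cons cat_rcons; apply: IH.
    by rewrite /not_mark; apply: contra nx => /eqP [->].
  by apply: ex_seq (ex_copy _ _) (ex_pop _ _).
exact: ex_pop.
Qed.

(* The counter register holds one letter for every subtree still to be read. *)
Definition stash_step (y : reg) : cmd :=
  Seq (If RM is_node (Push RC Nd_letter) (Pop RC)) (Seq (Copy RM y) (Pop RM)).

Definition stash (y : reg) : cmd :=
  Seq (Seq (Push y mark) (Seq (Push RC mark) (Push RC Nd_letter)))
      (Seq (While RC not_mark (stash_step y)) (Pop RC)).

(** Stated with the rest of the loop as a continuation: both subtrees of a node are read by the same
    loop, so the induction on [t] needs the execution that follows each of them. Every letter costs
    4 + 3 + 2 = 9 steps. *)
Lemma ex_stash_loop y t i m u v c n S :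
  ex (While RC not_mark (stash_step (reg_of y)))
     (store_of y i m (rev (code t) ++ u) v c) n S ->
  ex (While RC not_mark (stash_step (reg_of y)))
     (store_of y i (code t ++ m) u v (Nd_letter :: c)) (9 * tsize t + n) S.
Proof.
elim: t m u c n => [|l IHl r IHr] m u c n H.
  rewrite -[tsize Leaf]/1; apply: (ex_le (n := 4 + (2 + 1) + n + 2)); last by lia.
  have {}H : ex (While RC not_mark (stash_step (reg_of y)))
     (store_of y i m (Lf_letter :: u) v c) n S by [].
  apply: ex_while_true H; first by case: y.
  apply: (ex_seq (S1 := store_of y i (Lf_letter :: m) u v c)).
    by apply: ex_if_false; case: y => //; apply: ex_le (ex_pop _ _) _.
  by case: y; apply: ex_seq (ex_copy _ _) (ex_pop _ _).
rewrite tsize_Node.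
apply: (ex_le (n := 4 + (2 + 1) + (9 * tsize l + (9 * tsize r + n)) + 2));
  last by lia.
apply: (ex_while_true (S1 := store_of y i (code l ++ code r ++ m) (Nd_letter :: u) v
          (Nd_letter :: Nd_letter :: c))); first by case: (y).
  apply: (ex_seq (S1 := store_of y i (code (Node l r) ++ m) u v
          (Nd_letter :: Nd_letter :: c))).
    by apply: ex_if_true; case: (y) => //; apply: ex_le (ex_push _ _ _) _.
  by rewrite /= -catA; case: (y); apply: ex_seq (ex_copy _ _) (ex_pop _ _).
by apply: IHl; apply: IHr; rewrite /= rev_cons rev_cat cat_rcons -catA in H.
Qed.

Lemma ex_stash y t i m u v c :
  ex (stash (reg_of y)) (store_of y i (code t ++ m) u v c) (9 * tsize t + 8)
     (store_of y i m (rev (code t) ++ mark :: u) v c).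
Proof.
apply: (ex_seq_le (n := 2 + (2 + 2)) (m := 9 * tsize t + 1 + 1)
  (S1 := store_of y i (code t ++ m) (mark :: u) v (Nd_letter :: mark :: c))).
- by case: y; apply: ex_seq (ex_push _ _ _) (ex_seq (ex_push _ _ _) (ex_push _ _ _)).
- apply: (ex_seq (S1 := store_of y i m (rev (code t) ++ mark :: u) v (mark :: c)));
    last by case: y; apply: ex_pop.
  by apply: ex_stash_loop; case: y; apply: ex_while_false.
- by lia.
Qed.

(** The remainder of the stack and the other registers are arbitrary and preserved. Hence a program
    may act on the topmost tree while other trees wait below it or in [RA] and [RB], which is what
    makes the constructions below compose. *)
Definition rewrites (c : cmd) (t u : tree) (n : nat) : Prop :=
  forall i m a b cc, ex c (Store i (code t ++ m) a b cc) n (Store i (code u ++ m) a b cc).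

Lemma rewrites_le c t u n n' : rewrites c t u n -> n <= n' -> rewrites c t u n'.
Proof. by move=> H le i m a b cc; apply: ex_le (H _ _ _ _ _) le. Qed.

Lemma rewrites_seq c1 c2 t u w n m :
  rewrites c1 t u n -> rewrites c2 u w m -> rewrites (Seq c1 c2) t w (n + m).
Proof. by move=> H1 H2 i s a b cc; apply: ex_seq (H1 _ _ _ _ _) (H2 _ _ _ _ _). Qed.

Definition restore (y : bool) : cmd := shift (reg_of y) RM.

Lemma ex_restore y t i m u v c :
  ex (restore y) (store_of y i m (rev (code t) ++ mark :: u) v c) (5 * tsize t + 2)
     (store_of y i (code t ++ m) u v c).
Proof.
have := @ex_shift_main y (rev (code t)) i m u v c; rewrite mem_rev size_rev revK.
by apply; apply: mark_code.
Qed.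

Definition drop_tree : cmd :=
  Seq (stash RA) (Seq (While RA not_mark (Pop RA)) (Pop RA)).

Lemma ex_drop_tree t i m a b c :
  ex drop_tree (Store i (code t ++ m) a b c) (12 * tsize t + 10) (Store i m a b c).
Proof.
apply: (ex_seq_le (n := 9 * tsize t + 8) (m := 3 * tsize t + 1 + 1)); last by lia.
  exact: (@ex_stash true).
apply: ex_seq; last exact: (ex_pop RA (Store i m (mark :: a) b c)).
have: mark \notin rev (code t) by rewrite mem_rev mark_code.
rewrite /tsize -size_rev; elim: (rev (code t)) => [|x w IH].
  by move=> _; apply: ex_while_false.
rewrite inE negb_or => /andP [nx nw].
apply: (ex_le (n := 1 + (3 * size w + 1) + 2)); last by rewrite /=; lia.
apply: (ex_while_true (S1 := Store i m (w ++ mark :: a) b c)) (IH nw).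
  by rewrite /not_mark; apply: contra nx => /eqP [->].
exact: ex_pop.
Qed.

Definition dup_loop : cmd := Seq (Copy RA RM) (Seq (Copy RA RB) (Pop RA)).

Lemma ex_dup_loop w i m a b c : mark \notin w ->
  ex (While RA not_mark dup_loop) (Store i m (w ++ mark :: a) b c) (7 * size w + 1)
     (Store i (rev w ++ m) (mark :: a) (rev w ++ b) c).
Proof.
elim: w m b => [|x w IH] m b Hw; first exact: ex_while_false.
move: Hw; rewrite inE negb_or => /andP [nx nw].
apply: (ex_le (n := (2 + (2 + 1)) + (7 * size w + 1) + 2)); last by rewrite /=; lia.
apply: ex_while_true; last by rewrite rev_cons !cat_rcons; apply: IH.
  by rewrite /not_mark; apply: contra nx => /eqP [->].
by apply: ex_seq (ex_copy _ _) (ex_seq (ex_copy _ _) (ex_pop _ _)).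
Qed.

Definition dup_tree : cmd :=
  Seq (Seq (stash RA) (Seq (Push RB mark) (Seq (While RA not_mark dup_loop) (Pop RA))))
      (Seq (Push RA mark) (Seq (shift RB RA) (restore true))).

Lemma ex_dup_tree t i m a b c :
  ex dup_tree (Store i (code t ++ m) a b c) (26 * tsize t + 20)
     (Store i (code t ++ code t ++ m) a b c).
Proof.
apply: (ex_seq_le (n := 9 * tsize t + 8 + (2 + (7 * tsize t + 1 + 1)))
  (m := 2 + (5 * tsize t + 2 + (5 * tsize t + 2)))
  (S1 := Store i (code t ++ m) a (code t ++ mark :: b) c)); last by lia.
- apply: (ex_seq (S1 := Store i m (rev (code t) ++ mark :: a) b c)).
    exact: (@ex_stash true).
  apply: (ex_seq (ex_push _ _ _)).
  apply: ex_seq; last exact: (ex_pop RA (Store i _ (mark :: a) _ c)).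
  have := @ex_dup_loop (rev (code t)) i m a (mark :: b) c.
  by rewrite mem_rev size_rev revK => H; apply: H; apply: mark_code.
- apply: ex_seq (ex_push _ _ _) _.
  apply: (ex_seq (S1 := Store i (code t ++ m) (rev (code t) ++ mark :: a) b c)).
    by apply: ex_shift_BA; apply: mark_code.
  exact: (@ex_restore true).
Qed.

Definition swap_trees : cmd :=
  Seq (Seq (stash RA) (stash RB)) (Seq (restore true) (restore false)).

Lemma ex_swap_trees t u i m a b c :
  ex swap_trees (Store i (code t ++ code u ++ m) a b c) (14 * (tsize t + tsize u) + 20)
     (Store i (code u ++ code t ++ m) a b c).
Proof.
apply: (ex_seq_le (n := (9 * tsize t + 8) + (9 * tsize u + 8))
  (m := (5 * tsize t + 2) + (5 * tsize u + 2))); last by lia.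
- exact: ex_seq (@ex_stash true _ _ _ _ _ _) (@ex_stash false _ _ _ _ _ _).
- exact: ex_seq (@ex_restore true _ _ _ _ _ _) (@ex_restore false _ _ _ _ _ _).
Qed.

(** The second component is computed first, on the copy, and swapped below the original, so that the
    first component ends up on top as preorder requires. *)
Definition pair_cmd (c1 c2 : cmd) : cmd :=
  Seq (Seq dup_tree c2) (Seq swap_trees (Seq c1 (Push RM Nd_letter))).

Lemma rewrites_pair c1 c2 t u1 u2 n1 n2 :
  rewrites c1 t u1 n1 -> rewrites c2 t u2 n2 ->
  rewrites (pair_cmd c1 c2) t (Node u1 u2) (n1 + n2 + 40 * tsize t + 14 * tsize u2 + 42).
Proof.
move=> H1 H2 i m a b c; rewrite /= -catA.
apply: (ex_seq_le (n := (26 * tsize t + 20) + n2)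
  (m := (14 * (tsize u2 + tsize t) + 20) + (n1 + 2))); last by lia.
  exact: ex_seq (ex_dup_tree _ _ _ _ _ _) (H2 _ _ _ _ _).
exact: ex_seq (ex_swap_trees _ _ _ _ _ _ _) (ex_seq (H1 _ _ _ _ _) (ex_push _ _ _)).
Qed.

Fixpoint push_letters (w : seq letter) : cmd :=
  if w is x :: w' then Seq (push_letters w') (Push RM x) else Skip.

Lemma ex_push_letters w i m a b c :
  ex (push_letters w) (Store i m a b c) (2 * size w) (Store i (w ++ m) a b c).
Proof.
elim: w => [|x w IH] /=; first exact: ex_skip.
by rewrite mulnS addnC; apply: ex_seq IH (ex_push _ _ _).
Qed.

Definition const_cmd (t : tree) : cmd := Seq drop_tree (push_letters (code t)).

Lemma rewrites_const t u : rewrites (const_cmd u) t u (12 * tsize t + 10 + 2 * tsize u).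
Proof.
by move=> i m a b c; apply: ex_seq (ex_drop_tree _ _ _ _ _ _) (ex_push_letters _ _ _ _ _ _).
Qed.

Definition head_tree (t : tree) : tree := if t is Node l _ then l else Leaf.
Definition tail_tree (t : tree) : tree := if t is Node _ r then r else Leaf.

Definition head_cmd : cmd :=
  If RM is_node (Seq (Pop RM) (Seq (stash RA) (Seq drop_tree (restore true)))) Skip.

Lemma rewrites_head t : rewrites head_cmd t (head_tree t) (14 * tsize t + 23).
Proof.
case: t => [|l r] i m a b c.
  by apply: (@ex_le _ _ 2); [apply: ex_if_false (ex_skip _) | lia].
rewrite /= -catA tsize_Node.
apply: (@ex_le _ _ (1 + (9 * tsize l + 8 + (12 * tsize r + 10 + (5 * tsize l + 2)))).+2).
  apply: ex_if_true => //; apply: ex_seq (ex_pop _ _) _ => /=.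
  apply: ex_seq (@ex_stash true _ _ _ _ _ _) _.
  exact: ex_seq (ex_drop_tree _ _ _ _ _ _) (@ex_restore true _ _ _ _ _ _).
by lia.
Qed.

Definition tail_cmd : cmd := If RM is_node (Seq (Pop RM) drop_tree) Skip.

Lemma rewrites_tail t : rewrites tail_cmd t (tail_tree t) (12 * tsize t + 13).
Proof.
case: t => [|l r] i m a b c.
  by apply: (@ex_le _ _ 2); [apply: ex_if_false (ex_skip _) | lia].
rewrite /= -catA tsize_Node.
apply: (@ex_le _ _ (1 + (12 * tsize l + 10)).+2); last by lia.
apply: ex_if_true => //; apply: ex_seq (ex_pop _ _) _ => /=.
exact: ex_drop_tree.
Qed.

Definition nonleaf (t : tree) : bool := if t is Node _ _ then true else false.

Lemma nonleaf_code t s : is_node (ohead (code t ++ s)) = nonleaf t.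
Proof. by case: t. Qed.

Definition if_cmd (c c1 c2 : cmd) : cmd :=
  Seq (Seq dup_tree c) (If RM is_node (Seq drop_tree c1) (Seq drop_tree c2)).

Lemma rewrites_if c c1 c2 t u n (f : bool -> tree) n1 :
  rewrites c t u n ->
  rewrites (if nonleaf u then c1 else c2) t (f (nonleaf u)) n1 ->
  rewrites (if_cmd c c1 c2) t (f (nonleaf u)) (n + n1 + 26 * tsize t + 12 * tsize u + 32).
Proof.
move=> H H1 i m a b cc.
apply: (ex_seq_le (n := (26 * tsize t + 20) + n)
  (m := (12 * tsize u + 10 + n1).+2)); last by lia.
  exact: ex_seq (ex_dup_tree _ _ _ _ _ _) (H _ _ _ _ _).
case E: (nonleaf u) H1 => H1; [apply: ex_if_true | apply: ex_if_false];
  rewrite ?nonleaf_code //; exact: ex_seq (ex_drop_tree _ _ _ _ _ _) (H1 _ _ _ _ _).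
Qed.

Fixpoint comb (s : seq tree) : tree := if s is t :: s' then Node t (comb s') else Leaf.

(** The stack holds the remaining list above the accumulator. The tail of the list is put aside on
    [RA], head and accumulator are joined to a pair for [c], and the tail is brought back. *)
Definition fold_step (c : cmd) : cmd :=
  Seq (Seq (Pop RM) (Seq swap_trees (stash RA)))
      (Seq (Push RM Nd_letter) (Seq c (restore true))).

Definition fold_cmd (c : cmd) : cmd :=
  Seq (Pop RM) (Seq (While RM is_node (fold_step c)) (Pop RM)).

(** The hypothesis concerns only accumulators reached on prefixes of [s], so that a bound on the
    intermediate values can supply the uniform cost [n]. *)
Lemma rewrites_fold (A T : Type) (ea : A -> tree) (et : T -> tree) (F : T -> A -> T)
    (c : cmd) s t n :
  (forall u a v, s = u ++ a :: v -> rewrites c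
     (Node (ea a) (et (foldl F t u))) (et (foldl F t (rcons u a))) n) ->
  rewrites (fold_cmd c) (Node (comb (map ea s)) (et t)) (et (foldl F t s))
    (size s * (n + 28 * tsize (comb (map ea s)) + 40) + 3).
Proof.
move=> H i m a b cc; rewrite /= -catA.
apply: (ex_seq_le (n := 1) (m := size s * (n + 28 * tsize (comb (map ea s)) + 40) + 1 + 1)
  (ex_pop _ _)); last by lia.
apply: (ex_seq (S1 := Store i (Lf_letter :: code (et (foldl F t s)) ++ m) a b cc));
  last exact: ex_pop.
(* The size of the whole list is frozen as [K], so that the cost per round stays the same while the
   list shrinks. *)
move: (leqnn (tsize (comb (map ea s)))); move: {2 3}(tsize _) => K.
elim: s t H => [|x s IH] t H leK; first exact: ex_while_false.
rewrite /= tsize_Node in leK.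
rewrite /= mulSn; set k := size s * _.
apply: (ex_le (n := (1 + (14 * (tsize (ea x) + tsize (comb (map ea s))) + 20 +
     (9 * tsize (comb (map ea s)) + 8)) + (2 + (n + (5 * tsize (comb (map ea s)) + 2)))) +
     (k + 1) + 2)); last by lia.
apply: ex_while_true => //; last first.
  apply: IH; last by lia.
  by move=> u y v E; apply: (H (x :: u) y v); rewrite E.
apply: ex_seq.
  apply: ex_seq (ex_pop _ _) (ex_seq _ (@ex_stash true _ _ _ _ _ _)) => /=.
  by rewrite -catA; apply: ex_swap_trees.
apply: ex_seq (ex_push _ _ _) (ex_seq _ (@ex_restore true _ _ _ _ _ _)).
by have := H [::] x s erefl i m (rev (code (comb (map ea s))) ++ mark :: a) b cc;
   rewrite /= -catA.
Qed.

(** * Reading the input *)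

(** Chosen so that tests are projections: the left subtree is the encoding of [true] exactly for
    [Bit true], the right one exactly for [Bit false], and only [Semicolon] is a leaf. *)
Definition symbol_tree (x : symbol) : tree :=
  match x with
  | Bit true => Node (Node Leaf Leaf) Leaf
  | Bit false => Node Leaf (Node Leaf Leaf)
  | Comma => Node Leaf Leaf
  | Semicolon => Leaf
  end.

Definition input_tree (x : seq symbol) : tree := comb (map symbol_tree x).

Definition is_symbol (x : symbol) (o : option letter) : bool := o == Some (inl x).

Definition push_symbol : cmd :=
  If RA (is_symbol (Bit true)) (push_letters (code (symbol_tree (Bit true))))
  (If RA (is_symbol (Bit false)) (push_letters (code (symbol_tree (Bit false))))
  (If RA (is_symbol Comma) (push_letters (code (symbol_tree Comma)))
      (push_letters (code (symbol_tree Semicolon))))).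

Definition nonempty (o : option letter) : bool := o != None.

(** Reversing the input onto [RA] makes the last symbol available first, as is needed to build a
    list from its end. *)
Definition read_cmd : cmd :=
  Seq (While RI nonempty (Seq (Copy RI RA) (Pop RI)))
  (Seq (Push RM Lf_letter)
       (While RA nonempty (Seq push_symbol (Seq (Push RM Nd_letter) (Pop RA))))).

Lemma ex_push_symbol x i m a b c :
  ex push_symbol (Store i m (inl x :: a) b c) 16
     (Store i (code (symbol_tree x) ++ m) (inl x :: a) b c).
Proof.
have P y r : ex (push_letters (code (symbol_tree y))) (Store i m r b c) 10
    (Store i (code (symbol_tree y) ++ m) r b c).
  by apply: ex_le (ex_push_letters _ _ _ _ _ _) _; case: y => [[]| |].
case: x => [[]| |].
- by apply: (@ex_le _ _ 12) => //; apply: ex_if_true (P _ _).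
- apply: (@ex_le _ _ 14) => //.
  by apply: ex_if_false => //; apply: ex_if_true (P _ _).
- apply: ex_if_false => //; apply: ex_if_false => //.
  by apply: ex_if_true (P _ _).
- apply: ex_if_false => //; apply: ex_if_false => //.
  by apply: ex_if_false (P _ _).
Qed.

Lemma ex_read x : ex read_cmd (Store [seq inl a | a <- x] [::] [::] [::] [::])
  (26 * size x + 4) (Store [::] (code (input_tree x)) [::] [::] [::]).
Proof.
apply: (ex_seq_le (n := 5 * size x + 1) (m := 2 + (21 * size x + 1))
  (S1 := Store [::] [::] [seq inl a | a <- rev x] [::] [::])); last by lia.
  suff H a : ex (While RI nonempty (Seq (Copy RI RA) (Pop RI)))
      (Store [seq inl a | a <- x] [::] a [::] [::]) (5 * size x + 1)
      (Store [::] [::] ([seq inl a | a <- rev x] ++ a) [::] [::]).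
    by have := H [::]; rewrite cats0.
  elim: x a => [|x s IH] a; first exact: ex_while_false.
  apply: (@ex_le _ _ (2 + 1 + (5 * size s + 1) + 2)); last by rewrite /=; lia.
  apply: ex_while_true => //; last by rewrite rev_cons map_rcons cat_rcons; apply: IH.
  by apply: ex_seq (ex_copy _ _) (ex_pop _ _).
apply: ex_seq (ex_push _ _ _) _ => /=.
have -> : input_tree x = foldl (fun t y => Node (symbol_tree y) t) Leaf (rev x).
  by rewrite foldl_rev; elim: x => //= y x; rewrite /input_tree /= => ->.
rewrite -size_rev -[[:: Lf_letter]]/(code Leaf).
elim: (rev x) Leaf => [|y s IH] t; first exact: ex_while_false.
apply: (@ex_le _ _ (16 + (2 + 1) + (21 * size s + 1) + 2)); last by rewrite /=; lia.
apply: ex_while_true => //; last exact: IH.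
apply: ex_seq (ex_push_symbol _ _ _ _ _ _) _ => /=.
have := ex_seq (ex_push RM Nd_letter (Store [::] (code (symbol_tree y) ++ code t)
  (inl y :: [seq inl a | a <- s]) [::] [::])) (ex_pop RA _); exact.
Qed.

(** * Preparing the guesses *)

(* The unary number goes to register [RA].  The letter [Node] of the pair is lost,
   and the remaining [Leaf] is the empty list of guesses. *)
Definition unary_tree (n : nat) : tree := iter n (Node Leaf) Leaf.

Definition prepare_cmd : cmd :=
  Seq (Pop RM) (While RM is_node (Seq (Copy RM RA) (Seq (Pop RM) (Pop RM)))).

Lemma ex_prepare n t :
  ex prepare_cmd (Store [::] (code (Node (unary_tree n) t)) [::] [::] [::]) (6 * n + 2)
     (Store [::] (Lf_letter :: code t) (nseq n Nd_letter) [::] [::]).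
Proof.
apply: (ex_seq_le (n := 1) (m := 6 * n + 1) (ex_pop _ _)); last by lia.
suff H a : ex (While RM is_node (Seq (Copy RM RA) (Seq (Pop RM) (Pop RM))))
   (Store [::] (code (unary_tree n) ++ code t) a [::] [::]) (6 * n + 1)
   (Store [::] (Lf_letter :: code t) (nseq n Nd_letter ++ a) [::] [::]).
  by have := H [::]; rewrite cats0.
elim: n a => [|n IH] a; first exact: ex_while_false.
apply: (@ex_le _ _ (2 + (1 + 1) + (6 * n + 1) + 2)); last by lia.
apply: ex_while_true => //; last first.
  have -> : nseq n.+1 Nd_letter ++ a = nseq n Nd_letter ++ Nd_letter :: a.
    by elim: (n) => //= k ->.
  exact: IH.
by apply: ex_seq (ex_copy _ _) (ex_seq (ex_pop _ _) (ex_pop _ _)).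
Qed.

(** * Polynomial-time functions *)

(** The base is at least 2 even where [mu] vanishes; this lets powers absorb constants and the
    factor 2 of a sum. *)
Definition poly_bounded (A : Type) (mu t : A -> nat) : Prop :=
  exists k, forall a, t a <= (mu a + 2) ^ k.

Section PolyBounded.
Variables (A : Type) (mu : A -> nat).
Implicit Types t u : A -> nat.

Lemma pb_le t u : poly_bounded mu u -> (forall a, t a <= u a) -> poly_bounded mu t.
Proof. by case=> k H le; exists k => a; apply: leq_trans (le a) (H a). Qed.

Lemma pb_const n : poly_bounded mu (fun=> n).
Proof.
exists n => a; apply: leq_trans (ltnW (ltn_expl n (isT : 1 < 2))) _.
by case: n => [|n]; rewrite ?expn0 // leq_exp2r // leq_addl.
Qed.

Lemma pb_mu : poly_bounded mu mu.
Proof. by exists 1 => a; rewrite leq_addr. Qed.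

Lemma pb_mul t u : poly_bounded mu t -> poly_bounded mu u ->
  poly_bounded mu (fun a => t a * u a).
Proof.
move=> [k Hk] [l Hl]; exists (k + l) => a.
by rewrite expnD leq_mul.
Qed.

Lemma pb_add t u : poly_bounded mu t -> poly_bounded mu u ->
  poly_bounded mu (fun a => t a + u a).
Proof.
move=> [k Hk] [l Hl]; exists (k + l).+1 => a.
have p n : 0 < (mu a + 2) ^ n by rewrite expn_gt0 addn_gt0 orbT.
apply: (@leq_trans (2 * (mu a + 2) ^ (k + l))); last by rewrite expnS leq_mul2r leq_addl orbT.
rewrite mul2n -addnn leq_add //.
  by apply: leq_trans (Hk a) _; rewrite expnD leq_pmulr.
by apply: leq_trans (Hl a) _; rewrite expnD leq_pmull.
Qed.

Lemma pb_comp (B : Type) (nu s : B -> nat) (f : A -> B) :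
  poly_bounded nu s -> poly_bounded mu (fun a => nu (f a)) ->
  poly_bounded mu (fun a => s (f a)).
Proof.
move=> [k Hk] /(fun H => pb_add H (pb_const 2)) [l Hl]; exists (l * k) => a.
apply: leq_trans (Hk _) _; rewrite expnM; case: k {Hk} => // k.
by rewrite leq_exp2r.
Qed.

End PolyBounded.

Class encoding (A : Type) := enc : A -> tree.

#[global] Instance enc_bool : encoding bool := fun b => if b then Node Leaf Leaf else Leaf.
#[global] Instance enc_nat : encoding nat := unary_tree.
#[global] Instance enc_symbol : encoding symbol := symbol_tree.
#[global] Instance enc_prod A B (EA : encoding A) (EB : encoding B) : encoding (A * B) :=
  fun p => Node (enc p.1) (enc p.2).
#[global] Instance enc_seq A (EA : encoding A) : encoding (seq A) :=
  fun s => comb (map enc s).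

Definition sz {A} {EA : encoding A} (a : A) : nat := tsize (enc a).

(* [mu] is the size in terms of which the running time is polynomial. *)
Definition PTm {A B} {EA : encoding A} {EB : encoding B} (mu : A -> nat) (f : A -> B) : Prop :=
  exists c t, [/\ forall a, rewrites c (enc a) (enc (f a)) (t a),
    poly_bounded mu t & poly_bounded mu (fun a => sz (f a))].

Notation PT f := (PTm sz f).

Lemma sz_pair {A B} {EA : encoding A} {EB : encoding B} (a : A) (b : B) :
  sz (a, b) = (sz a + sz b).+1.
Proof. exact: tsize_Node. Qed.

Lemma sz_cons {A} {EA : encoding A} (a : A) s : sz (a :: s) = (sz a + sz s).+1.
Proof. exact: tsize_Node. Qed.

Section Closure.
Context {A B C : Type} {EA : encoding A} {EB : encoding B} {EC : encoding C}.
Implicit Types (mu : A -> nat).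

Lemma PTm_eq mu (f g : A -> B) : PTm mu f -> f =1 g -> PTm mu g.
Proof.
move=> [c [t [H1 H2 H3]]] E; exists c, t; split=> //.
  by move=> a; rewrite -E.
by apply: pb_le H3 _ => a; rewrite E.
Qed.

(** Programs act on untyped trees, so a result may be reread at any type whose encoding gives the
    same tree, for instance a pair as a nonempty list. *)
Lemma PTm_retype mu (f : A -> B) (g : A -> C) :
  PTm mu f -> (forall a, enc (f a) = enc (g a)) -> PTm mu g.
Proof.
move=> [c [t [H1 H2 H3]]] E; exists c, t; split=> //.
  by move=> a; rewrite -E.
by apply: pb_le H3 _ => a; rewrite /sz E.
Qed.

Lemma PTm_comp mu (f : A -> B) (g : B -> C) :
  PTm mu f -> PT g -> PTm mu (fun a => g (f a)).
Proof.
move=> [c [t [H1 H2 H3]]] [d [u [H4 H5 H6]]].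
exists (Seq c d), (fun a => t a + u (f a)); split.
- by move=> a; apply: rewrites_seq (H1 a) (H4 _).
- by apply: pb_add => //; apply: pb_comp H5 H3.
- exact: pb_comp H6 H3.
Qed.

Lemma PT_id : PT (fun a : A => a).
Proof.
exists Skip, (fun=> 0); split; last exact: pb_mu.
  by move=> a i m s b cc; apply: ex_skip.
exact: pb_const.
Qed.

Lemma PT_const (b : B) : PT (fun a : A => b).
Proof.
exists (const_cmd (enc b)), (fun a => 12 * sz a + 10 + 2 * sz b); split.
- by move=> a; apply: rewrites_const.
- by do ![apply: pb_add | apply: pb_mul | apply: pb_const | apply: pb_mu].
- exact: pb_const.
Qed.

Lemma PTm_pair mu (f : A -> B) (g : A -> C) : poly_bounded mu sz ->
  PTm mu f -> PTm mu g -> PTm mu (fun a => (f a, g a)).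
Proof.
move=> Hsz [c [t [H1 H2 H3]]] [d [u [H4 H5 H6]]].
exists (pair_cmd c d), (fun a => t a + u a + 40 * sz a + 14 * sz (g a) + 42); split.
- by move=> a; apply: rewrites_pair.
- by do ![apply: pb_add | apply: pb_mul | apply: pb_const | done].
- apply: pb_le (pb_add (pb_add H3 H6) (pb_const _ 1)) _ => a.
  by rewrite /sz tsize_Node addn1.
Qed.

Lemma PT_fst : PT (fun p : A * B => p.1).
Proof.
exists head_cmd, (fun p => 14 * sz p + 23); split.
- by move=> [a b]; apply: rewrites_head.
- by do ![apply: pb_add | apply: pb_mul | apply: pb_const | apply: pb_mu].
- by apply: pb_le (pb_mu _) _ => -[a b]; rewrite /sz tsize_Node; lia.
Qed.

Lemma PT_snd : PT (fun p : A * B => p.2).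
Proof.
exists tail_cmd, (fun p => 12 * sz p + 13); split.
- by move=> [a b]; apply: rewrites_tail.
- by do ![apply: pb_add | apply: pb_mul | apply: pb_const | apply: pb_mu].
- by apply: pb_le (pb_mu _) _ => -[a b]; rewrite /sz tsize_Node; lia.
Qed.

Lemma PT_tail (f : A -> B) (g : A -> C) : PT f ->
  (forall a, enc (g a) = tail_tree (enc (f a))) -> PT g.
Proof.
move=> [c [t [H1 H2 H3]]] E; exists (Seq c tail_cmd), (fun a => t a + (12 * sz (f a) + 13)).
split.
- by move=> a; apply: rewrites_seq (H1 a) _; rewrite E; apply: rewrites_tail.
- by do ![apply: pb_add | apply: pb_mul | apply: pb_const | done].
- apply: pb_le H3 _ => a; rewrite /sz E; case: (enc (f a)) => // l r.
  by rewrite tsize_Node /=; lia.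
Qed.

Lemma PT_head (f : A -> B) (g : A -> C) : PT f ->
  (forall a, enc (g a) = head_tree (enc (f a))) -> PT g.
Proof.
move=> [c [t [H1 H2 H3]]] E; exists (Seq c head_cmd), (fun a => t a + (14 * sz (f a) + 23)).
split.
- by move=> a; apply: rewrites_seq (H1 a) _; rewrite E; apply: rewrites_head.
- by do ![apply: pb_add | apply: pb_mul | apply: pb_const | done].
- apply: pb_le H3 _ => a; rewrite /sz E; case: (enc (f a)) => // l r.
  by rewrite tsize_Node /=; lia.
Qed.

Lemma PT_branch (h : A -> C) (b : A -> bool) (f g : A -> B) : PT h ->
  (forall a, nonleaf (enc (h a)) = b a) -> PT f -> PT g ->
  PT (fun a => if b a then f a else g a).
Proof.
move=> [e [w [H7 H8 H9]]] E [c [t [H1 H2 H3]]] [d [u [H4 H5 H6]]].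
exists (if_cmd e c d), (fun a => w a + (t a + u a) + 26 * sz a + 12 * sz (h a) + 32); split.
- move=> a; have := @rewrites_if e c d (enc a) _ _
    (fun x => enc (if x then f a else g a)) (t a + u a) (H7 a).
  rewrite E; apply; case: (b a).
    by apply: rewrites_le (H1 a) _; rewrite leq_addr.
  by apply: rewrites_le (H4 a) _; rewrite leq_addl.
- by do ![apply: pb_add | apply: pb_mul | apply: pb_const | apply: pb_mu | done].
- apply: pb_le (pb_add H3 H6) _ => a; case: (b a); first exact: leq_addr.
  exact: leq_addl.
Qed.

End Closure.

Lemma size_le_comb s : size s <= tsize (comb s).
Proof. by elim: s => //= t s IH; rewrite tsize_Node ltnS (leq_trans IH) // leq_addl. Qed.

(** The bound [w] on all intermediate accumulators is essential: iterating a polynomial-time step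
    can double the value each time. With it, the number of rounds and the cost of each are
    polynomial. *)
Lemma PTm_fold (X A T : Type) (EX : encoding X) (EA : encoding A) (ET : encoding T)
    (mu : X -> nat) (F : T -> A -> T) (l : X -> seq A) (i : X -> T) :
  poly_bounded mu sz -> PT (fun p : A * T => F p.2 p.1) -> PTm mu l -> PTm mu i ->
  (exists2 w, poly_bounded mu w &
    forall x u v, l x = u ++ v -> sz (foldl F (i x) u) <= w x) ->
  PTm mu (fun x => foldl F (i x) (l x)).
Proof.
move=> Hsz [c [t [H1 [kt Ht] H3]]] Hl Hi [w Hw le_w].
have [d [u [H4 H5 H6]]] := PTm_pair Hsz Hl Hi.
have Hli : poly_bounded mu (fun x => sz (l x)).
  by apply: pb_le H6 _ => x; rewrite sz_pair; lia.
(* Bounds the time of one step: its argument is the pair of an element of [l x] and an accumulator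
   of size at most [w x]. *)
pose b x := (@sz _ (enc_seq EA) (l x) + w x + 1 + 2) ^ kt.
exists (Seq d (fold_cmd c)),
  (fun x => u x + (sz (l x) * (b x + 28 * sz (l x) + 40) + 3)); split.
- move=> x; apply: rewrites_seq (H4 x) _.
  apply: (rewrites_le (n := size (l x) * (b x + 28 * sz (l x) + 40) + 3)).
    apply: rewrites_fold => y a z /= E.
    have := H1 (a, foldl F (i x) y); rewrite /= -cats1 foldl_cat /=.
    move=> /rewrites_le; apply; apply: leq_trans (Ht _) _.
    rewrite /b; case: (kt) => // k; rewrite leq_exp2r //.
    rewrite leq_add2r sz_pair addn1 ltnS leq_add //; last exact: le_w E.
    rewrite E; elim: (y) => [|y0 y1 IH]; rewrite sz_cons; first by lia.
    by apply: (leq_trans IH); rewrite -/(_ ++ _); lia.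
  rewrite leq_add2r leq_mul2r; apply/orP; right.
  by rewrite -(size_map enc (l x)); apply: size_le_comb.
- have Hb : poly_bounded mu b.
    have Q : poly_bounded mu (fun x => sz (l x) + w x + 1).
      by do ![apply: pb_add | apply: pb_const | done].
    have P : poly_bounded id (fun n => (n + 2) ^ kt) by exists kt.
    exact: pb_comp P Q.
  by do ![apply: pb_add | apply: pb_mul | apply: pb_const | done].
- by apply: pb_le Hw _ => x; apply: (le_w x _ [::]); rewrite cats0.
Qed.

(** * Polynomial-time list and number functions *)

Lemma sz_nil {A} {EA : encoding A} : sz ([::] : seq A) = 1.
Proof. by []. Qed.

Lemma sz_gt0 {A} {EA : encoding A} (a : A) : 0 < sz a.
Proof. exact: tsize_gt0. Qed.

Lemma sz_cat {A} {EA : encoding A} (s t : seq A) : (sz (s ++ t)).+1 = sz s + sz t.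
Proof. by elim: s => [|a s IH] //=; rewrite !sz_cons; lia. Qed.

Lemma sz_catl {A} {EA : encoding A} (s t : seq A) : sz s <= sz (s ++ t).
Proof. by generalize (sz_cat s t); generalize (sz_gt0 t); lia. Qed.

Lemma sz_catr {A} {EA : encoding A} (s t : seq A) : sz t <= sz (s ++ t).
Proof. by generalize (sz_cat s t); generalize (sz_gt0 s); lia. Qed.

Lemma sz_rev {A} {EA : encoding A} (s : seq A) : sz (rev s) = sz s.
Proof.
elim: s => // a s IH; rewrite rev_cons -cats1; apply/eqP; rewrite -eqSS sz_cat IH.
by rewrite !sz_cons sz_nil; lia.
Qed.

Lemma sz_filter {A} {EA : encoding A} (p : pred A) (s : seq A) : sz (filter p s) <= sz s.
Proof. by elim: s => //= a s IH; case: (p a); rewrite !sz_cons; lia. Qed.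

Lemma sz_flatten {A} {EA : encoding A} (s : seq (seq A)) : sz (flatten s) <= sz s.
Proof. by elim: s => //= a s IH; rewrite sz_cons; generalize (sz_cat a (flatten s)); lia. Qed.

Lemma sz_nat n : sz n = 2 * n + 1.
Proof.
elim: n => // n IH; have -> : sz n.+1 = (1 + sz n).+1 by exact: tsize_Node.
by rewrite IH; lia.
Qed.

Lemma size_le_sz {A} {EA : encoding A} (s : seq A) : size s < sz s.
Proof. by elim: s => // a s IH; rewrite sz_cons /=; lia. Qed.

Lemma sz_mem {A : eqType} {EA : encoding A} (a : A) (s : seq A) : a \in s -> sz a < sz s.
Proof.
elim: s => // b s IH; rewrite inE sz_cons => /orP [/eqP ->|/IH]; first by lia.
by lia.
Qed.

Lemma sz_bool (b : bool) : sz b <= 3.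
Proof. by case: b. Qed.

(** As 0 is a leaf, a unary number is the same tree as a list of zeros. This turns bounded iteration
    into a fold. *)
Lemma enc_nseq n : enc (nseq n 0) = enc n.
Proof. by elim: n => // n IH; congr Node. Qed.

(** * Closure rules for functions of a common argument *)

Lemma PT_eq A B (EA : encoding A) (EB : encoding B) (f g : A -> B) :
  PT f -> f =1 g -> PT g.
Proof. exact: PTm_eq. Qed.

Lemma PT_comp A B C (EA : encoding A) (EB : encoding B) (EC : encoding C)
  (g : B -> C) (f : A -> B) : PT g -> PT f -> PT (fun x => g (f x)).
Proof. by move=> Hg Hf; apply: PTm_comp Hf Hg. Qed.


Lemma PT_pair X A B (EX : encoding X) (EA : encoding A) (EB : encoding B) (f : X -> A) (g : X -> B) :
  PT f -> PT g -> PT (fun x => (f x, g x)).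
Proof. by apply: PTm_pair; apply: pb_mu. Qed.

Lemma PT_comp2 X A B C (EX : encoding X) (EA : encoding A) (EB : encoding B) (EC : encoding C)
  (h : A -> B -> C) (f : X -> A) (g : X -> B) :
  PT (fun p : A * B => h p.1 p.2) -> PT f -> PT g -> PT (fun x => h (f x) (g x)).
Proof. by move=> Hh Hf Hg; apply: PT_comp Hh (PT_pair Hf Hg). Qed.

Lemma PT_fst' X A B (EX : encoding X) (EA : encoding A) (EB : encoding B) (f : X -> A * B) :
  PT f -> PT (fun x => (f x).1).
Proof. by apply: PT_comp; apply: PT_fst. Qed.

Lemma PT_snd' X A B (EX : encoding X) (EA : encoding A) (EB : encoding B) (f : X -> A * B) :
  PT f -> PT (fun x => (f x).2).
Proof. by apply: PT_comp; apply: PT_snd. Qed.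

Lemma PT_at X T A B (EX : encoding X) (ET : encoding T) (EA : encoding A)
    (EB : encoding B) (p : X -> A -> B) :
  PT (fun q : X * A => p q.1 q.2) -> PT (fun q : X * T * A => p q.1.1 q.2).
Proof.
have H : PT (fun q : X * T * A => (q.1.1, q.2)).
  by apply: PT_pair; [apply: PT_fst'; apply: PT_fst | apply: PT_snd].
by move=> Hp; exact: PT_comp Hp H.
Qed.

Section OneType.
Context {A : Type} {EA : encoding A}.

Lemma PT_if X (EX : encoding X) (b : X -> bool) (f g : X -> A) : PT b -> PT f -> PT g ->
  PT (fun x => if b x then f x else g x).
Proof. by move=> Hb; apply: PT_branch Hb _ => x; case: (b x). Qed.

Lemma PT_cons X (EX : encoding X) (f : X -> A) (l : X -> seq A) : PT f -> PT l -> PT (fun x => f x :: l x).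
Proof. by move=> Hf Hl; apply: PTm_retype (PT_pair Hf Hl) _. Qed.

Lemma PT_behead X (EX : encoding X) (l : X -> seq A) : PT l -> PT (fun x => behead (l x)).
Proof. by move=> Hl; apply: PT_tail Hl _ => x; case: (l x). Qed.

Lemma PT_headd X (EX : encoding X) (a0 : A) (l : X -> seq A) : enc a0 = Leaf -> PT l ->
  PT (fun x => head a0 (l x)).
Proof. by move=> E Hl; apply: PT_head Hl _ => x; case: (l x). Qed.

Lemma PT_nilp X (EX : encoding X) (l : X -> seq A) : PT l -> PT (fun x => nilp (l x)).
Proof.
move=> Hl; have H : PT (fun x => if ~~ nilp (l x) then false else true).
  by apply: (PT_branch Hl); [move=> x; case: (l x) | apply: PT_const | apply: PT_const].
by apply: PT_eq H _ => x; case: (nilp _).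
Qed.

End OneType.

Lemma PT_negb X (EX : encoding X) (b : X -> bool) : PT b -> PT (fun x => ~~ b x).
Proof.
move=> Hb; apply: PT_eq (PT_if Hb (PT_const false) (PT_const true)) _ => x.
by case: (b x).
Qed.

Lemma PT_andb X (EX : encoding X) (b c : X -> bool) : PT b -> PT c -> PT (fun x => b x && c x).
Proof. by move=> Hb Hc; apply: PT_eq (PT_if Hb Hc (PT_const false)) _. Qed.

Lemma PT_orb X (EX : encoding X) (b c : X -> bool) : PT b -> PT c -> PT (fun x => b x || c x).
Proof. by move=> Hb Hc; apply: PT_eq (PT_if Hb (PT_const true) Hc) _. Qed.

Lemma PT_implyb X (EX : encoding X) (b c : X -> bool) : PT b -> PT c -> PT (fun x => b x ==> c x).
Proof. by move=> Hb Hc; apply: PT_eq (PT_if Hb Hc (PT_const true)) _. Qed.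

Lemma PT_succ X (EX : encoding X) (n : X -> nat) : PT n -> PT (fun x => (n x).+1).
Proof. by move=> Hn; apply: PTm_retype (PT_pair (PT_const 0) Hn) _. Qed.

Lemma PT_pred X (EX : encoding X) (n : X -> nat) : PT n -> PT (fun x => (n x).-1).
Proof. by move=> Hn; apply: PT_tail Hn _ => x; case: (n x). Qed.

(** [PTm_fold] takes a step without parameters, so the argument [x] is carried along in the
    accumulator. *)
Lemma PT_foldl X A T (EX : encoding X) (EA : encoding A) (ET : encoding T) (F : X -> T -> A -> T)
    (i : X -> T) (l : X -> seq A) :
  PT (fun q : X * T * A => F q.1.1 q.1.2 q.2) -> PT i -> PT l ->
  (exists2 w, poly_bounded sz w &
     forall x u v, l x = u ++ v -> sz (foldl (F x) (i x) u) <= w x) ->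
  PT (fun x => foldl (F x) (i x) (l x)).
Proof.
move=> HF Hi Hl [w Hw le_w].
pose G (st : X * T) (a : A) := (st.1, F st.1 st.2 a).
have E x s : foldl G (x, i x) s = (x, foldl (F x) (i x) s).
  by elim: s (i x) => //= a s IH t; rewrite IH.
apply: PT_eq (PT_snd' (PTm_fold (F := G) (l := l) (i := fun x => (x, i x)) _ _ _ _ _)) _;
  last by move=> x; rewrite E.
- exact: pb_mu.
- have P : PT (fun p : A * (X * T) => (p.2, p.1)).
    by apply: PT_pair; [apply: PT_snd | apply: PT_fst].
  have Q : PT (fun p : A * (X * T) => F p.2.1 p.2.2 p.1) by exact: PT_comp HF P.
  have R : PT (fun p : A * (X * T) => p.2.1) by apply: PT_fst'; apply: PT_snd.
  exact: (PT_pair R Q).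
- exact: Hl.
- by apply: PT_pair Hi; apply: PT_id.
- exists (fun x => sz x + w x + 1).
    by do ![apply: pb_add | apply: pb_const | apply: pb_mu | done].
  by move=> x u v /le_w le; rewrite E sz_pair addn1 ltnS leq_add2l.
Qed.

Lemma PT_rev X A (EX : encoding X) (EA : encoding A) (l : X -> seq A) : PT l -> PT (fun x => rev (l x)).
Proof.
move=> Hl; have E s t : foldl (fun s (a : A) => a :: s) t s = catrev s t.
  by elim: s t => //= a s IH t; rewrite IH.
apply: PT_eq (PT_foldl (F := fun _ s (a : A) => a :: s) (i := fun=> [::]) _ _ Hl _) _.
- by apply: PT_cons; [apply: PT_snd | apply: PT_snd'; apply: PT_fst].
- exact: PT_const.
- exists (fun x => sz (l x)); first by case: Hl => [c [t []]].
  by move=> x u v ->; rewrite E -/(rev _) sz_rev sz_catl.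
- by move=> x; rewrite /= E.
Qed.

(** A left fold over the reversed list: prefixes of the reversal are reversed suffixes, hence the
    bound on suffixes. *)
Lemma PT_foldr X A T (EX : encoding X) (EA : encoding A) (ET : encoding T) (F : X -> A -> T -> T)
    (i : X -> T) (l : X -> seq A) :
  PT (fun q : X * T * A => F q.1.1 q.2 q.1.2) -> PT i -> PT l ->
  (exists2 w, poly_bounded sz w &
     forall x u v, l x = u ++ v -> sz (foldr (F x) (i x) v) <= w x) ->
  PT (fun x => foldr (F x) (i x) (l x)).
Proof.
move=> HF Hi Hl [w Hw le_w].
apply: PT_eq (PT_foldl (F := fun x t a => F x a t) HF Hi (PT_rev Hl) _) _; last first.
  by move=> x; rewrite foldl_rev.
exists w => // x u v E; have := le_w x (rev v) (rev u).
by rewrite -rev_cat -E revK => /(_ erefl); rewrite -(revK u) foldl_rev revK.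
Qed.

Lemma PT_iter X T (EX : encoding X) (ET : encoding T) (F : X -> T -> T) (i : X -> T) (n : X -> nat) :
  PT (fun q : X * T => F q.1 q.2) -> PT i -> PT n ->
  (exists2 w, poly_bounded sz w &
     forall x k, k <= n x -> sz (iter k (F x) (i x)) <= w x) ->
  PT (fun x => iter (n x) (F x) (i x)).
Proof.
move=> HF Hi Hn [w Hw le_w].
have E x s : foldl (fun t (_ : nat) => F x t) (i x) s = iter (size s) (F x) (i x).
  by rewrite -(revK s) foldl_rev size_rev; elim: (rev s) => //= _ s' ->.
have Hl : PT (fun x => nseq (n x) 0) by apply: PTm_retype Hn _ => x; rewrite enc_nseq.
apply: PT_eq (PT_foldl (F := fun x t (_ : nat) => F x t) _ Hi Hl _) _.
- by apply: PT_comp HF _; apply: PT_fst.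
- exists w => // x u v /(congr1 size); rewrite size_nseq size_cat E => En.
  by apply: le_w; rewrite En leq_addr.
- by move=> x; rewrite E size_nseq.
Qed.

Section Lists.
Context {A : Type} {EA : encoding A}.

Lemma PT_all X (EX : encoding X) (p : X -> A -> bool) (l : X -> seq A) :
  PT (fun q : X * A => p q.1 q.2) -> PT l -> PT (fun x => all (p x) (l x)).
Proof.
move=> Hp Hl.
apply: PT_eq (PT_foldl (F := fun x b a => b && p x a) (i := fun=> true) _ _ Hl _) _.
- apply: PT_andb; first by apply: PT_snd'; apply: PT_fst.
  exact: PT_at Hp.
- exact: PT_const.
- by exists (fun=> 3) => [|x u v _]; [apply: pb_const | apply: sz_bool].
- move=> x; elim: (l x) => //= a s <-; case: (p x a) => //=.
  by elim: s.
Qed.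

Lemma PT_has X (EX : encoding X) (p : X -> A -> bool) (l : X -> seq A) :
  PT (fun q : X * A => p q.1 q.2) -> PT l -> PT (fun x => has (p x) (l x)).
Proof.
move=> Hp Hl; apply: PT_eq (PT_negb (PT_all (PT_negb Hp) Hl)) _ => x /=.
by rewrite -has_predC; apply: eq_has => a; exact: negbK.
Qed.

Lemma PT_filter X (EX : encoding X) (p : X -> A -> bool) (l : X -> seq A) :
  PT (fun q : X * A => p q.1 q.2) -> PT l -> PT (fun x => filter (p x) (l x)).
Proof.
move=> Hp Hl.
apply: PT_eq (PT_foldr (F := fun x a s => if p x a then a :: s else s)
  (i := fun=> [::]) _ _ Hl _) _.
- apply: PT_if.
  + exact: PT_at Hp.
  + by apply: PT_cons; [apply: PT_snd | apply: PT_snd'; apply: PT_fst].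
  + by apply: PT_snd'; apply: PT_fst.
- exact: PT_const.
- exists (fun x => sz (l x)); first by case: Hl => [c [t []]].
  move=> x u v ->; apply: leq_trans (sz_filter (p x) v) _.
  exact: sz_catr.
- by [].
Qed.

Lemma PT_map X B (EX : encoding X) (EB : encoding B) (f : X -> A -> B) (l : X -> seq A) :
  PT (fun q : X * A => f q.1 q.2) -> PT l -> PT (fun x => map (f x) (l x)).
Proof.
move=> Hf Hl.
apply: PT_eq (PT_foldr (F := fun x a s => f x a :: s) (i := fun=> [::]) _ _ Hl _) _.
- apply: PT_cons; last by apply: PT_snd'; apply: PT_fst.
  exact: PT_at Hf.
- exact: PT_const.
- have [c [t [_ _ [k Hk]]]] := Hf; have [c' [t' [_ _ Hsl]]] := Hl.
  pose b (x : X) := (@sz _ EX x + @sz _ (enc_seq EA) (l x) + 1 + 2) ^ k.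
  exists (fun x => 1 + sz (l x) * (b x + 1)).
    have P : poly_bounded id (fun n => (n + 2) ^ k) by exists k.
    have Q : poly_bounded sz (fun x => sz x + sz (l x) + 1).
      by do ![apply: pb_add | apply: pb_const | apply: pb_mu | done].
    have R := pb_comp P Q.
    by do ![apply: pb_add | apply: pb_mul | apply: pb_const | done].
  move=> x u v El; have le_v : sz v <= sz (l x).
    by rewrite El; generalize (sz_cat u v); generalize (sz_gt0 u); lia.
  have {}El : forall a v1 v2, v = v1 ++ a :: v2 -> sz (f x a) <= b x.
    move=> a v1 v2 Ev; apply: leq_trans (Hk (x, a)) _; rewrite /b.
    case: (k) => // k'; rewrite leq_exp2r // leq_add2r sz_pair addn1 ltnS leq_add2l.
    apply: leq_trans le_v; rewrite Ev; generalize (sz_cat v1 (a :: v2)).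
    by rewrite sz_cons; generalize (sz_gt0 v1); lia.
  apply: (@leq_trans (1 + sz v * (b x + 1))); last by rewrite leq_add2l leq_mul2r le_v orbT.
  rewrite -[foldr _ _ _]/(map (f x) v).
  elim: v {le_v} El => [|a v IH] El; first by [].
  rewrite map_cons !sz_cons; have := El a [::] v erefl.
  have {}/IH : forall a v1 v2, v = v1 ++ a :: v2 -> sz (f x a) <= b x.
    by move=> a' v1 v2 E; apply: (El a' (a :: v1) v2); rewrite E.
  rewrite mulSn mulnDl => H1 H2.
  have := leq_add H2 H1; lia.
- by [].
Qed.

Lemma PT_size X (EX : encoding X) (l : X -> seq A) : PT l -> PT (fun x => size (l x)).
Proof.
move=> Hl.
apply: PT_eq (PT_foldr (F := fun x (a : A) n => n.+1) (i := fun=> 0) _ _ Hl _) _.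
- by apply: PT_succ; apply: PT_snd'; apply: PT_fst.
- exact: PT_const.
- have [c' [t' [_ _ Hsl]]] := Hl.
  exists (fun x => 2 * sz (l x) + 1).
    by do ![apply: pb_add | apply: pb_mul | apply: pb_const | done].
  move=> x u v ->; rewrite sz_nat leq_add2r leq_mul2l /=.
  generalize (size_le_sz (u ++ v)); rewrite size_cat => H.
  rewrite -[foldr _ _ _]/(size v); lia.
- by [].
Qed.

Lemma PT_cat X (EX : encoding X) (l m : X -> seq A) :
  PT l -> PT m -> PT (fun x => l x ++ m x).
Proof.
move=> Hl Hm.
have E s t : foldr (fun a s => a :: s) s t = t ++ s :> seq A.
  by elim: t => //= a t ->.
apply: PT_eq (PT_foldr (F := fun x (a : A) s => a :: s) _ Hm Hl _) _.
- by apply: PT_cons; [apply: PT_snd | apply: PT_snd'; apply: PT_fst].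
- have [c' [t' [_ _ Hsl]]] := Hl; have [c [t [_ _ Hsm]]] := Hm.
  exists (fun x => sz (l x) + sz (m x)); first exact: pb_add.
  move=> x u v ->; rewrite E.
  by generalize (sz_cat u v); generalize (sz_gt0 u); generalize (sz_cat v (m x)); lia.
- by move=> x; rewrite /= E.
Qed.

Lemma PT_flatten X (EX : encoding X) (l : X -> seq (seq A)) :
  PT l -> PT (fun x => flatten (l x)).
Proof.
move=> Hl.
apply: PT_eq (PT_foldr (F := fun x (a : seq A) s => a ++ s) (i := fun=> [::]) _ _ Hl _) _.
- by apply: PT_cat; [apply: PT_snd | apply: PT_snd'; apply: PT_fst].
- exact: PT_const.
- have [c' [t' [_ _ Hsl]]] := Hl.
  exists (fun x => sz (l x)) => // x u v ->.
  rewrite -[foldr _ _ _]/(flatten v); apply: leq_trans (sz_flatten v) _.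
  exact: sz_catr.
- by [].
Qed.

End Lists.

Lemma pb_sz X A (EX : encoding X) (EA : encoding A) (f : X -> A) :
  PT f -> poly_bounded sz (fun x => sz (f x)).
Proof. by case=> [c [t []]]. Qed.

Lemma PT_addn X (EX : encoding X) (m n : X -> nat) : PT m -> PT n -> PT (fun x => m x + n x).
Proof.
move=> Hm Hn; apply: PT_eq (PT_iter (F := fun _ k => k.+1) _ Hn Hm _) _.
- by apply: PT_succ; apply: PT_snd.
- exists (fun x => sz (m x) + sz (n x)).
    by apply: pb_add; apply: pb_sz.
  by move=> x k le; rewrite iter_succn !sz_nat; lia.
- by move=> x; rewrite /= iter_succn addnC.
Qed.

Lemma PT_muln X (EX : encoding X) (m n : X -> nat) : PT m -> PT n -> PT (fun x => m x * n x).
Proof.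
move=> Hm Hn.
have E x k : iter k (addn (n x)) 0 = k * n x by elim: k => //= k ->; rewrite mulSn.
apply: PT_eq (PT_iter (F := fun x k => n x + k) (i := fun=> 0) _ _ Hm _) _.
- apply: PT_addn; last exact: PT_snd.
  by apply: (PT_comp Hn); apply: PT_fst.
- exact: PT_const.
- exists (fun x => sz (m x) * sz (n x)).
    by apply: pb_mul; apply: pb_sz.
  move=> x k le; rewrite E !sz_nat.
  by apply: (@leq_trans (2 * (m x * n x) + 1)); [rewrite leq_add2r leq_mul2l leq_mul2r le orbT | nia].
- by move=> x; rewrite /= E.
Qed.

Lemma PT_subn X (EX : encoding X) (m n : X -> nat) : PT m -> PT n -> PT (fun x => m x - n x).
Proof.
move=> Hm Hn.
have E a k : iter k predn a = a - k by elim: k => [|k /= ->]; rewrite ?subn0 ?subnS.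
apply: PT_eq (PT_iter (F := fun _ k => k.-1) _ Hm Hn _) _.
- by apply: PT_pred; apply: PT_snd.
- exists (fun x => sz (m x)); first exact: pb_sz.
  by move=> x k le; rewrite E !sz_nat; lia.
- by move=> x; rewrite /= E.
Qed.

Lemma PT_leq X (EX : encoding X) (m n : X -> nat) : PT m -> PT n -> PT (fun x => m x <= n x).
Proof.
move=> Hm Hn; have H : PT (fun x => if 0 < m x - n x then false else true).
  apply: (PT_branch (PT_subn Hm Hn)); [|exact: PT_const|exact: PT_const].
  by move=> x; case: (m x - n x).
by apply: PT_eq H _ => x; rewrite subn_gt0 ltnNge; case: (_ <= _).
Qed.

Lemma PT_eqn X (EX : encoding X) (m n : X -> nat) : PT m -> PT n -> PT (fun x => m x == n x).
Proof.
move=> Hm Hn; apply: PT_eq (PT_andb (PT_leq Hm Hn) (PT_leq Hn Hm)) _ => x.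
by rewrite eqn_leq.
Qed.

Lemma PT_eqb X (EX : encoding X) (b c : X -> bool) : PT b -> PT c -> PT (fun x => b x == c x).
Proof.
move=> Hb Hc; apply: PT_eq (PT_if Hb Hc (PT_negb Hc)) _ => x.
by case: (b x); case: (c x).
Qed.

Lemma PT_mem X (EX : encoding X) (n : X -> nat) (l : X -> seq nat) :
  PT n -> PT l -> PT (fun x => n x \in l x).
Proof.
move=> Hn Hl; apply: PT_eq (PT_has (p := fun x a => a == n x) _ Hl) _.
  by apply: PT_eqn; [apply: PT_snd | apply: (PT_comp Hn); apply: PT_fst].
by move=> x; rewrite has_pred1.
Qed.

(** Syntax-directed on the body of the function, the components being found by second-order
    matching. Defined functions such as [face_eq] have no case and remain as goals for their own
    lemmas. *)
Ltac pt_step :=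
  lazymatch goal with
  | |- PTm _ (@fst _ _) => apply: PT_fst
  | |- PTm _ (@snd _ _) => apply: PT_snd
  | |- PTm _ (fun x => x) => apply: PT_id
  | |- PTm _ (fun _ => ?b) => apply: PT_const
  | |- PTm _ (fun x => (@?f x).1) => apply: (@PT_fst' _ _ _ _ _ _ f)
  | |- PTm _ (fun x => (@?f x).2) => apply: (@PT_snd' _ _ _ _ _ _ f)
  | |- PTm _ (fun x => (@?f x, @?g x)) => apply: (@PT_pair _ _ _ _ _ _ f g)
  | |- PTm _ (fun x => match @?b x with true => @?f x | false => @?g x end) =>
      apply: (@PT_if _ _ _ _ b f g)
  | |- PTm _ (fun x => ~~ @?b x) => apply: (@PT_negb _ _ b)
  | |- PTm _ (fun x => @?b x && @?c x) => apply: (@PT_andb _ _ b c)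
  | |- PTm _ (fun x => @?b x || @?c x) => apply: (@PT_orb _ _ b c)
  | |- PTm _ (fun x => @?b x ==> @?c x) => apply: (@PT_implyb _ _ b c)
  | |- PTm _ (fun x => @?f x :: @?l x) => apply: (@PT_cons _ _ _ _ f l)
  | |- PTm _ (fun x => behead (@?l x)) => apply: (@PT_behead _ _ _ _ l)
  | |- PTm _ (fun x => head ?d (@?l x)) => apply: (@PT_headd _ _ _ _ d l); first by []
  | |- PTm _ (fun x => nilp (@?l x)) => apply: (@PT_nilp _ _ _ _ l)
  | |- PTm _ (fun x => (@?f x).+1) => apply: (@PT_succ _ _ f)
  | |- PTm _ (fun x => (@?f x).-1) => apply: (@PT_pred _ _ f)
  | |- PTm _ (fun x => rev (@?l x)) => apply: (@PT_rev _ _ _ _ l)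
  | |- PTm _ (fun x => all (@?p x) (@?l x)) => apply: (@PT_all _ _ _ _ p l)
  | |- PTm _ (fun x => has (@?p x) (@?l x)) => apply: (@PT_has _ _ _ _ p l)
  | |- PTm _ (fun x => filter (@?p x) (@?l x)) => apply: (@PT_filter _ _ _ _ p l)
  | |- PTm _ (fun x => map (@?p x) (@?l x)) => apply: (@PT_map _ _ _ _ _ _ p l)
  | |- PTm _ (fun x => size (@?l x)) => apply: (@PT_size _ _ _ _ l)
  | |- PTm _ (fun x => @?l x ++ @?m x) => apply: (@PT_cat _ _ _ _ l m)
  | |- PTm _ (fun x => flatten (@?l x)) => apply: (@PT_flatten _ _ _ _ l)
  | |- PTm _ (fun x => @?m x + @?n x) => apply: (@PT_addn _ _ m n)
  | |- PTm _ (fun x => @?m x * @?n x) => apply: (@PT_muln _ _ m n)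
  | |- PTm _ (fun x => @?m x - @?n x) => apply: (@PT_subn _ _ m n)
  | |- PTm _ (fun x => @?m x <= @?n x) => apply: (@PT_leq _ _ m n)
  | |- PTm _ (fun x => @?n x \in @?l x) => apply: (@PT_mem _ _ n l)
  | |- PTm _ (fun x => @?m x == @?n x) =>
      first [apply: (@PT_eqn _ _ m n) | apply: (@PT_eqb _ _ m n)]
  end.
Ltac pt := repeat first [assumption | pt_step].

(** * The verifier *)

Definition face_sub (s t : seq nat) : bool := all (fun v => v \in t) s.
Definition face_eq (s t : seq nat) : bool := face_sub s t && face_sub t s.
Definition has_face (s : seq nat) (K : seq (seq nat)) : bool :=
  has (fun t => face_eq s t) K.
Definition card_face (s : seq nat) : nat := size (undup s).
Definition remove (v : nat) (s : seq nat) : seq nat := filter (fun u => u != v) s.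

(** Closure is tested for the removal of one vertex only. Arbitrary nonempty subsets follow by
    removing vertices one at a time, and the test stays polynomial. *)
Definition simplicial (K : seq (seq nat)) : bool :=
  all (fun s => ~~ nilp s &&
    all (fun v => nilp (remove v s) || has_face (remove v s) K) s) K.

Definition collapsible (K : seq (seq nat)) (t s : seq nat) : bool :=
  [&& simplicial K, has_face t K, has_face s K, face_sub s t,
      card_face t == (card_face s).+1 &
      all (fun r => (card_face r == card_face t) && face_sub s r ==> face_eq r t) K].

Definition delete (K : seq (seq nat)) (t s : seq nat) : seq (seq nat) :=
  filter (fun r => ~~ face_eq r t && ~~ face_eq r s) K.

Lemma PT_face_sub X (EX : encoding X) (s t : X -> seq nat) :
  PT s -> PT t -> PT (fun x => face_sub (s x) (t x)).
Proof.
move=> Hs Ht; apply: (PT_comp2 (h := face_sub)) Hs Ht; rewrite /face_sub; pt.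
Qed.

Lemma PT_face_eq X (EX : encoding X) (s t : X -> seq nat) :
  PT s -> PT t -> PT (fun x => face_eq (s x) (t x)).
Proof. by move=> Hs Ht; apply: PT_andb; apply: PT_face_sub. Qed.

Lemma PT_has_face X (EX : encoding X) (s : X -> seq nat) (K : X -> seq (seq nat)) :
  PT s -> PT K -> PT (fun x => has_face (s x) (K x)).
Proof.
move=> Hs HK; apply: (PT_comp2 (h := has_face)) Hs HK; rewrite /has_face; pt.
by apply: PT_face_eq; pt.
Qed.

Lemma PT_undup X (EX : encoding X) (s : X -> seq nat) :
  PT s -> PT (fun x => undup (s x)).
Proof.
move=> Hs.
have E (t : seq nat) : foldr (fun (a : nat) (u : seq nat) =>
    if a \in u then u else a :: u) [::] t = undup t.
  by elim: t => //= a t ->; rewrite mem_undup.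
apply: PT_eq (PT_foldr (F := fun _ (a : nat) (t : seq nat) => if a \in t then t else a :: t)
  (i := fun=> [::]) _ _ Hs _) _.
- by pt.
- exact: PT_const.
- exists (fun x => sz (s x)); first exact: pb_sz.
  move=> x u v ->; rewrite E.
  apply: leq_trans (sz_catr u v).
  elim: v => //= a v IH; case: (a \in v); rewrite !sz_cons ?ltnS ?leq_add2l //.
  by apply: leq_trans IH _; rewrite leqW // leq_addl.
- by move=> x; rewrite /= E.
Qed.

Lemma PT_card_face X (EX : encoding X) (s : X -> seq nat) :
  PT s -> PT (fun x => card_face (s x)).
Proof. by move=> Hs; apply: PT_size; apply: PT_undup. Qed.

Lemma PT_remove X (EX : encoding X) (v : X -> nat) (s : X -> seq nat) :
  PT v -> PT s -> PT (fun x => remove (v x) (s x)).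
Proof. by move=> Hs HK; apply: (PT_comp2 (h := remove)) Hs HK; rewrite /remove; pt. Qed.

Lemma PT_simplicial X (EX : encoding X) (K : X -> seq (seq nat)) :
  PT K -> PT (fun x => simplicial (K x)).
Proof.
apply: (PT_comp (g := simplicial)); rewrite /simplicial; pt.
- by apply: PT_remove; pt.
- by apply: PT_has_face; pt; apply: PT_remove; pt.
Qed.

Lemma PT_collapsible X (EX : encoding X) (K : X -> seq (seq nat)) (t s : X -> seq nat) :
  PT K -> PT t -> PT s -> PT (fun x => collapsible (K x) (t x) (s x)).
Proof.
move=> HK Ht Hs.
apply: (PT_comp2 (h := fun K p => collapsible K p.1 p.2)) HK (PT_pair Ht Hs).
rewrite /collapsible; pt; try by apply: PT_card_face; pt.
- by apply: PT_simplicial; pt.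
- by apply: PT_has_face; pt.
- by apply: PT_has_face; pt.
- by apply: PT_face_sub; pt.
- by apply: PT_face_sub; pt.
- by apply: PT_face_eq; pt.
Qed.

Lemma PT_delete X (EX : encoding X) (K : X -> seq (seq nat)) (t s : X -> seq nat) :
  PT K -> PT t -> PT s -> PT (fun x => delete (K x) (t x) (s x)).
Proof.
move=> HK Ht Hs.
apply: (PT_comp2 (h := fun K p => delete K p.1 p.2)) HK (PT_pair Ht Hs).
by rewrite /delete; pt; apply: PT_face_eq; pt.
Qed.

(** * Decoding the guesses *)

(* Each guessed bit halves the list of candidates. *)
Section Pick.
Variable A : Type.
Implicit Types (s : seq A) (g : seq bool).

(** Elements are dealt alternately, so the two parts differ in size by at most one and [l] bits
    single out an element among at most [2 ^ l]. *)
Definition split_list s : seq A * seq A :=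
  foldr (fun x p => (p.2, x :: p.1)) ([::], [::]) s.
Definition halve s (b : bool) : seq A := if b then (split_list s).1 else (split_list s).2.
Definition pick_step (st : seq A * seq bool) : seq A * seq bool :=
  (halve st.1 (head false st.2), behead st.2).
Definition pick (l : nat) s g : seq A := (iter l pick_step (s, g)).1.

End Pick.

Definition skip_bits (l : nat) (g : seq bool) : seq bool := iter l behead g.

Lemma sz_iter A (EA : encoding A) (F : A -> A) a k :
  (forall b, sz (F b) <= sz b) -> sz (iter k F a) <= sz a.
Proof. by move=> H; elim: k => //= k; apply: leq_trans. Qed.

Lemma sz_behead A (EA : encoding A) (s : seq A) : sz (behead s) <= sz s.
Proof. by case: s => //= a s; rewrite sz_cons; lia. Qed.

Lemma sz_split_list A (EA : encoding A) (s : seq A) :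
  sz (split_list s) = sz s + 2.
Proof. by elim: s => //= a s; case: (split_list s) => u v; rewrite !sz_pair !sz_cons /=; lia. Qed.

Lemma sz_halve A (EA : encoding A) (s : seq A) b : sz (halve s b) <= sz s.
Proof.
have := sz_split_list EA s; rewrite /halve; case: (split_list s) => u v.
by rewrite sz_pair /=; generalize (sz_gt0 u); generalize (sz_gt0 v); case: b => /=; lia.
Qed.

Lemma sz_pick_step A (EA : encoding A) (st : seq A * seq bool) :
  sz (pick_step st) <= sz st.
Proof.
case: st => s g; rewrite /pick_step !sz_pair ltnS.
by apply: leq_add; [apply: sz_halve | apply: sz_behead].
Qed.

Lemma PT_halve X A (EX : encoding X) (EA : encoding A) (s : X -> seq A) (b : X -> bool) :
  PT s -> PT b -> PT (fun x => halve (s x) (b x)).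
Proof.
move=> Hs Hb.
have H : PT (fun x => split_list (s x)).
  apply: PT_eq (PT_foldr (F := fun _ (a : A) (p : seq A * seq A) => (p.2, a :: p.1))
    (i := fun=> ([::], [::])) _ _ Hs _) _ => //; [by pt | by pt |].
  exists (fun x => sz (s x) + 2); first by apply: pb_add (pb_sz Hs) (pb_const _ _).
  move=> x u v ->; rewrite -[foldr _ _ _]/(split_list v) sz_split_list leq_add2r.
  exact: sz_catr.
by rewrite /halve; pt.
Qed.

Lemma PT_pick X A (EX : encoding X) (EA : encoding A) (l : X -> nat) (s : X -> seq A)
    (g : X -> seq bool) : PT l -> PT s -> PT g -> PT (fun x => pick (l x) (s x) (g x)).
Proof.
move=> Hl Hs Hg; rewrite /pick; apply: PT_fst'.
apply: (PT_iter (F := fun _ => @pick_step A)); [|by pt|by []|].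
  by rewrite /pick_step; pt; apply: PT_halve; pt.
exists (fun x => sz (s x, g x)); first by apply: pb_sz; pt.
by move=> x k _; apply: sz_iter; apply: sz_pick_step.
Qed.

Lemma PT_skip_bits X (EX : encoding X) (l : X -> nat) (g : X -> seq bool) :
  PT l -> PT g -> PT (fun x => skip_bits (l x) (g x)).
Proof.
move=> Hl Hg; rewrite /skip_bits.
apply: (PT_iter (F := fun _ => behead)); [by pt|by []|by []|].
exists (fun x => sz (g x)); first by apply: pb_sz.
by move=> x k _; apply: sz_iter; apply: sz_behead.
Qed.

(** * Guessed expansions and collapses, then greedy collapses of triangles *)

(* An illegal guess leaves the complex unchanged. *)
Definition expand (K : seq (seq nat)) (t s : seq nat) : seq (seq nat) :=
  if [&& ~~ has_face t K, ~~ has_face s K & collapsible (t :: s :: K) t s]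
  then t :: s :: K else K.

Definition contract (K : seq (seq nat)) (t s : seq nat) : seq (seq nat) :=
  if collapsible K t s then delete K t s else K.

Definition state : Type := (seq (seq nat) * seq bool)%type.

(** If [v] already lies in the face [t], the proposed simplex is an old face and nothing happens;
    this provides idle rounds. *)
Definition expand_at (K : seq (seq nat)) (t : seq nat) (v u : nat) : seq (seq nat) :=
  expand K (v :: t) (remove u (v :: t)).

Definition expand_step (l : nat) (V : seq nat) (st : state) : state :=
  (expand_at st.1 (head [::] (pick l st.1 st.2))
    (head 0 (pick l V (skip_bits l st.2)))
    (head 0 (pick l V (skip_bits l (skip_bits l st.2)))),
   skip_bits l (skip_bits l (skip_bits l st.2))).

Definition contract_step (l : nat) (st : state) : state :=
  (contract st.1 (head [::] (pick l st.1 st.2))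
     (head [::] (pick l st.1 (skip_bits l st.2))),
   skip_bits l (skip_bits l st.2)).

Definition greedy_step (K : seq (seq nat)) (t s : seq nat) : seq (seq nat) :=
  if card_face t == 3 then contract K t s else K.

(** The pairs come from the list at the start of the sweep; [contract] tests each against the
    current list, so pairs that have become stale do nothing. *)
Definition sweep (K : seq (seq nat)) : seq (seq nat) :=
  foldl (fun L t => foldl (fun L' s => greedy_step L' t s) L K) K K.

Definition one_dimensional (K : seq (seq nat)) : bool :=
  all (fun s => card_face s <= 2) K && has (fun s => card_face s == 2) K.

(** At most [2p] collapses of high dimension are needed, whence [p + p]. As many sweeps as there are
    faces suffice, since every sweep that changes something shortens the list. *)
Definition search (l : nat) (V : seq nat) (p : nat) (K : seq (seq nat)) (g : seq bool) : bool :=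
  let st := iter (p + p) (contract_step l) (iter p (expand_step l V) (K, g)) in
  one_dimensional (iter (size st.1) sweep st.1).

Lemma PT_expand X (EX : encoding X) (K : X -> seq (seq nat)) (t s : X -> seq nat) :
  PT K -> PT t -> PT s -> PT (fun x => expand (K x) (t x) (s x)).
Proof.
move=> HK Ht Hs; rewrite /expand; pt; try by apply: PT_has_face.
by apply: PT_collapsible; pt.
Qed.

Lemma PT_contract X (EX : encoding X) (K : X -> seq (seq nat)) (t s : X -> seq nat) :
  PT K -> PT t -> PT s -> PT (fun x => contract (K x) (t x) (s x)).
Proof.
move=> HK Ht Hs; rewrite /contract; pt; first by apply: PT_collapsible.
exact: PT_delete.
Qed.

Lemma PT_greedy_step X (EX : encoding X) (K : X -> seq (seq nat)) (t s : X -> seq nat) :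
  PT K -> PT t -> PT s -> PT (fun x => greedy_step (K x) (t x) (s x)).
Proof.
move=> HK Ht Hs; rewrite /greedy_step; pt; first by apply: PT_card_face.
exact: PT_contract.
Qed.

Lemma sz_contract K t s : sz (contract K t s) <= sz K.
Proof. by rewrite /contract; case: ifP => // _; apply: sz_filter. Qed.

Lemma sz_greedy_step K t s : sz (greedy_step K t s) <= sz K.
Proof. by rewrite /greedy_step; case: ifP => // _; apply: sz_contract. Qed.

Lemma foldl_le A B (m : A -> nat) (F : A -> B -> A) a s :
  (forall c b, m (F c b) <= m c) -> m (foldl F a s) <= m a.
Proof. by move=> H; elim: s a => //= b s IH a; apply: leq_trans (IH _) (H _ _). Qed.

Lemma PT_sweep X (EX : encoding X) (K : X -> seq (seq nat)) :
  PT K -> PT (fun x => sweep (K x)).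
Proof.
apply: (PT_comp (g := sweep)); rewrite /sweep.
have H : PT (fun q : (seq (seq nat) * seq (seq nat)) * seq nat =>
    foldl (fun L' s => greedy_step L' q.2 s) q.1.2 q.1.1).
  apply: (PT_foldl (F := fun q L' s => greedy_step L' q.2 s)); try by pt.
    by apply: PT_greedy_step; pt.
  exists (fun q => sz q.1.2); first by apply: (pb_sz (f := fun q => q.1.2)); pt.
  by move=> q u v _; apply: foldl_le => c b; apply: sz_greedy_step.
apply: (PT_foldl (F := fun K L t => foldl (fun L' s => greedy_step L' t s) L K));
  [exact: H | by pt | by pt |].
exists (fun K => sz K); first exact: pb_mu.
by move=> L u v _; apply: foldl_le => c b; apply: foldl_le => c' b'; apply: sz_greedy_step.
Qed.

Lemma sz_sweep K : sz (sweep K) <= sz K.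
Proof. by apply: foldl_le => c b; apply: foldl_le => c' b'; apply: sz_greedy_step. Qed.

Lemma PT_expand_step X (EX : encoding X) (l : X -> nat) (V : X -> seq nat) (st : X -> state) :
  PT l -> PT V -> PT st -> PT (fun x => expand_step (l x) (V x) (st x)).
Proof.
move=> Hl HV Hst; rewrite /expand_step.
have Hg : PT (fun x => (st x).2) by apply: PT_snd'.
have HK : PT (fun x => (st x).1) by apply: PT_fst'.
have H1 := PT_skip_bits Hl Hg; have H2 := PT_skip_bits Hl H1.
have H3 : PT (fun x => (st x).1) by apply: PT_fst'.
have Ht : PT (fun x => head [::] (pick (l x) (st x).1 (st x).2)).
  by pt; apply: PT_pick.
have Hv : PT (fun x => head 0 (pick (l x) (V x) (skip_bits (l x) (st x).2))).
  by pt; apply: PT_pick.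
have Hu : PT (fun x => head 0 (pick (l x) (V x)
    (skip_bits (l x) (skip_bits (l x) (st x).2)))).
  by pt; apply: PT_pick.
rewrite /expand_at; apply: PT_pair; last exact: PT_skip_bits.
by apply: PT_expand => //; [pt | apply: PT_remove => //; pt].
Qed.

Lemma PT_contract_step X (EX : encoding X) (l : X -> nat) (st : X -> state) :
  PT l -> PT st -> PT (fun x => contract_step (l x) (st x)).
Proof.
move=> Hl Hst; rewrite /contract_step.
have Hg : PT (fun x => (st x).2) by apply: PT_snd'.
have HK : PT (fun x => (st x).1) by apply: PT_fst'.
have H1 := PT_skip_bits Hl Hg.
apply: PT_pair; last exact: PT_skip_bits.
by apply: PT_contract => //; pt; apply: PT_pick.
Qed.

Lemma sz_skip_bits l g : sz (skip_bits l g) <= sz g.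
Proof. by apply: sz_iter => b; apply: sz_behead. Qed.

Lemma sz_contract_step l st : sz (contract_step l st) <= sz st.
Proof.
case: st => K g; rewrite /contract_step !sz_pair ltnS /=.
apply: leq_add; first exact: sz_contract.
by apply: leq_trans (sz_skip_bits _ _) (sz_skip_bits _ _).
Qed.

Definition faces_within (b n : nat) (K : seq (seq nat)) : bool :=
  all (fun s => sz s <= b) K && (size K <= n).

Lemma sz_faces_within b n K : faces_within b n K -> sz K <= 1 + n * (b + 1).
Proof.
case/andP => Hb Hn; apply: (@leq_trans (1 + size K * (b + 1))); last first.
  by rewrite leq_add2l leq_mul2r Hn orbT.
elim: K Hb {Hn} => //= s K IH /andP [Hs HK].
by rewrite sz_cons mulSn; have := IH HK; lia.
Qed.

Lemma faces_within_sz K : faces_within (sz K) (size K) K.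
Proof. by rewrite /faces_within leqnn andbT; apply/allP => s /sz_mem /ltnW. Qed.

Lemma faces_withinW b n b' n' K : b <= b' -> n <= n' ->
  faces_within b n K -> faces_within b' n' K.
Proof.
move=> le1 le2 /andP [Hb Hn]; rewrite /faces_within (leq_trans Hn) // andbT.
by apply: sub_all Hb => s /leq_trans; apply.
Qed.

Lemma mem_split_list (A : eqType) (s : seq A) x :
  (x \in s) = (x \in (split_list s).1) || (x \in (split_list s).2).
Proof. by elim: s => //= y s; rewrite !inE => ->; rewrite orbA orbC orbCA orbA. Qed.

Lemma halve_sub (A : eqType) (s : seq A) b : {subset halve s b <= s}.
Proof. by move=> x Hx; rewrite mem_split_list; case: b Hx => /= ->; rewrite ?orbT. Qed.

Lemma pick_sub (A : eqType) l (s : seq A) g : {subset pick l s g <= s}.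
Proof.
rewrite /pick; suff H st : {subset (iter l (@pick_step A) st).1 <= st.1}.
  exact: H (s, g).
by elim: l => //= l IH x /halve_sub /IH.
Qed.

Lemma head_pick (A : eqType) d l (s : seq A) g :
  head d (pick l s g) = d \/ head d (pick l s g) \in s.
Proof.
by have := @pick_sub A l s g; case: (pick l s g) => [|x t] H; [left | right; apply: H; rewrite inE eqxx].
Qed.

(** A new simplex is an old face with one vertex of [V] added, so face sizes grow additively and [p]
    rounds stay polynomial. [0 < b] covers the default face [[::]], of size 1. *)
Lemma faces_within_expand b n l V st : 0 < b -> faces_within b n st.1 ->
  faces_within (b + sz V + 1) n.+2 (expand_step l V st).1.
Proof.
move=> b0 HK; have le_b : b <= b + sz V + 1 by rewrite -addnA leq_addr.
have W := faces_withinW le_b (ltnW (leqnSn _)) HK.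
rewrite /= /expand_at /expand; case: ifP => // _.
have Ht : sz (head [::] (pick l st.1 st.2)) <= b.
  case: (head_pick [::] l st.1 st.2) => [->//|].
  by case/andP: HK => /allP H _ /H.
have Hv : sz (head 0 (pick l V (skip_bits l st.2))) <= sz V.
  case: (head_pick 0 l V (skip_bits l st.2)) => [->|/sz_mem/ltnW //].
  exact: sz_gt0.
move: Ht Hv; set t := head _ _; set v := head _ _ => Ht Hv.
have Hvt : sz (v :: t) <= b + sz V + 1 by rewrite sz_cons; lia.
rewrite /faces_within /= Hvt /= !ltnS; case/andP: W => -> _; rewrite andbT.
apply/andP; split; last by case/andP: HK.
exact: leq_trans (sz_filter _ (v :: t)) Hvt.
Qed.

Lemma PT_search X (EX : encoding X) (l : X -> nat) (V : X -> seq nat) (p : X -> nat)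
    (K : X -> seq (seq nat)) (g : X -> seq bool) :
  PT l -> PT V -> PT p -> PT K -> PT g ->
  PT (fun x => search (l x) (V x) (p x) (K x) (g x)).
Proof.
move=> Hl HV Hp HK Hg; rewrite /search.
pose e x := iter (p x) (expand_step (l x) (V x)) (K x, g x).
have He : PT e.
  apply: (PT_iter (F := fun x => expand_step (l x) (V x))); [|by pt|by []|].
    by apply: PT_expand_step; [exact: (PT_comp Hl (@PT_fst X state _ _))
      | exact: (PT_comp HV (@PT_fst X state _ _)) | pt].
  (* After at most [p] rounds there are at most [size K + 2p] faces, each of size at most
     [sz K + p (sz V + 1)]; the bits only get fewer. *)
  exists (fun x => (1 + (size (K x) + 2 * p x) *
      (sz (K x) + p x * (sz (V x) + 1) + 1)) + sz (g x) + 1).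
    have sz_nat_le X' (EX' : encoding X') (f : X' -> nat) : PT f -> poly_bounded sz f.
      by move=> Hf; apply: pb_le (pb_sz Hf) _ => x; rewrite sz_nat; lia.
    do ![apply: pb_add | apply: pb_mul | apply: pb_const | apply: pb_sz | done];
      apply: sz_nat_le; pt.
  move=> x k le_k; pose st k := iter k (expand_step (l x) (V x)) (K x, g x).
  have [H1 H2] : faces_within (sz (K x) + k * (sz (V x) + 1)) (size (K x) + 2 * k) (st k).1
      /\ sz (st k).2 <= sz (g x).
    elim: k {le_k} => [|k [IH1 IH2]] /=.
      by rewrite mul0n muln0 !addn0; split=> //; apply: faces_within_sz.
    split; last by do 3 apply: leq_trans (sz_skip_bits _ _) _.
    have := faces_within_expand (l x) (V x) _ IH1.
    rewrite addn_gt0 sz_gt0 => /(_ isT); apply: faces_withinW; last by lia.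
    by rewrite mulSn; lia.
  rewrite -/(st k); case: (st k) H1 H2 => L h /= H1 H2.
  have {}H1 := faces_withinW _ _ H1.
  have : faces_within (sz (K x) + p x * (sz (V x) + 1)) (size (K x) + 2 * p x) L.
    by apply: H1; rewrite leq_add2l ?leq_mul2r ?leq_mul2l ?le_k ?orbT.
  by move=> /sz_faces_within; rewrite sz_pair; lia.
pose c x := iter (p x + p x) (contract_step (l x)) (e x).
have Hc : PT c.
  apply: (PT_iter (F := fun x => contract_step (l x))); [|by []|by pt|].
    by apply: PT_contract_step; [exact: (PT_comp Hl (@PT_fst X state _ _)) | pt].
  exists (fun x => sz (e x)); first exact: pb_sz.
  by move=> x k _; apply: sz_iter; apply: sz_contract_step.
apply: (PT_comp (g := fun K => one_dimensional (iter (size K) sweep K)) (f := fun x => (c x).1));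
  last by pt.
apply: (PT_comp (g := one_dimensional)).
  by rewrite /one_dimensional; pt; apply: PT_card_face; pt.
apply: (PT_iter (F := fun _ => sweep)); [by apply: PT_sweep; pt|by pt|exact: PT_size PT_id|].
exists (fun K => sz K); first exact: pb_mu.
by move=> L k _; apply: sz_iter; apply: sz_sweep.
Qed.

(** * Parsing *)

Definition parse_state : Type :=
  (bool * (seq bool * (seq (seq bool) * seq (seq (seq bool)))))%type.

(* Words are read from the right: the state holds a validity flag, the current
   numeral, the current face and the list of faces. *)
Definition parse_step (a : symbol) (st : parse_state) : parse_state :=
  let: (ok, (cur, (face, F))) := st in
  match a with
  | Bit b => (ok, (b :: cur, (face, F)))
  | Comma => (ok, ([::], (cur :: face, F)))
  | Semicolon => (ok && nilp cur, ([::], ([::], face :: F)))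
  end.

Definition parse (w : seq symbol) : parse_state :=
  foldr parse_step (true, ([::], ([::], [::]))) w.

(** Exactly the numerals produced by [bits_of_nat]. Membership in the language requires the word to
    equal an encoding, so leading zeros must be rejected. *)
Definition canonical (s : seq bool) : bool := head false s || (size s == 1).

Definition same_bits_step (st : bool * seq bool) (b : bool) : bool * seq bool :=
  (st.1 && (~~ nilp st.2 && (head false st.2 == b)), behead st.2).

Definition same_bits (s t : seq bool) : bool :=
  (foldl same_bits_step (true, t) s).1 && nilp (foldl same_bits_step (true, t) s).2.

Definition position (v : seq bool) (vs : seq (seq bool)) : nat :=
  foldr (fun a n => if same_bits a v then 0 else n.+1) 0 vs.

Definition down_from (n : nat) : seq nat := iter n (fun s => size s :: s) [::].

Definition well_formed (ps : parse_state) : bool :=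
  [&& ps.1, nilp ps.2.2.1, canonical ps.2.1 & all (all canonical) ps.2.2.2].

(** Unary vertex names could be exponential in the length of the word, whereas positions in the list
    of all vertex occurrences are smaller than that length. *)
Definition renamed (F : seq (seq (seq bool))) : seq (seq nat) :=
  map (map (fun v => position v (flatten F))) F.

Definition two_dimensional (K : seq (seq nat)) : bool :=
  [&& simplicial K, has (fun s => card_face s == 3) K & all (fun s => card_face s <= 3) K].

(** The state is [(2 ^ j, j)], advanced as long as the power does not exceed [n]. *)
Definition log_step (n : nat) (st : nat * nat) : nat * nat :=
  if st.1 + st.1 <= n then (st.1 + st.1, st.2.+1) else st.

Definition floor_log (n : nat) : nat := (iter n (log_step n) (1, 0)).2.

(** The bits of one choice. It must be a multiple of the rounded-down logarithm by a function of
    [p], because this is all the nondeterminism allowed, yet large enough for lists of [n + 2p]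
    candidates. *)
Definition guess_length (p n : nat) : nat := (p + p + 2) * floor_log n.

Definition verify (g : seq bool) (w : seq symbol) (p : nat) : bool :=
  let F := (parse w).2.2.2 in
  [&& well_formed (parse w), two_dimensional (renamed F) &
   search (guess_length p (size w)) (down_from (size (flatten F) + p)) p (renamed F) g].

Lemma PT_is_bit (b : bool) : PT (fun a : symbol => a == Bit b).
Proof.
case: b; [apply: PT_head PT_id _ | apply: PT_tail PT_id _]; by case=> [[]| |].
Qed.

Lemma PT_is_semicolon : PT (fun a : symbol => a == Semicolon).
Proof.
have H : PT (fun a : symbol => if a != Semicolon then false else true).
  by apply: (PT_branch PT_id); [case=> [[]| |] | exact: PT_const | exact: PT_const].
by apply: PT_eq H _; case=> [[]| |].
Qed.

Lemma PT_parse : PT parse.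
Proof.
(* [parse_step] rewritten with equality tests and projections, the form that the closure rules
   accept. *)
pose F (a : symbol) (st : parse_state) : parse_state :=
  if a == Bit true then (st.1, (true :: st.2.1, st.2.2)) else
  if a == Bit false then (st.1, (false :: st.2.1, st.2.2)) else
  if a == Semicolon then (st.1 && nilp st.2.1, ([::], ([::], st.2.2.1 :: st.2.2.2)))
  else (st.1, ([::], (st.2.1 :: st.2.2.1, st.2.2.2))).
have EF a st : F a st = parse_step a st by case: st a => [ok [cur [face G]]] [[]| |].
have sz_step a st : sz (parse_step a st) <= sz st + 8.
  case: st a => [ok [cur [face G]]] [b| |]; rewrite /parse_step !sz_pair ?sz_cons ?sz_nil.
  - by have := sz_bool b; lia.
  - by lia.
  - by have := sz_bool (ok && nilp cur); have := @sz_gt0 _ _ ok; lia.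
apply: PT_eq (PT_foldr (X := seq symbol) (F := fun _ => F)
  (i := fun=> (true, ([::], ([::], [::])))) (l := id) _ _ PT_id _) _.
- have Ha (b : bool) : PT (fun q : seq symbol * parse_state * symbol => q.2 == Bit b).
    exact: PT_comp (PT_is_bit b) (@PT_snd _ _ _ _).
  have Hs : PT (fun q : seq symbol * parse_state * symbol => q.2 == Semicolon).
    exact: PT_comp PT_is_semicolon (@PT_snd _ _ _ _).
  by rewrite /F; apply: PT_if => //; [pt | apply: PT_if => //; [pt | apply: PT_if => //; pt]].
- by pt.
- exists (fun w => 12 + 8 * sz w).
    by do ![apply: pb_add | apply: pb_mul | apply: pb_const | apply: pb_mu].
  move=> w u v ->; apply: (@leq_trans (12 + 8 * sz v)); last first.
    by rewrite leq_add2l leq_mul2l /= sz_catr.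
  elim: v => [|a v IH]; first by [].
  rewrite /= EF sz_cons; apply: leq_trans (sz_step _ _) _.
  by apply: leq_trans (leq_add IH (leqnn 8)) _; lia.
- by elim=> //= a w ->; rewrite EF.
Qed.

Lemma PT_canonical X (EX : encoding X) (s : X -> seq bool) :
  PT s -> PT (fun x => canonical (s x)).
Proof. by move=> Hs; rewrite /canonical; pt. Qed.

Lemma PT_same_bits X (EX : encoding X) (s t : X -> seq bool) :
  PT s -> PT t -> PT (fun x => same_bits (s x) (t x)).
Proof.
move=> Hs Ht; rewrite /same_bits.
have H : PT (fun x => foldl same_bits_step (true, t x) (s x)).
  apply: (PT_foldl (F := fun _ => same_bits_step)); [by rewrite /same_bits_step; pt
    | by pt | by [] |].
  exists (fun x => 4 + sz (t x)).
    by apply: pb_add (pb_const _ _) (pb_sz Ht).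
  move=> x u v _; pose m (z : seq bool) := @sz _ (enc_seq enc_bool) z.
  suff [b [z [-> le]]] : exists b z,
    foldl same_bits_step (true, t x) u = (b, z) /\ m z <= m (t x).
    by rewrite sz_pair; have := sz_bool b; rewrite /m in le; lia.
  elim/last_ind: u => [|u a [b [z [E le]]]]; first by exists true, (t x).
  rewrite -cats1 foldl_cat E /= /same_bits_step /=; do 2 eexists; split; first reflexivity.
  exact: leq_trans (sz_behead _ _) le.
by pt.
Qed.

Lemma PT_position X (EX : encoding X) (v : X -> seq bool) (vs : X -> seq (seq bool)) :
  PT v -> PT vs -> PT (fun x => position (v x) (vs x)).
Proof.
move=> Hv Hvs; apply: (PT_foldr (F := fun x a n => if same_bits a (v x) then 0 else n.+1)).
- pt; apply: PT_same_bits; pt.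
  by apply: (PT_comp Hv); pt.
- by pt.
- by [].
- exists (fun x => 2 * sz (vs x) + 1).
    by do ![apply: pb_add | apply: pb_mul | apply: pb_const | apply: pb_sz].
  move=> x u w E; rewrite sz_nat leq_add2r leq_mul2l /=.
  have : sz w <= sz (vs x) by rewrite E sz_catr.
  apply: leq_trans; rewrite ltnW //; apply: leq_ltn_trans (size_le_sz w).
  by elim: (w) => //= a z; case: (same_bits _ _).
Qed.

Lemma size_down_from n : size (down_from n) = n.
Proof. by elim: n => //= n ->. Qed.

Lemma mem_down_from n v : (v \in down_from n) = (v < n).
Proof. by elim: n => //= n IH; rewrite inE IH size_down_from ltnS (leq_eqVlt v). Qed.

Lemma PT_down_from X (EX : encoding X) (n : X -> nat) :
  PT n -> PT (fun x => down_from (n x)).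
Proof.
move=> Hn; apply: (PT_iter (F := fun _ s => size s :: s)); [by pt|by pt|by []|].
exists (fun x => (n x) * (2 * n x + 2) + 1).
  have H : poly_bounded sz n by apply: pb_le (pb_sz Hn) _ => x; rewrite sz_nat; lia.
  by do ![apply: pb_add | apply: pb_mul | apply: pb_const | done].
move=> x k le; rewrite -/(down_from k).
apply: (@leq_trans (k * (2 * k + 2) + 1)); last by rewrite leq_add2r leq_mul //; lia.
elim: k {le} => //= k IH; rewrite sz_cons size_down_from sz_nat.
by rewrite -/(down_from k) in IH *; nia.
Qed.

Lemma PT_floor_log X (EX : encoding X) (n : X -> nat) :
  PT n -> PT (fun x => floor_log (n x)).
Proof.
apply: (PT_comp (g := floor_log)); rewrite /floor_log; apply: PT_snd'.
apply: (PT_iter (F := log_step)); [by rewrite /log_step; pt|by pt|exact: PT_id|].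
exists (fun n => 4 * n + 8).
  have H : poly_bounded sz (@id nat) by apply: pb_le (pb_mu _) _ => x; rewrite sz_nat; lia.
  by do ![apply: pb_add | apply: pb_mul | apply: pb_const | done].
move=> x k le; suff [a [b [-> le1 le2]]] : exists a b,
    [/\ iter k (log_step x) (1, 0) = (a, b), a <= x.+1 & b <= k].
  by rewrite sz_pair !sz_nat; lia.
elim: k {le} => [|k [a [b [/= -> le1 le2]]]]; first by exists 1, 0.
rewrite /log_step /=; case: ifP => le; last by exists a, b; split=> //; apply: leqW.
by exists (a + a), b.+1; split=> //; apply: leqW.
Qed.

Lemma PT_guess_length X (EX : encoding X) (p n : X -> nat) :
  PT p -> PT n -> PT (fun x => guess_length (p x) (n x)).
Proof. by move=> Hp Hn; rewrite /guess_length; pt; apply: PT_floor_log. Qed.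

Lemma PT_two_dimensional X (EX : encoding X) (K : X -> seq (seq nat)) :
  PT K -> PT (fun x => two_dimensional (K x)).
Proof.
move=> HK; rewrite /two_dimensional; pt; first exact: PT_simplicial.
  by apply: PT_card_face; pt.
by apply: PT_card_face; pt.
Qed.

Lemma PT_renamed X (EX : encoding X) (F : X -> seq (seq (seq bool))) :
  PT F -> PT (fun x => renamed (F x)).
Proof.
apply: (PT_comp (g := renamed)); rewrite /renamed; pt.
by apply: PT_position; pt.
Qed.

Lemma PT_well_formed X (EX : encoding X) (st : X -> parse_state) :
  PT st -> PT (fun x => well_formed (st x)).
Proof. by move=> Hst; rewrite /well_formed; pt; apply: PT_canonical; pt. Qed.

Lemma PT_verify : PT (fun q : seq bool * (seq symbol * nat) => verify q.1 q.2.1 q.2.2).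
Proof.
rewrite /verify.
have Hp : PT (fun q : seq bool * (seq symbol * nat) => parse q.2.1).
  by apply: (PT_comp PT_parse); pt.
have HF : PT (fun q : seq bool * (seq symbol * nat) => (parse q.2.1).2.2.2).
  by do 3 apply: PT_snd'.
apply: PT_andb; first exact: PT_well_formed.
apply: PT_andb; first by apply: PT_two_dimensional; apply: PT_renamed.
apply: PT_search; [| |by pt|exact: PT_renamed|by pt].
  by apply: PT_guess_length; pt.
by apply: PT_down_from; pt.
Qed.

(** * Elementary collapses *)

(** An elementary collapse with its dimension eliminated: cardinalities replace dimensions, and
    uniqueness of the coface is required among faces of the size of [t]. *)
Definition elementary (K : collection) (t s : {fset nat}) : Prop :=
  [/\ simplicial_complex K, t \in K, s \in K, s `<=` t & #|` t| = #|` s|.+1] /\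
  (forall r, r \in K -> #|` r| = #|` t| -> s `<=` r -> r = t).

Definition remaining (K : collection) (t s : {fset nat}) : collection :=
  K `\` [fset t; s].

Lemma in_remaining K t s r :
  (r \in remaining K t s) = [&& r != t, r != s & r \in K].
Proof. by rewrite !inE negb_or -andbA. Qed.

Lemma face_gt0 K s : simplicial_complex K -> s \in K -> 0 < #|` s|.
Proof. by case=> H _ /H; rewrite cardfs_gt0. Qed.

(** The dimension is recovered as the cardinality of [s], positive because faces are nonempty; for
    the same reason the truncated predecessor in [dim_face] does no harm. *)
Lemma collapseP K0 K1 : collapse K0 K1 <->
  exists t s, elementary K0 t s /\ K1 = remaining K0 t s.
Proof.
split=> [[m [m1 HK [t [s [[tK dt] st [[sK ds] [t' [_ Ht']]] ->]]]]]|[t [s [[[HK tK sK st E] Hr] ->]]]].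
  exists t, s; split=> //; have s0 := face_gt0 HK sK; have t0 := face_gt0 HK tK.
  rewrite /dim_face in dt ds.
  split; first by split=> //; lia.
  move=> r rK Er sr; rewrite -(Ht' r); first by apply: Ht'.
  by split=> //; split; rewrite // /dim_face Er.
exists #|` s|; split=> //; first exact: face_gt0 sK.
exists t, s; split=> //; first by split=> //; rewrite /dim_face E.
split; first by split.
exists t; split; first by split=> //; split=> //; rewrite /dim_face E.
move=> r [[rK Er] sr]; apply/esym/Hr => //.
by rewrite /dim_face in Er; have := face_gt0 HK rK; lia.
Qed.

(** For every [x] in [r] outside [s], adding [x] to [s] gives a face of the size of [t], hence [t]
    itself by freeness. So all such [x] lie in [t], and [r] is [t] as soon as one exists. *)
Lemma elementary_cofaces K t s r :
  elementary K t s -> r \in K -> s `<=` r -> r = s \/ r = t.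
Proof.
move=> [[[HK0 HK] tK sK st E] Hr] rK sr.
have step x : x \in r -> x \notin s -> t = x |` s.
  move=> xr xs; apply/esym/Hr; last exact: fsubsetUr.
    apply: HK rK _ _; first by rewrite fsubUset fsub1set xr.
    by apply/fset0Pn; exists x; rewrite !inE eqxx.
  by rewrite cardfsU1 xs E.
have [->|ne] := eqVneq r s; first by left.
right; have : ~~ (r `<=` s) by apply: contra ne => rs; rewrite eqEfsubset rs.
case/fsubsetPn => x xr xs; have Et := step x xr xs.
apply/eqP; rewrite eqEfsubset; apply/andP; split; last first.
  by rewrite Et fsubUset fsub1set xr.
apply/fsubsetP => y yr; have [ys|ys] := boolP (y \in s); first exact: (fsubsetP st).
by rewrite (step y yr ys) !inE eqxx.
Qed.

Lemma elementary_neq K t s : elementary K t s -> s != t.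
Proof. by move=> [[_ _ _ _ E] _]; apply/eqP => e; rewrite e in E; lia. Qed.

(** By [elementary_cofaces] only [s] and [t] contain [s], so no surviving face has a removed
    subset. *)
Lemma remaining_complex K t s :
  elementary K t s -> simplicial_complex (remaining K t s).
Proof.
move=> H; have [[HK tK sK st E] _] := H; case: (HK) => HK0 HK1.
split=> [r|r q]; rewrite !in_remaining; first by case/and3P => _ _; apply: HK0.
case/and3P => qt qs qK rq r0; have rK := HK1 _ _ qK rq r0.
rewrite rK andbT; apply/andP; split; apply/eqP => e; subst r.
  have [e|e] := elementary_cofaces H qK (fsubset_trans st rq).
    by rewrite e eqxx in qs.
  by rewrite e eqxx in qt.
have [e|e] := elementary_cofaces H qK rq; first by rewrite e eqxx in qs.
by rewrite e eqxx in qt.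
Qed.

Lemma elementary_vertex K t s : elementary K t s ->
  exists u, [/\ u \in t, u \notin s & s = t `\ u].
Proof.
move=> [[HK tK sK st E] _].
have : ~~ (t `<=` s) by apply/negP => /fsubset_leq_card; rewrite E ltnn.
case/fsubsetPn => u ut us; exists u; split=> //.
apply/eqP; rewrite eqEfcard; apply/andP; split.
  apply/fsubsetP => x xs; rewrite !inE (fsubsetP st) // andbT.
  by apply: contraNneq us => <-.
by have := cardfsD1 u t; rewrite ut E; lia.
Qed.

(** For [v] in [s], the facet of [t] opposite to [v] differs from [s] and is nonempty, as it keeps
    the vertex opposite to [s]. It is the old facet to which a guessed expansion adds [v]. *)
Lemma elementary_old_facet K t s : elementary K t s ->
  exists v, [/\ v \in s, v \in t & t `\ v \in remaining K t s].
Proof.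
move=> H; have [[HK tK sK st E] _] := H; have [u [ut us Es]] := elementary_vertex H.
have := face_gt0 HK sK; rewrite cardfs_gt0 => /fset0Pn [v vs].
have vt := fsubsetP st _ vs; exists v; split=> //; rewrite in_remaining.
apply/and3P; split.
- by apply/eqP => e; rewrite -e !inE eqxx in vt.
- by apply/eqP => e; rewrite -e !inE eqxx in vs.
- case: HK => _ HK; apply: HK tK _ _; first exact: fsubD1set.
  apply/fset0Pn; exists u; rewrite !inE ut andbT.
  by apply: contraNneq us => ->.
Qed.

Lemma walk_collapse_complex b K L :
  simplicial_complex K -> walk collapse b K L -> simplicial_complex L.
Proof.
move=> HK W; elim: W HK => // n K1 K2 L1 /collapseP [t [s [H ->]]] _ IH _.
exact: IH (remaining_complex H).
Qed.

Lemma walk_expansion_complex a K L :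
  simplicial_complex K -> walk expansion a K L -> simplicial_complex L.
Proof.
move=> HK W; elim: W HK => // n K1 K2 L1 /collapseP [t [s [H _]]] _ IH _.
by apply: IH; case: H => [[]].
Qed.

Lemma walk_expansion_sub a K L : walk expansion a K L -> K `<=` L.
Proof.
elim=> {a K L} // n K1 K2 L1 /collapseP [t [s [H ->]]] _; apply: fsubset_trans.
exact: fsubsetDl.
Qed.

Definition vertex_of (K : collection) (v : nat) : Prop := exists2 s, s \in K & v \in s.

(** Each expansion contributes at most one vertex: all vertices of the new simplex but [v] belong to
    an old facet. *)
Lemma walk_expansion_vertices a K L : walk expansion a K L ->
  exists2 e : seq nat, size e <= a & forall v, vertex_of L v -> v \in e \/ vertex_of K v.
Proof.
elim=> {a K L} [K|n K1 K2 L1 /collapseP [t [s [H ->]]] _ [e se He]].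
  by exists [::] => //; right.
have [[HK tK sK st E] _] := H; have [v [vs vt Hf]] := elementary_old_facet H.
exists (v :: e) => [//|x /He [xe|[r rK xr]]]; first by left; rewrite inE xe orbT.
have [->|ne] := eqVneq x v; first by left; rewrite inE eqxx.
have Ht : x \in t -> vertex_of (remaining K2 t s) x.
  by move=> xt; exists (t `\ v) => //; rewrite !inE ne.
have [e1|n1] := eqVneq r t; first by right; apply: Ht; rewrite -e1.
have [e1|n2] := eqVneq r s; first by right; apply: Ht; apply: (fsubsetP st); rewrite -e1.
by right; exists r => //; rewrite in_remaining n1 n2.
Qed.

(** * Renaming vertices *)

Section Renaming.
Variable g : nat -> nat.
Hypothesis g_inj : injective g.

Definition rename_face (s : {fset nat}) : {fset nat} := g @` s.
Definition rename (K : collection) : collection := rename_face @` K.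

Lemma card_rename_face s : #|` rename_face s| = #|` s|.
Proof. by rewrite card_imfset. Qed.

Lemma rename_face_sub s t : (rename_face s `<=` rename_face t) = (s `<=` t).
Proof.
apply/fsubsetP/fsubsetP => H x; last by case/imfsetP => y /H yt ->; apply/imfsetP; exists y.
by move=> /(in_imfset imfset_key g) /H; rewrite mem_imfset.
Qed.

Lemma rename_face_inj : injective rename_face.
Proof.
move=> s t e; apply/eqP; rewrite eqEfsubset.
by rewrite -(rename_face_sub s t) -(rename_face_sub t s) e fsubset_refl.
Qed.

Lemma in_rename K s : (rename_face s \in rename K) = (s \in K).
Proof. by rewrite mem_imfset //; apply: rename_face_inj. Qed.

Lemma renameP K s : reflect (exists2 s', s' \in K & s = rename_face s') (s \in rename K).
Proof. exact: imfsetP. Qed.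

Lemma sub_rename_face s t : t `<=` rename_face s -> exists2 t', t' `<=` s & t = rename_face t'.
Proof.
move=> H; exists [fset x in s | g x \in t]; first by apply/fsubsetP => x; rewrite !inE => /andP [].
apply/fsetP => y; apply/idP/imfsetP => [yt|[x]].
  have /imfsetP [x xs e] := fsubsetP H _ yt.
  by exists x => //; rewrite !inE -e xs.
by rewrite !inE => /andP [_ gx] ->.
Qed.

Lemma rename_complex K : simplicial_complex K -> simplicial_complex (rename K).
Proof.
move=> [H0 H1]; split=> [s|s t].
  by case/renameP => s' /H0 s0 ->; rewrite -cardfs_gt0 card_rename_face cardfs_gt0.
case/renameP => t' tK -> /sub_rename_face [s' st ->] s0; rewrite in_rename.
by apply: H1 tK st _; rewrite -cardfs_gt0 -card_rename_face cardfs_gt0.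
Qed.

Lemma rename_elementary K t s : elementary K t s ->
  elementary (rename K) (rename_face t) (rename_face s).
Proof.
move=> [[HK tK sK st E] Hr]; split.
  by split; rewrite ?in_rename ?rename_face_sub ?card_rename_face //; apply: rename_complex.
move=> r /renameP [r' rK ->]; rewrite !card_rename_face rename_face_sub => e sr.
by rewrite (Hr r').
Qed.

Lemma rename_remaining K t s :
  rename (remaining K t s) = remaining (rename K) (rename_face t) (rename_face s).
Proof.
apply/fsetP => r; rewrite in_remaining; apply/idP/idP.
  case/renameP => r'; rewrite in_remaining => /and3P [n1 n2 rK] ->.
  by rewrite !(inj_eq rename_face_inj) n1 n2 in_rename.
case/and3P => n1 n2 /renameP [r' rK e]; rewrite e in n1 n2 *.
rewrite in_rename in_remaining rK andbT.
by rewrite !(inj_eq rename_face_inj) in n1 n2; rewrite n1 n2.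
Qed.

Lemma rename_collapse K L : collapse K L -> collapse (rename K) (rename L).
Proof.
case/collapseP => t [s [H ->]]; apply/collapseP.
by exists (rename_face t), (rename_face s); rewrite rename_remaining; split=> //;
  apply: rename_elementary.
Qed.

Lemma rename_walk_collapse n K L : walk collapse n K L -> walk collapse n (rename K) (rename L).
Proof.
elim=> [K1|m K1 K2 L1 H _ IH]; first exact: walk_nil.
by apply: walk_cons IH; apply: rename_collapse.
Qed.

Lemma rename_walk_expansion n K L :
  walk expansion n K L -> walk expansion n (rename K) (rename L).
Proof.
elim=> [K1|m K1 K2 L1 H _ IH]; first exact: walk_nil.
by apply: walk_cons IH; apply: rename_collapse.
Qed.

End Renaming.

Lemma d_complexP d (K : collection) : 0 < d -> d_complex d K <->
  [/\ simplicial_complex K, (forall s, s \in K -> #|` s| <= d.+1) &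
      exists2 s, s \in K & #|` s| = d.+1].
Proof.
move=> d0; split=> [[HK K0 Ed]|[HK Hd [s sK Es]]].
  have le s : s \in K -> #|` s| <= d.+1.
    by move=> sK; have := @leq_bigmax_seq _ (enum_fset K) xpredT dim_face s sK isT; rewrite -/(dim K) Ed /dim_face; lia.
  split=> //.
  have [/hasP [s sK /eqP Es]|/hasPn H] := boolP (has (fun s => dim_face s == d) K).
    by exists s => //; have := face_gt0 HK sK; rewrite /dim_face in Es; lia.
  suff : dim K <= d.-1 by rewrite Ed; lia.
  apply/bigmax_leqP_seq => s sK _; have := H s sK; have := le s sK.
  by rewrite /dim_face; lia.
split=> //; first by apply/fset0Pn; exists s.
apply/eqP; rewrite eqn_leq; apply/andP; split.
  by apply/bigmax_leqP_seq => r rK _; have := Hd r rK; rewrite /dim_face; lia.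
by have := @leq_bigmax_seq _ (enum_fset K) xpredT dim_face s sK isT; rewrite /dim_face Es.
Qed.

Lemma rename_d_complex g d K : injective g -> 0 < d ->
  d_complex d K -> d_complex d (rename g K).
Proof.
move=> g_inj d0 /(d_complexP _ d0) [H1 H2 [s sK Es]]; apply/(d_complexP _ d0); split.
- exact: rename_complex.
- by move=> r /renameP [r' /H2 le ->]; rewrite card_rename_face.
- by exists (rename_face g s); rewrite ?in_rename ?card_rename_face.
Qed.

Lemma rename_erasible g K p : injective g ->
  ordered_erasible K p -> ordered_erasible (rename g K) p.
Proof.
move=> g_inj [K' [L [a [b [le W1 W2 HL]]]]].
exists (rename g K'), (rename g L), a, b; split=> //.
- exact: rename_walk_expansion.
- exact: rename_walk_collapse.
- exact: rename_d_complex.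
Qed.

(** Outside [s] the extension is a shift beyond all values of [f] on [s]. *)
Lemma injective_extension (s : seq nat) (f : nat -> nat) :
  {in s &, injective f} -> exists2 g, injective g & {in s, g =1 f}.
Proof.
move=> f_inj; pose M := (\max_(x <- s) f x).+1.
have lt_M x : x \in s -> f x < M by move=> xs; rewrite ltnS (@leq_bigmax_seq _ s xpredT f x xs isT).
exists (fun x => if x \in s then f x else x + M); last by move=> x ->.
move=> x y; case: ifP => xs; case: ifP => ys.
- exact: f_inj.
- by move=> e; have := lt_M x xs; lia.
- by move=> e; have := lt_M y ys; lia.
- by move/addIn.
Qed.

Definition face_of (s : seq nat) : {fset nat} := [fset v | v in s].

Lemma in_face_of s v : (v \in face_of s) = (v \in s).
Proof. by rewrite /face_of in_fset. Qed.

Lemma complex_ofP F (s : {fset nat}) :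
  reflect (exists2 t, t \in F & s = face_of t) (s \in complex_of F).
Proof.
by rewrite /complex_of; apply: (iffP (imfsetP _ _ _ _)) => -[t tF ->]; exists t.
Qed.

Lemma complex_of_map (f g : nat -> nat) F : {in flatten F, g =1 f} ->
  complex_of (map (map f) F) = rename g (complex_of F).
Proof.
move=> E.
have Ef t : t \in F -> face_of (map f t) = rename_face g (face_of t).
  move=> tF; apply/fsetP => v; rewrite in_face_of; apply/mapP/imfsetP => [[x xt ->]|[x]].
    exists x; first by rewrite /= in_face_of.
    by rewrite E //; apply/flattenP; exists t.
  rewrite /= in_face_of => xt ->; exists x => //.
  by rewrite E //; apply/flattenP; exists t.
apply/fsetP => s; apply/complex_ofP/renameP => [[t /mapP [t' tF ->] ->]|[s' /complex_ofP [t tF ->] ->]].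
  by exists (face_of t'); [apply/complex_ofP; exists t' | apply: Ef].
by exists (map f t); [apply: map_f | rewrite Ef].
Qed.

(** Both implications are the forward one: the converse applies it to the renamed instance and the
    left inverse [h] of [f]. *)
Lemma rename_instance (f : nat -> nat) F p : {in flatten F &, injective f} ->
  (d_complex 2 (complex_of F) /\ ordered_erasible (complex_of F) p) <->
  (d_complex 2 (complex_of (map (map f) F)) /\
   ordered_erasible (complex_of (map (map f) F)) p).
Proof.
have fwd h G : {in flatten G &, injective h} ->
  d_complex 2 (complex_of G) /\ ordered_erasible (complex_of G) p ->
  d_complex 2 (complex_of (map (map h) G)) /\
  ordered_erasible (complex_of (map (map h) G)) p.
  move=> /injective_extension [g g_inj E] [H1 H2]; rewrite (complex_of_map E).
  by split; [apply: rename_d_complex | apply: rename_erasible].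
move=> f_inj; split; first exact: fwd.
pose h y := nth 0 (flatten F) (index y (map f (flatten F))).
have hK x : x \in flatten F -> h (f x) = x.
  move=> xF; rewrite /h; have fx : f x \in map f (flatten F) by apply: map_f.
  have lt : index (f x) (map f (flatten F)) < size (flatten F).
    by rewrite -(size_map f) index_mem.
  apply: f_inj => //; first exact: mem_nth.
  by rewrite -(nth_map 0 (f 0)) // nth_index.
have flat : flatten (map (map f) F) = map f (flatten F).
  by elim: (F) => //= s G ->; rewrite map_cat.
have /fwd : {in flatten (map (map f) F) &, injective h}.
  move=> x y; rewrite flat => /mapP [x' x'F ->] /mapP [y' y'F ->].
  by rewrite !hK // => ->.
have -> // : map (map h) (map (map f) F) = F.
rewrite -map_comp -[RHS]map_id; apply/eq_in_map => s sF /=.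
rewrite -map_comp -[RHS]map_id; apply/eq_in_map => x xs /=.
by apply: hK; apply/flattenP; exists s.
Qed.

(** * Collapsing high-dimensional faces first *)

Definition high_step (K0 K1 : collection) : Prop :=
  exists t s, [/\ elementary K0 t s, 3 < #|` t| & K1 = remaining K0 t s].

Definition high_faces (K : collection) : nat := #|` [fset s in K | 3 < #|` s|]|.

(** A set of triangles each of whose edges lies in a further triangle of the set: the obstruction to
    collapsing triangles. *)
Definition is_core (T : collection) : Prop :=
  forall t, t \in T -> #|` t| = 3 /\ forall s : {fset nat}, s `<=` t -> #|` s| = 2 ->
    exists r, [/\ r \in T, r != t & s `<=` r].

(** If a triangle of [T] were [t], its edge [s] would lie in a second triangle of [T], contradicting
    freeness; and [s], having at most two vertices, is not in [T]. *)
Lemma core_collapse K t s T : elementary K t s -> #|` t| <= 3 ->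
  is_core T -> T `<=` K -> T `<=` remaining K t s.
Proof.
move=> [[HK tK sK st E] Hr] t3 HT TK; apply/fsubsetP => r rT.
have [r3 Hc] := HT r rT; rewrite in_remaining (fsubsetP TK) // andbT.
apply/andP; split; apply/eqP => e; subst r; last by lia.
have [|q [qT qt sq]] := Hc s st; first by lia.
have [q3 _] := HT q qT; case/eqP: qt; apply: Hr => //; last by rewrite q3 r3.
exact: (fsubsetP TK).
Qed.

(** [M] is the current complex with the low collapses made so far left out, so it contains [K] and
    has the same faces with more than three vertices. Low collapses of the walk are skipped, high
    ones are copied to [M]. A core inside the result is never touched by the walk, so it survives to
    [L], which has no triangles. *)
Lemma high_collapses_first b K L : walk collapse b K L ->
  (forall s, s \in L -> #|` s| <= 2) ->
  forall M, simplicial_complex M -> K `<=` M ->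
  (forall s, s \in M -> 3 < #|` s| -> s \in K) ->
  exists c M', [/\ walk high_step c M M', forall s, s \in M' -> #|` s| <= 3 &
    forall T, is_core T -> T `<=` M' -> T `<=` K -> T = fset0].
Proof.
elim=> {b K L} [K HK M _ KM hM|n K K1 L /collapseP [t [s [H ->]]] _ IH HL M HM KM hM].
  exists 0, M; split; first exact: walk_nil.
    move=> s sM; rewrite leqNgt; apply/negP => lt; have := HK s (hM s sM lt); lia.
  move=> T HT _ TK; apply/eqP; rewrite -fsubset0; apply/fsubsetP => r rT.
  by have := HK r (fsubsetP TK _ rT); have [-> _] := HT r rT.
have [[HK tK sK st E] Hr] := H.
have [lt|le] := ltnP 3 #|` t|; last first.
  have [|r rM r3|c [M' [W HM' HT]]] := IH HL M HM.
  - by apply: fsubset_trans KM; apply: fsubsetDl.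
  - rewrite in_remaining hM // andbT.
    by apply/andP; split; apply/eqP => e; subst r; lia.
  exists c, M'; split=> // T cT TM TK; apply: HT => //.
  exact: core_collapse H le cT TK.
(* Freeness passes to [M], since its faces of the size of [t] are high and hence lie in [K]. *)
have HMt : elementary M t s.
  split; first by split=> //; apply: (fsubsetP KM).
  by move=> r rM e sr; apply: Hr => //; apply: hM; rewrite ?e.
have [|r|c [M' [W HM' HT]]] := IH HL (remaining M t s) (remaining_complex HMt).
- by apply: fsetSD.
- by rewrite !in_remaining => /and3P [-> -> rM] r3; apply: hM.
exists c.+1, M'; split=> //; first by apply: walk_cons W; exists t, s.
move=> T cT TM TK; apply: HT => //; apply/fsubsetP => r rT.
(* As a part of [M'], the core avoids [t] and [s], so it also lies in what remains of [K]. *)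
have WM : M' `<=` remaining M t s.
  elim: W => // {}n M1 M2 M3 [t' [s' [_ _ ->]]] _; move/fsubset_trans; apply.
  exact: fsubsetDl.
have := fsubsetP WM _ (fsubsetP TM _ rT); rewrite !in_remaining => /and3P [-> -> _].
exact: (fsubsetP TK).
Qed.

Lemma high_faces_remaining K t s : elementary K t s -> 3 < #|` t| ->
  high_faces (remaining K t s) < high_faces K.
Proof.
move=> [[_ tK _ _ _] _] t3; apply: fproper_ltn_card; rewrite fproperE.
apply/andP; split; first by apply/fsubsetP => r; rewrite !inE => /andP [/andP [_ ->] ->].
by apply/fsubsetPn; exists t; rewrite !inE ?tK ?t3 ?eqxx.
Qed.

Lemma walk_high_faces c M M' : walk high_step c M M' -> c + high_faces M' <= high_faces M.
Proof.
elim=> // n K K1 L [t [s [H t3 ->]]] _; have := high_faces_remaining H t3; lia.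
Qed.

Lemma walk_expansion_high_faces a K L : walk expansion a K L ->
  high_faces L <= high_faces K + 2 * a.
Proof.
elim=> [K1|n K1 K2 L1 /collapseP [t [s [H ->]]] _ IH]; first by rewrite addn0.
apply: leq_trans IH _; suff : high_faces K2 <= high_faces (remaining K2 t s) + 2 by lia.
rewrite /high_faces; set A := [fset _ in K2 | _]; set B := [fset _ in _ | _].
have : A `<=` B `|` [fset t; s].
  by apply/fsubsetP => r; rewrite !inE; case: (r == t); case: (r == s); rewrite ?orbT ?orbF.
move/fsubset_leq_card/leq_trans; apply.
apply: leq_trans (leq_card_fsetU _ _).1 _.
by rewrite leq_add2l cardfs2; case: (_ != _).
Qed.

(** A surviving facet of [t] has at least two vertices and so contains an edge. This prevents the
    collapses from falling below dimension 1. *)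
Lemma elementary_edge K t s : elementary K t s -> 2 < #|` t| ->
  exists2 e, e \in remaining K t s & #|` e| = 2.
Proof.
move=> H t3; have [[HK tK sK st E] _] := H; have [v [vs vt Hf]] := elementary_old_facet H.
have HR := remaining_complex H.
have [lt|le] := ltnP 2 #|` t `\ v|; last first.
  by exists (t `\ v) => //; have := cardfsD1 v t; rewrite vt; lia.
move: Hf lt; set q := t `\ v => Hf lt.
have /fset0Pn [x xq] : q != fset0 by rewrite -cardfs_gt0; lia.
have /fset0Pn [y] : q `\ x != fset0.
  by rewrite -cardfs_gt0; have := cardfsD1 x q; rewrite xq; lia.
rewrite in_fsetD1 => /andP [yx yq].
exists [fset x; y]; last by rewrite cardfs2 eq_sym yx.
case: HR => _ HR; apply: HR Hf _ _; first by rewrite fsubUset !fsub1set xq yq.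
by apply/fset0Pn; exists x; rewrite !inE eqxx.
Qed.

(** * Correctness of the search *)

Lemma face_subE s t : face_sub s t = (face_of s `<=` face_of t).
Proof.
apply/allP/fsubsetP => H v; first by rewrite !in_face_of => /H.
by move=> vs; rewrite -in_face_of; apply: H; rewrite in_face_of.
Qed.

Lemma face_eqE s t : face_eq s t = (face_of s == face_of t).
Proof. by rewrite eqEfsubset -!face_subE. Qed.

Lemma has_faceE s K : has_face s K = (face_of s \in complex_of K).
Proof.
apply/hasP/complex_ofP => -[t tK e]; exists t => //.
  by move: e; rewrite face_eqE => /eqP.
by rewrite face_eqE e.
Qed.

Lemma card_faceE s : card_face s = #|` face_of s|.
Proof.
by rewrite /card_face /face_of card_imfset.
Qed.

Lemma nilpE s : nilp s = (face_of s == fset0).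
Proof.
apply/nilP/eqP => [->|]; first by apply/fsetP => v; rewrite in_face_of.
by case: s => // v s /fsetP/(_ v); rewrite in_face_of mem_head in_fset0.
Qed.

Lemma face_of_remove v s : face_of (remove v s) = face_of s `\ v.
Proof. by apply/fsetP => u; rewrite in_face_of mem_filter in_fsetD1 in_face_of. Qed.

Lemma face_of_cons v s : face_of (v :: s) = v |` face_of s.
Proof. by apply/fsetP => u; rewrite in_face_of in_cons in_fset1U in_face_of. Qed.

Lemma complex_of_cons s K : complex_of (s :: K) = face_of s |` complex_of K.
Proof.
apply/fsetP => t; rewrite in_fset1U; apply/complex_ofP/orP => [[r]|[/eqP ->|/complex_ofP [r rK ->]]].
- rewrite inE => /orP [/eqP -> ->|rK ->]; first by left.
  by right; apply/complex_ofP; exists r.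
- by exists s; rewrite ?inE ?eqxx.
- by exists r; rewrite ?inE ?rK ?orbT.
Qed.

Lemma face_of_in s K : s \in K -> face_of s \in complex_of K.
Proof. by move=> sK; apply/complex_ofP; exists s. Qed.

Lemma simplicialP K : reflect (simplicial_complex (complex_of K)) (simplicial K).
Proof.
apply: (iffP allP) => [H|[H0 H1] s sK]; last first.
  rewrite nilpE H0 ?face_of_in //=; apply/allP => v vs.
  rewrite nilpE has_faceE face_of_remove -implyNb; apply/implyP => ne.
  by apply: H1 ne; [apply: face_of_in sK | apply: fsubD1set].
have H0 s : s \in complex_of K -> s != fset0.
  by case/complex_ofP => t /H /andP [ne _] ->; rewrite -nilpE.
split=> // s t tK st s0.
(* Induction on the number of vertices of [t] outside [s], removing one of them. *)
have [n le_n] := ubnP (#|` t| - #|` s|); elim: n => // n IH in t tK st le_n *.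
have [->//|ne] := eqVneq s t.
have /fsubsetPn [v vt vs] : ~~ (t `<=` s).
  by apply: contra ne => ts; rewrite eqEfsubset st.
have sub : s `<=` t `\ v.
  apply/fsubsetP => x xs; rewrite !inE (fsubsetP st) // andbT.
  by apply: contraNneq vs => <-.
apply: (IH (t `\ v)) => //; last first.
  have := fsubset_leq_card sub; have := cardfsD1 v t; rewrite vt.
  by move: le_n; rewrite /=; lia.
case/complex_ofP: tK => t' /H /andP [_ /allP Hv] Et.
have : v \in t' by rewrite -in_face_of -Et.
move/Hv; rewrite nilpE has_faceE face_of_remove -Et => /orP [/eqP e|//].
by move: sub; rewrite e fsubset0 (negbTE s0).
Qed.

Lemma collapsibleP K t s :
  reflect (elementary (complex_of K) (face_of t) (face_of s)) (collapsible K t s).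
Proof.
rewrite /collapsible !has_faceE face_subE !card_faceE.
apply: (iffP and5P).
  case=> /simplicialP HK tK sK st /andP [/eqP E /allP Hr]; split=> // r.
  case/complex_ofP => r' rK -> er sr; have := Hr r' rK.
  by rewrite card_faceE face_subE face_eqE er eqxx sr => /eqP.
case=> [[HK tK sK st E] Hr]; split=> //; first exact/simplicialP.
rewrite E eqxx /=; apply/allP => r rK.
rewrite card_faceE face_subE face_eqE; apply/implyP => /andP [/eqP er sr].
by rewrite (Hr (face_of r)) ?face_of_in // er E.
Qed.

Lemma complex_of_delete K t s :
  complex_of (delete K t s) = remaining (complex_of K) (face_of t) (face_of s).
Proof.
apply/fsetP => r; rewrite in_remaining; apply/complex_ofP/and3P.
  case=> r'; rewrite mem_filter !face_eqE => /andP [/andP [n1 n2] rK] ->.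
  by split=> //; apply: face_of_in.
case=> n1 n2 /complex_ofP [r' rK e]; exists r' => //.
by rewrite mem_filter !face_eqE -e n1 n2.
Qed.

Lemma remaining_cons2 K t s :
  face_of t \notin complex_of K -> face_of s \notin complex_of K ->
  remaining (complex_of (t :: s :: K)) (face_of t) (face_of s) = complex_of K.
Proof.
move=> nt ns; apply/fsetP => r; rewrite in_remaining !complex_of_cons !in_fset1U.
case: eqP => [->|_]; first by rewrite (negbTE nt).
by case: eqP => [->|_]; first by rewrite (negbTE ns).
Qed.

(** * Soundness of the search *)

Lemma walk_trans step n m K L M : walk step n K L -> walk step m L M -> walk step (n + m) K M.
Proof.
elim=> // k K1 K2 L1 H _ IH W; rewrite addSn; exact: walk_cons H (IH W).
Qed.

Lemma walk_one (step : collection -> collection -> Prop) K L : step K L -> walk step 1 K L.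
Proof. by move=> H; apply: walk_cons H (walk_nil _ _). Qed.

Lemma expand_walk K t s : exists2 a, a <= 1 &
  walk expansion a (complex_of K) (complex_of (expand K t s)).
Proof.
rewrite /expand; case: ifP => [/and3P []|_]; last by exists 0 => //; apply: walk_nil.
rewrite !has_faceE => nt ns /collapsibleP H; exists 1 => //; apply: walk_one.
by apply/collapseP; exists (face_of t), (face_of s); rewrite remaining_cons2.
Qed.

Lemma expansions_walk l V p K g : exists2 a, a <= p &
  walk expansion a (complex_of K) (complex_of (iter p (expand_step l V) (K, g)).1).
Proof.
elim: p => [|p [a le W]]; first by exists 0 => //; apply: walk_nil.
rewrite iterS; case: (iter _ _ _) W => L h W.
have [b leb Wb] := expand_walk L (head 0 (pick l V (skip_bits l h)) :: head [::] (pick l L h))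
  (remove (head 0 (pick l V (skip_bits l (skip_bits l h))))
    (head 0 (pick l V (skip_bits l h)) :: head [::] (pick l L h))).
by exists (a + b); [lia | apply: walk_trans W Wb].
Qed.

Definition reaches (K L : seq (seq nat)) : Prop :=
  exists b, walk collapse b (complex_of K) (complex_of L).

Lemma reaches_refl K : reaches K K.
Proof. by exists 0; apply: walk_nil. Qed.

Lemma reaches_trans K L M : reaches K L -> reaches L M -> reaches K M.
Proof. by move=> [a Wa] [b Wb]; exists (a + b); apply: walk_trans Wa Wb. Qed.

Lemma reaches_contract K t s : reaches K (contract K t s).
Proof.
rewrite /contract; case: ifP => [/collapsibleP H|_]; last exact: reaches_refl.
exists 1; apply: walk_one; apply/collapseP; exists (face_of t), (face_of s).
by rewrite complex_of_delete.
Qed.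

Lemma reaches_greedy_step K t s : reaches K (greedy_step K t s).
Proof.
by rewrite /greedy_step; case: ifP => _; [apply: reaches_contract | apply: reaches_refl].
Qed.

Lemma reaches_foldl (A : Type) (F : seq (seq nat) -> A -> seq (seq nat)) s K :
  (forall L a, reaches L (F L a)) -> reaches K (foldl F K s).
Proof.
move=> H; elim: s K => [|a s IH] K; first exact: reaches_refl.
exact: reaches_trans (H K a) (IH _).
Qed.

Lemma reaches_iter (F : seq (seq nat) -> seq (seq nat)) n K :
  (forall L, reaches L (F L)) -> reaches K (iter n F K).
Proof.
move=> H; elim: n => [|n IH] /=; first exact: reaches_refl.
exact: reaches_trans IH (H _).
Qed.

Lemma reaches_sweep K : reaches K (sweep K).
Proof.
by apply: reaches_foldl => L t; apply: reaches_foldl => L' s; apply: reaches_greedy_step.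
Qed.

Lemma reaches_contract_steps l n st : reaches st.1 (iter n (contract_step l) st).1.
Proof.
elim: n => [|n IH]; first exact: reaches_refl.
rewrite iterS; apply: reaches_trans IH _; exact: reaches_contract.
Qed.

Lemma two_dimensionalP K : reflect (d_complex 2 (complex_of K)) (two_dimensional K).
Proof.
apply: (iffP and3P) => [[/simplicialP HK /hasP [s sK Es] /allP Hd]|].
  apply/d_complexP => //; split=> //.
    by move=> r /complex_ofP [t /Hd tK ->]; rewrite -card_faceE.
  by exists (face_of s); [apply: face_of_in | rewrite -card_faceE; apply/eqP].
move=> /(@d_complexP 2 _ isT) [HK Hd [s /complex_ofP [t tK ->] Es]]; split.
- exact/simplicialP.
- by apply/hasP; exists t => //; rewrite card_faceE Es.
- by apply/allP => r /face_of_in /Hd; rewrite card_faceE.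
Qed.

Lemma search_sound l V p K g : d_complex 2 (complex_of K) ->
  search l V p K g -> ordered_erasible (complex_of K) p.
Proof.
move=> /(@d_complexP 2 _ isT) [HK _ _]; rewrite /search.
have [a le_a Wa] := expansions_walk l V p K g.
set st := iter p _ _ in Wa *; set st2 := iter (p + p) _ _.
have [b Wb] : reaches st.1 (iter (size st2.1) sweep st2.1).
  apply: reaches_trans (reaches_contract_steps l (p + p) st) _.
  by apply: reaches_iter; apply: reaches_sweep.
case/andP => /allP Hd /hasP [s sL Es].
exists (complex_of st.1), (complex_of (iter (size st2.1) sweep st2.1)), a, b.
split=> //; apply/d_complexP => //; split.
- by apply: walk_collapse_complex Wb; apply: walk_expansion_complex Wa.
- by move=> r /complex_ofP [t tL ->]; rewrite -card_faceE; apply: Hd.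
- by exists (face_of s); [apply: face_of_in | rewrite -card_faceE; apply/eqP].
Qed.

(** * Completeness of the search *)

Lemma size_split_list (A : Type) (s : seq A) :
  size (split_list s).1 + size (split_list s).2 = size s /\
  size (split_list s).1 <= size (split_list s).2 <= (size (split_list s).1).+1.
Proof.
elim: s => //= x s; case: (split_list s) => u v /= [<- /andP [le1 le2]].
by split; lia.
Qed.

(** The bits do not depend on what follows them, so the blocks of successive choices can be
    concatenated. *)
Lemma pick_complete (A : eqType) (d : A) l (s : seq A) t : t \in s -> size s <= 2 ^ l ->
  exists2 bs, size bs = l & forall g, head d (pick l s (bs ++ g)) = t /\ skip_bits l (bs ++ g) = g.
Proof.
elim: l s => [|l IH] s.
  by case: s => [|x [|y s]] //; rewrite inE => /eqP -> _; exists [::].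
move=> ts le; have [Es /andP [le1 le2]] := size_split_list s.
have [b tb] : exists b, t \in halve s b.
  by move: ts; rewrite mem_split_list => /orP [h|h]; [exists true | exists false].
have [|bs sb H] := IH (halve s b) tb.
  by rewrite expnS in le; case: (b); rewrite /halve; lia.
exists (b :: bs) => [|g]; first by rewrite /= sb.
have [H1 H2] := H g; rewrite /pick /skip_bits !iterSr /=.
by split.
Qed.

Lemma expand_step_skip l (V : seq nat) (K : seq (seq nat)) t v : t \in K -> v \in t -> v \in V ->
  size K <= 2 ^ l -> size V <= 2 ^ l ->
  exists2 bs, size bs = 3 * l & forall g, expand_step l V (K, bs ++ g) = (K, g).
Proof.
move=> tK vt vV leK leV.
have [b1 s1 H1] := pick_complete [::] tK leK; have [b2 s2 H2] := pick_complete 0 vV leV.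
exists (b1 ++ b2 ++ b2) => [|g]; first by rewrite !size_cat s1 s2; lia.
rewrite /expand_step /= -!catA.
have [-> ->] := H1 (b2 ++ b2 ++ g); have [-> ->] := H2 (b2 ++ g); have [_ ->] := H2 g.
congr pair; rewrite /expand_at /expand has_faceE.
suff -> : face_of (v :: t) = face_of t by rewrite face_of_in.
by rewrite face_of_cons; apply/fsetUidPr; rewrite fsub1set in_face_of.
Qed.

Lemma expand_step_complete l (V : seq nat) K L : collapse L (complex_of K) ->
  (forall v, vertex_of L v -> v \in V) -> size K <= 2 ^ l -> size V <= 2 ^ l ->
  exists K', [/\ complex_of K' = L, size K' = (size K).+2 &
    exists2 bs, size bs = 3 * l & forall g, expand_step l V (K, bs ++ g) = (K', g)].
Proof.
move=> /collapseP [t [s [H EK]]] HV leK leV.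
have [[HL tL sL st E] _] := H.
have [v [vs vt]] := elementary_old_facet H; rewrite -EK => /complex_ofP [t' t'K Et'].
have [u [ut us Es]] := elementary_vertex H.
have tV x : x \in t -> x \in V by move=> xt; apply: HV; exists t.
have [b1 s1 H1] := pick_complete [::] t'K leK.
have [b2 s2 H2] := pick_complete 0 (tV v vt) leV; have [b3 s3 H3] := pick_complete 0 (tV u ut) leV.
have Et : face_of (v :: t') = t by rewrite face_of_cons -Et' fsetD1K.
have Es' : face_of (remove u (v :: t')) = s by rewrite face_of_remove Et.
have nt : t \notin complex_of K by rewrite EK in_remaining eqxx.
have ns : s \notin complex_of K by rewrite EK in_remaining eqxx andbF.
have EL : complex_of [:: v :: t', remove u (v :: t') & K] = L.
  rewrite !complex_of_cons Et Es' EK; apply/fsetP => r; rewrite !in_fset1U in_remaining.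
  have [->|_] /= := eqVneq r t; first by rewrite tL.
  by have [->|_] /= := eqVneq r s; first by rewrite sL.
exists [:: v :: t', remove u (v :: t') & K]; split=> //.
exists (b1 ++ b2 ++ b3) => [|g]; first by rewrite !size_cat s1 s2 s3; lia.
rewrite /expand_step /= -!catA.
have [-> ->] := H1 (b2 ++ b3 ++ g); have [-> ->] := H2 (b3 ++ g); have [-> ->] := H3 g.
congr pair; rewrite /expand_at /expand !has_faceE Et Es' nt ns /=.
case: collapsibleP => //; case.
by rewrite -[complex_of _]/(complex_of [:: v :: t', remove u (v :: t') & K]) EL Et Es'.
Qed.

(** Choosing the same face twice is an illegal collapse and gives an idle round. *)
Lemma contract_step_skip l (K : seq (seq nat)) t : t \in K -> size K <= 2 ^ l ->
  exists2 bs, size bs = 2 * l & forall g, contract_step l (K, bs ++ g) = (K, g).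
Proof.
move=> tK leK; have [b s H] := pick_complete [::] tK leK.
exists (b ++ b) => [|g]; first by rewrite size_cat s; lia.
rewrite /contract_step /= -catA; have [-> ->] := H (b ++ g); have [-> ->] := H g.
congr pair; rewrite /contract; case: collapsibleP => // /elementary_neq.
by rewrite eqxx.
Qed.

Lemma contract_step_complete l K t s : elementary (complex_of K) t s -> size K <= 2 ^ l ->
  exists K', [/\ complex_of K' = remaining (complex_of K) t s, size K' <= size K &
    exists2 bs, size bs = 2 * l & forall g, contract_step l (K, bs ++ g) = (K', g)].
Proof.
move=> H leK; have [[_ tK sK _ _] _] := H.
case/complex_ofP: tK H => t' t'K ->; case/complex_ofP: sK => s' s'K -> H.
have [b1 s1 H1] := pick_complete [::] t'K leK; have [b2 s2 H2] := pick_complete [::] s'K leK.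
exists (delete K t' s'); split.
- exact: complex_of_delete.
- by rewrite size_filter count_size.
exists (b1 ++ b2) => [|g]; first by rewrite size_cat s1 s2; lia.
rewrite /contract_step /= -catA; have [-> ->] := H1 (b2 ++ g); have [-> ->] := H2 g.
by congr pair; rewrite /contract; case: collapsibleP.
Qed.

Lemma nonempty_vertex K : simplicial_complex (complex_of K) -> complex_of K != fset0 ->
  exists t v, [/\ t \in K, v \in t & vertex_of (complex_of K) v].
Proof.
move=> [H0 _] /fset0Pn [s sK]; case/complex_ofP: (sK) => t tK Et.
have /fset0Pn [v vs] := H0 _ sK; exists t, v; split=> //; last by exists s.
by rewrite -in_face_of -Et.
Qed.

Lemma expansions_complete l (V : seq nat) a p K L : walk expansion a (complex_of K) L -> a <= p ->
  simplicial_complex (complex_of K) -> complex_of K != fset0 ->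
  (forall v, vertex_of L v -> v \in V) -> size K + 2 * a <= 2 ^ l -> size V <= 2 ^ l ->
  exists K', [/\ complex_of K' = L, size K' <= size K + 2 * a &
    exists2 bs, size bs = 3 * l * p &
      forall g, iter p (expand_step l V) (K, bs ++ g) = (K', g)].
Proof.
move=> W le_ap HK K0 HV leK leV.
have [K' [EL le Ha]] : exists K', [/\ complex_of K' = L, size K' <= size K + 2 * a &
    exists2 bs, size bs = 3 * l * a &
      forall g, iter a (expand_step l V) (K, bs ++ g) = (K', g)].
  move EK: (complex_of K) W HK K0 => C W.
  elim: W K EK HV leK => {le_ap a C L} [C|n C C1 L H W IH] K EK HV leK HC C0.
    by exists K; split; [by []|by rewrite addn0|exists [::]; rewrite ?muln0].
  have HV1 v : vertex_of C1 v -> v \in V.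
    case=> s sC vs; apply: HV; exists s => //.
    exact: (fsubsetP (walk_expansion_sub W)).
  rewrite -EK in H; have [|K1 [E1 le1 [bs sb Hb]]] := expand_step_complete H HV1 _ leV.
    by lia.
  have [|||K' [EK' le' [bs' sb' Hb']]] := IH K1 E1 HV.
  - by rewrite le1; lia.
  - by case/collapseP: H => t [s [[[]]]].
  - apply: contraNneq C0 => E0; rewrite -fsubset0 -E0 -EK.
    by case/collapseP: H => t [s [_ ->]]; apply: fsubsetDl.
  exists K'; split=> //; first by lia.
  exists (bs ++ bs') => [|g]; first by rewrite size_cat sb sb' mulnS.
  by rewrite iterSr -catA Hb Hb'.
have [bs sb Hb] := Ha; exists K'; split=> //.
have HL : simplicial_complex (complex_of K').
  by rewrite EL; apply: walk_expansion_complex W.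
have L0 : complex_of K' != fset0.
  apply: contraNneq K0 => E0; rewrite -fsubset0 -E0 EL; exact: walk_expansion_sub W.
have [t [v [tK vt vL]]] := nonempty_vertex HL L0.
have vV : v \in V by apply: HV; rewrite -EL.
(* The machine always makes [p] rounds, so the walk of length [a] is padded with [p - a] idle
   ones. *)
have [|bt st Ht] := expand_step_skip (l := l) tK vt vV _ leV; first by lia.
have [bu su Hu] : exists2 bu, size bu = 3 * l * (p - a) &
    forall g, iter (p - a) (expand_step l V) (K', bu ++ g) = (K', g).
  elim: (p - a) => [|n [bu su Hu]]; first by exists [::]; rewrite ?muln0.
  exists (bt ++ bu) => [|g]; first by rewrite size_cat st su mulnS.
  by rewrite iterSr -catA Ht Hu.
exists (bs ++ bu) => [|g]; first by rewrite size_cat sb su -mulnDr subnKC.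
by rewrite -{1}(subnK le_ap) iterD -catA Hb Hu.
Qed.

Lemma contractions_complete l c p K L : walk high_step c (complex_of K) L -> c <= p ->
  simplicial_complex L -> L != fset0 -> size K <= 2 ^ l ->
  exists K', complex_of K' = L /\
    exists2 bs, size bs = 2 * l * p &
      forall g, iter p (contract_step l) (K, bs ++ g) = (K', g).
Proof.
move=> W le_cp HL L0 leK.
have [K' [EL le [bs sb Hb]]] : exists K', [/\ complex_of K' = L, size K' <= size K &
    exists2 bs, size bs = 2 * l * c &
      forall g, iter c (contract_step l) (K, bs ++ g) = (K', g)].
  move EK: (complex_of K) W => C W.
  elim: W K EK leK HL L0 => {le_cp c C L} [C|n C C1 L [t [s [H _ E1]]] W IH] K EK leK HL L0.
    by exists K; split; [by []|by []|exists [::]; rewrite ?muln0].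
  rewrite -EK in H; have [K1 [EK1 le1 [bs sb Hb]]] := contract_step_complete H leK.
  have EC1 : complex_of K1 = C1 by rewrite EK1 E1 EK.
  have [K' [EK' le' [bs' sb' Hb']]] := IH K1 EC1 (leq_trans le1 leK) HL L0.
  exists K'; split=> //; first exact: leq_trans le' le1.
  exists (bs ++ bs') => [|g]; first by rewrite size_cat sb sb' mulnS.
  by rewrite iterSr -catA Hb Hb'.
exists K'; split=> //; rewrite -EL in HL L0.
have [t [v [tK _ _]]] := nonempty_vertex HL L0.
have [bt st Ht] := contract_step_skip tK (leq_trans le leK).
have [bu su Hu] : exists2 bu, size bu = 2 * l * (p - c) &
    forall g, iter (p - c) (contract_step l) (K', bu ++ g) = (K', g).
  elim: (p - c) => [|n [bu su Hu]]; first by exists [::]; rewrite ?muln0.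
  exists (bt ++ bu) => [|g]; first by rewrite size_cat st su mulnS.
  by rewrite iterSr -catA Ht Hu.
exists (bs ++ bu) => [|g]; first by rewrite size_cat sb su -mulnDr subnKC.
by rewrite -{1}(subnK le_cp) iterD -catA Hb Hu.
Qed.

(** * Greedy collapses of triangles *)

Section GreedyInvariant.
Variable P : collection -> Prop.
Hypothesis P_step : forall K t s,
  elementary K t s -> #|` t| = 3 -> P K -> P (remaining K t s).

Lemma greedy_step_invariant K t s : P (complex_of K) -> P (complex_of (greedy_step K t s)).
Proof.
rewrite /greedy_step /contract; case: eqP => // t3; case: ifP => // /collapsibleP H HK.
by rewrite complex_of_delete; apply: P_step; rewrite -?card_faceE.
Qed.

Lemma sweep_invariant n K : P (complex_of K) -> P (complex_of (iter n sweep K)).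
Proof.
move=> HK; elim: n => //= n; move: (iter n sweep K) => {HK n}K.
suff H u v L : P (complex_of L) -> P (complex_of
    (foldl (fun L1 t => foldl (fun L2 s => greedy_step L2 t s) L1 v) L u)) by apply: H.
elim: u L => //= t u IH L HL; apply: IH.
by elim: v L HL => //= r q IHq L HL; apply: IHq; apply: greedy_step_invariant.
Qed.

End GreedyInvariant.

Section Fixpoints.
Variables (A B : Type) (m : A -> nat).

(** [m] is a potential: a step that does not lower it changes nothing. If the whole fold preserves
    it, every step was trivial, and all were applied to [a] itself. *)
Lemma foldl_fixpoint (F : A -> B -> A) a s :
  (forall c b, m (F c b) <= m c) -> (forall c b, m (F c b) = m c -> F c b = c) ->
  m (foldl F a s) = m a ->
  foldl F a s = a /\ forall u b v, s = u ++ b :: v -> F a b = a.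
Proof.
move=> Hle Heq; elim: s => [|b s IH] /=; first by split=> // -[].
have le1 := foldl_le (m := m) (F := F) (F a b) s Hle; have le2 := Hle a b => e.
have e1 : F a b = a by apply: Heq; lia.
rewrite e1 in e *; have [E H] := IH e; split=> // -[|x u] c v; first by case=> <-.
by case=> _ /H.
Qed.

(** Each round before stalling lowers [m] by at least one, so [m a] rounds are enough. *)
Lemma iter_fixpoint (f : A -> A) n a :
  (forall c, m (f c) <= m c) -> (forall c, m (f c) = m c -> f c = c) ->
  m a <= n -> f (iter n f a) = iter n f a.
Proof.
move=> Hle Heq; elim: n a => [|n IH] a le_n; first by apply: Heq => /=; have := Hle a; lia.
have [/Heq e|ne] := eqVneq (m (f a)) (m a).
  by elim: (n.+1) => //= k Hk; rewrite !Hk.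
by rewrite iterSr; apply: IH; have := Hle a; lia.
Qed.

End Fixpoints.

Lemma size_delete K t s : t \in K -> size (delete K t s) < size K.
Proof.
move=> tK; rewrite size_filter -(count_predC (fun r => ~~ face_eq r t && ~~ face_eq r s)).
rewrite -[X in X < _]addn0 ltn_add2l -has_count; apply/hasP; exists t => //=.
by rewrite !face_eqE eqxx.
Qed.

Lemma size_delete_complex K t s :
  face_of t \in complex_of K -> size (delete K t s) < size K.
Proof.
case/complex_ofP => r rK e; have -> : delete K t s = delete K r s.
  by apply: eq_filter => q; rewrite !face_eqE e.
exact: size_delete.
Qed.

Lemma size_greedy_step K t s : size (greedy_step K t s) <= size K.
Proof.
rewrite /greedy_step /contract; do 2 case: ifP => // _.
by rewrite size_filter count_size.
Qed.

Lemma greedy_step_fixpoint K t s : size (greedy_step K t s) = size K ->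
  greedy_step K t s = K.
Proof.
rewrite /greedy_step /contract; case: ifP => // _; case: ifP => // /collapsibleP H.
by have [[_ tK _ _ _] _] := H; have := size_delete_complex s tK; lia.
Qed.

Lemma size_sweep K : size (sweep K) <= size K.
Proof.
apply: (foldl_le (m := size)) => L t; apply: (foldl_le (m := size)) => L' s.
exact: size_greedy_step.
Qed.

Lemma sweep_fixpoint K : size (sweep K) = size K ->
  sweep K = K /\ forall t s, t \in K -> s \in K -> greedy_step K t s = K.
Proof.
have inner L t : (forall M s, size (greedy_step M t s) = size M -> greedy_step M t s = M) ->
    size (foldl (fun L' s => greedy_step L' t s) L K) = size L ->
    foldl (fun L' s => greedy_step L' t s) L K = L /\
    forall s, s \in K -> greedy_step L t s = L.
  move=> Heq /(foldl_fixpoint (fun M s => size_greedy_step M t s) Heq) [E H]; split=> // s.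
  by move=> /path.splitPr sK; case: sK H => u v H; apply: (H u s v).
have H1 L t : size (foldl (fun L' s => greedy_step L' t s) L K) <= size L.
  by apply: (foldl_le (m := size)) => M s; apply: size_greedy_step.
have H2 L t : size (foldl (fun L' s => greedy_step L' t s) L K) = size L ->
    foldl (fun L' s => greedy_step L' t s) L K = L.
  by case/(inner L t (fun M s => @greedy_step_fixpoint M t s)).
move/(foldl_fixpoint H1 H2) => [E H].
split=> // t s tK sK.
have Et : foldl (fun L' s => greedy_step L' t s) K K = K.
  by move/path.splitPr: (tK) => tK'; case: tK' H => u v H; apply: (H u t v).
have [_ Hs] := inner K t (fun M s => @greedy_step_fixpoint M t s) (congr1 size Et).
exact: Hs.
Qed.

Lemma one_dimensional_greedy K :
  simplicial_complex (complex_of K) ->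
  (forall s, s \in complex_of K -> #|` s| <= 3) ->
  (exists2 e, e \in complex_of K & #|` e| = 2) ->
  (forall T, is_core T -> T `<=` complex_of K -> T = fset0) ->
  one_dimensional (iter (size K) sweep K).
Proof.
move=> HK H3 Hedge Hcore.
pose P (C : collection) := [/\ simplicial_complex C, C `<=` complex_of K &
  exists2 e, e \in C & #|` e| = 2].
have P_step C t s : elementary C t s -> #|` t| = 3 -> P C -> P (remaining C t s).
  move=> H t3 [_ CK _]; split; first exact: remaining_complex H.
    by apply: fsubset_trans CK; apply: fsubsetDl.
  by apply: elementary_edge H _; rewrite t3.
have /(sweep_invariant P_step (size K)) : P (complex_of K) by split.
set R := iter _ _ _ => -[HR RK [e eR e2]].
have [_ stuck] : sweep R = R /\ forall t s, t \in R -> s \in R -> greedy_step R t s = R.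
  apply: sweep_fixpoint; congr size.
  by apply: (iter_fixpoint size_sweep) => // C /sweep_fixpoint [].
(* The triangles left when no greedy step applies form a core, hence there are none. *)
pose T := [fset t in complex_of R | #|` t| == 3].
have T0 : T = fset0.
  apply: Hcore; last first.
    by apply: fsubset_trans RK; apply/fsubsetP => t; rewrite !inE => /andP [].
  move=> t; rewrite !inE => /andP [tR /eqP t3]; split=> // s st s2.
  have sR : s \in complex_of R.
    by case: HR => _ HR; apply: HR tR st _; rewrite -cardfs_gt0 s2.
  case/complex_ofP: (tR) => t' t'R Et; case/complex_ofP: (sR) => s' s'R Es.
  have := stuck t' s' t'R s'R; rewrite /greedy_step card_faceE -Et t3 eqxx /contract.
  have [Hc /(congr1 size) /=|Hn _] := boolP (collapsible R t' s').
    by move=> ee; have := size_delete s' t'R; rewrite ee ltnn.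
  (* Without a second triangle on the edge [s], the pair of [t] and [s] would be an elementary
     collapse, contrary to [Hn]. *)
  have [/hasP [r rR /andP [/eqP r3 /andP [sr rt]]]|/hasPn H] :=
    boolP (has (fun r => [&& #|` face_of r| == 3, s `<=` face_of r & face_of r != t]) R).
    by exists (face_of r); rewrite !inE face_of_in ?r3.
  case/collapsibleP: Hn; rewrite -Et -Es; split; first by split; rewrite ?t3 ?s2.
  move=> r /complex_ofP [r' /H r'R ->]; rewrite t3 => r3 sr.
  by move: r'R; rewrite r3 eqxx sr /= negbK => /eqP.
apply/andP; split.
  apply/allP => s sR; rewrite card_faceE; have sRc := face_of_in sR.
  have := H3 _ (fsubsetP RK _ sRc); rewrite leq_eqVlt => /orP [s3|//].
  have : face_of s \in T by rewrite !inE sRc.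
  by rewrite T0 in_fset0.
case/complex_ofP: eR e2 => r rR -> e2.
by apply/hasP; exists r => //; rewrite card_faceE e2.
Qed.

(** The constant 7 adds three choices for each of [p] expansions and two for each of [2p]
    collapses. *)
Lemma search_complete l (V : seq nat) p K K' L a b :
  d_complex 2 (complex_of K) -> a <= p -> walk expansion a (complex_of K) K' ->
  walk collapse b K' L -> d_complex 1 L -> (forall v, vertex_of K' v -> v \in V) ->
  size K + 2 * p <= 2 ^ l -> size V <= 2 ^ l ->
  exists2 g, size g = 7 * l * p & search l V p K g.
Proof.
move=> /(@d_complexP 2 _ isT) [HK Hd [t tK t3]] le_ap Wa Wb /(@d_complexP 1 _ isT) [_ HL _].
move=> HV leK leV.
have K0 : complex_of K != fset0 by apply/fset0Pn; exists t.
have [|K1 [E1 le1 [b1 s1 H1]]] := expansions_complete Wa le_ap HK K0 HV _ leV; first by lia.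
have HK' := walk_expansion_complex HK Wa.
have [c [M [Wc HM HT]]] := high_collapses_first Wb HL HK' (fsubset_refl _) (fun _ h _ => h).
(* A 2-dimensional complex has no high faces, an expansion adds at most two, and each high collapse
   removes at least one. *)
have le_c : c <= p + p.
  have h0 : high_faces (complex_of K) = 0.
    apply/eqP; rewrite cardfs_eq0; apply/eqP/fsetP => s; rewrite !inE.
    by apply/negbTE; rewrite negb_and -implybE -leqNgt; apply/implyP => /Hd.
  by have := walk_high_faces Wc; have := walk_expansion_high_faces Wa; lia.
have HMc : simplicial_complex M.
  elim: Wc HK' {HM HT Wa Wb HV E1} => // n C C1 C2 [t1 [s [H _ ->]]] _ IH _.
  by apply: IH; apply: remaining_complex H.
have MK' : M `<=` K'.
  elim: Wc {HM HT Wa Wb HV HK' HMc E1} => // n C C1 C2 [t1 [s [H _ ->]]] _.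
  by move/fsubset_trans; apply; apply: fsubsetDl.
have [e eM e2] : exists2 e, e \in M & #|` e| = 2.
  have : exists2 e, e \in K' & #|` e| = 2.
    have tK' := fsubsetP (walk_expansion_sub Wa) _ tK.
    have /fset0Pn [v vt] : t != fset0 by rewrite -cardfs_gt0 t3.
    have c2 : #|` t `\ v| = 2 by have := cardfsD1 v t; rewrite vt t3; lia.
    exists (t `\ v) => //; case: HK' => _ HK'; apply: HK' tK' (fsubD1set _ _) _.
    by rewrite -cardfs_gt0 c2.
  elim: Wc {HM HT Wa Wb HV HK' HMc E1 MK'} => // n C C1 C2 [t1 [s [H h3 ->]]] _ IH _.
  by apply: IH; apply: elementary_edge H _; rewrite ltnW.
have M0 : M != fset0 by apply/fset0Pn; exists e.
rewrite -E1 in Wc; have [|K2 [E2 [b2 s2 H2]]] := contractions_complete Wc le_c HMc M0 (l := l).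
  by lia.
exists (b1 ++ b2); first by rewrite size_cat s1 s2; lia.
rewrite /search H1 -[b2]cats0 H2; apply: one_dimensional_greedy; rewrite E2 //.
- by exists e.
- by move=> T cT TM; apply: HT => //; apply: fsubset_trans TM MK'.
Qed.

(* Fresh vertices may be chosen among the [p] numbers from [n] on. *)
Lemma search_complete_fresh l n p K :
  d_complex 2 (complex_of K) -> ordered_erasible (complex_of K) p ->
  (forall v, vertex_of (complex_of K) v -> v < n) ->
  size K + 2 * p <= 2 ^ l -> n + p <= 2 ^ l ->
  exists2 g, size g = 7 * l * p & search l (down_from (n + p)) p K g.
Proof.
move=> HK [K' [L [a [b [le_ap Wa Wb HL]]]]] HV leK leV.
have [e se He] := walk_expansion_vertices Wa.
(* Old vertices are kept; new ones, listed in [e] with at most [p] entries, move to the numbers from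
   [n] on. *)
pose f x := if x < n then x else n + index x e.
pose vs := [seq x <- iota 0 (n + (\max_(x <- e) x).+1) | (x < n) || (x \in e)].
have [|g g_inj Hg] := @injective_extension vs f.
  move=> x y; rewrite !mem_filter => /andP [hx _] /andP [hy _]; rewrite /f.
  case: ltnP hx => hx; case: ltnP hy => hy //=; try by [].
  - by move=> _ _ e1; lia.
  - by move=> _ _ e1; lia.
  - by move=> ye xe /addnI /index_inj; apply.
have Hgv v : vertex_of K' v -> g v = f v /\ f v < n + p.
  move=> vK'; have hv : (v < n) || (v \in e).
    by case: (He v vK') => [->|/HV ->]; rewrite ?orbT.
  split.
    apply: Hg; rewrite mem_filter hv mem_iota /= add0n; case/orP: hv => hv.
      by apply: ltn_addr.
    by have := @leq_bigmax_seq _ e xpredT id v hv isT; rewrite /=; lia.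
  rewrite /f; case: ltnP hv => //= h ve; first by apply: ltn_addr.
  by rewrite ltn_add2l (leq_trans _ (leq_trans se le_ap)) ?index_mem.
have sub := walk_expansion_sub Wa.
have EK : rename g (complex_of K) = complex_of K.
  have mid : map (map id) K = K by elim: (K) => //= s K1 ->; rewrite map_id.
  rewrite -[RHS](congr1 complex_of mid) (@complex_of_map id g) //.
  move=> v /flattenP [s sK vs']; have vK : vertex_of (complex_of K) v.
    by exists (face_of s); [apply: face_of_in | rewrite in_face_of].
  have [|-> _] := Hgv v; last by rewrite /f HV.
  by case: vK => r rK vr; exists r => //; apply: (fsubsetP sub).
apply: (@search_complete l (down_from (n + p)) p K (rename g K') (rename g L) a b) => //.
- by rewrite -{1}EK; apply: rename_walk_expansion.
- exact: rename_walk_collapse.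
- exact: rename_d_complex.
- move=> v [s /renameP [s' s'K ->] /imfsetP [x /= xs ->]].
  have [|-> h] := Hgv x; first by exists s'.
  by rewrite mem_down_from.
- by rewrite size_down_from.
Qed.

(** * Correctness of the parser *)

Definition numeral_code (b : seq bool) : seq symbol := Comma :: [seq Bit x | x <- b].
Definition face_code (s : seq (seq bool)) : seq symbol :=
  Semicolon :: flatten [seq numeral_code b | b <- s].

Definition unparse (cur : seq bool) (face : seq (seq bool)) (F : seq (seq (seq bool))) :
    seq symbol :=
  [seq Bit x | x <- cur] ++ flatten [seq numeral_code b | b <- face] ++
  flatten [seq face_code s | s <- F].

Lemma encode_unparse F p :
  encode F p = unparse (bits_of_nat p) [::] (map (map bits_of_nat) F).
Proof.
rewrite /encode /unparse /=; congr cat; rewrite -map_comp; congr flatten.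
apply: eq_map => s; rewrite /encode_face /face_code /= -map_comp.
by congr (_ :: flatten _); apply: eq_map.
Qed.

(** The flag rules out digits directly after a semicolon, the only loss of information in
    [parse_step]. *)
Lemma parse_sound w ok cur face F :
  parse w = (ok, (cur, (face, F))) -> ok -> w = unparse cur face F.
Proof.
elim: w ok cur face F => [|a w IH] ok cur face F /=; first by case=> <- <- <- <-.
rewrite -/(parse w); case: (parse w) IH => ok1 [cur1 [face1 F1]] IH.
case: a => [b| |] /= [<- <- <- <-] Hok.
- by rewrite (IH _ _ _ _ erefl Hok).
- by rewrite (IH _ _ _ _ erefl Hok) /unparse /= -catA.
- by case/andP: Hok => Hok /nilP E; rewrite (IH _ _ _ _ erefl Hok) E.
Qed.

Lemma parse_bits b w ok cur face F : parse w = (ok, (cur, (face, F))) ->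
  parse ([seq Bit x | x <- b] ++ w) = (ok, (b ++ cur, (face, F))).
Proof. by move=> E; elim: b => //= x b IH; rewrite -/(parse _) IH. Qed.

Lemma parse_unparse cur face F :
  parse (unparse cur face F) = (true, (cur, (face, F))).
Proof.
have faces s w G : parse w = (true, ([::], ([::], G))) ->
    parse (flatten [seq numeral_code b | b <- s] ++ w) = (true, ([::], (s, G))).
  move=> E; elim: s => //= b s IH; rewrite -catA -/(parse _).
  by rewrite (parse_bits b IH) cats0.
rewrite -[in RHS](cats0 cur); apply: parse_bits; apply: (faces).
elim: F => //= s F IH; rewrite -/(parse _) (faces s _ _ IH).
by [].
Qed.

Lemma bits_rec_half k n : 1 < n -> bits_rec k.+1 n = rcons (bits_rec k n./2) (odd n).
Proof. by rewrite ltnNge -ltnS => /negbTE /= ->. Qed.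

Lemma bits_rec_enough k n : n <= k -> bits_rec k n = bits_of_nat n.
Proof.
rewrite /bits_of_nat; elim/ltn_ind: n k => n IH k.
case: n IH => [|[|n]] IH; [by case: k | by case: k => [|k] | case: k => // k le].
have lt : n.+2./2 < n.+2 by rewrite -divn2 ltn_Pdiv.
by rewrite [LHS]bits_rec_half // [RHS]bits_rec_half // !(IH n.+2./2) // -divn2; lia.
Qed.

Lemma bits_of_nat_half n : 1 < n -> bits_of_nat n = rcons (bits_of_nat n./2) (odd n).
Proof.
case: n => // n n1; rewrite {1}/bits_of_nat bits_rec_half //.
by rewrite bits_rec_enough // -divn2; lia.
Qed.

Lemma head_bits_of_nat n : 0 < n -> head false (bits_of_nat n).
Proof.
elim/ltn_ind: n => n IH n0; have [n1|n1] := leqP n 1; first by case: n n0 n1 {IH} => [|[]].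
rewrite bits_of_nat_half //.
have /IH : n./2 < n by rewrite -divn2 ltn_Pdiv.
by rewrite half_gt0 n1 => /(_ isT); case: (bits_of_nat _).
Qed.

Lemma canonical_bits n : canonical (bits_of_nat n).
Proof. by case: n => // n; rewrite /canonical head_bits_of_nat. Qed.

Lemma bits_of_nat_canonical s : canonical s -> bits_of_nat (nat_of_bits s) = s.
Proof.
case/orP; last by case: s => [|[] [|b s]].
elim/last_ind: s => // s b IH; case: s IH => [|a s] IH; first by case: b.
move=> h; have {h} a1 : head false (a :: s) by [].
rewrite /nat_of_bits foldl_rcons -/(nat_of_bits _); set n := nat_of_bits _ in IH *.
have n0 : 0 < n.
  have E : bits_of_nat n = a :: s := IH a1.
  by case: (n) E a1 => // -[<- _].
rewrite bits_of_nat_half; last by rewrite -muln2; lia.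
by rewrite addnC half_bit_double oddD odd_double addbF oddb IH.
Qed.

Lemma same_bitsE s t : same_bits s t = (s == t).
Proof.
rewrite /same_bits; move E: (true) => ok.
have -> : (s == t) = ok && (s == t) by rewrite -E.
elim: s t ok {E} => [|a s IH] t ok /=; first by case: t.
rewrite IH; case: t => [|b t] /=; first by rewrite !andbF.
by rewrite eqseq_cons -andbA (eq_sym b).
Qed.

Lemma positionE v vs : position v vs = index v vs.
Proof. by elim: vs => //= a vs ->; rewrite same_bitsE. Qed.

Lemma floor_logE n : floor_log n = trunc_log 2 n.
Proof.
case: n => [|n]; first by [].
(* Either the power doubled in all [k] rounds or it has stalled. After [n.+1] rounds the former is
   impossible, since [2 ^ n.+1] exceeds [n.+1]. *)
have H k : exists j, [/\ iter k (log_step n.+1) (1, 0) = (2 ^ j, j), 2 ^ j <= n.+1 &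
    j = k \/ n.+1 < 2 ^ j.+1].
  elim: k => [|k [j [/= -> le H]]]; first by exists 0; split=> //; left.
  rewrite /log_step /= addnn -mul2n -expnS; case: leqP => lt.
    by exists j.+1; split=> //; left; case: H => [->//|]; rewrite ltnNge lt.
  by exists j; split=> //; right.
have [j [E le H1]] := H n.+1; rewrite /floor_log E; apply/esym/trunc_log_eq => //.
rewrite le /=; case: H1 => // ej; move: le; rewrite ej leqNgt.
by rewrite ltn_expl.
Qed.

Lemma size_unparse cur face F :
  size F + size (flatten F) + size cur <= size (unparse cur face F).
Proof.
rewrite /unparse !size_cat size_map addnC leq_add2l; apply: leq_trans (leq_addl _ _).
elim: F => //= s F IH; rewrite !size_cat /=.
have : size s <= size (flatten [seq numeral_code b | b <- s]).
  by elim: s => //= b s IHs; rewrite size_cat; lia.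
by lia.
Qed.

Definition guesses (p n : nat) : nat := 7 * guess_length p n * p.

(** [n] is below [2 ^ (t + 1)] and [2p] below [2 ^ (2p)], so their sum is at most the product of
    these powers. Since [1 < n] gives [t >= 1], the exponent [t + 1 + 2p] is at most
    [(2p + 2) t]. *)
Lemma guess_length_large p n m :
  1 < n -> m <= n + 2 * p -> m <= 2 ^ guess_length p n.
Proof.
move=> n1 /leq_trans; apply; rewrite /guess_length floor_logE; set t := trunc_log 2 n.
have t0 : 0 < t by rewrite trunc_log_gt0.
have lt : n < 2 ^ t.+1 by apply: trunc_log_ltn.
have lp : 2 * p < 2 ^ (2 * p) by rewrite ltn_expl.
apply: (@leq_trans (2 ^ t.+1 * 2 ^ (2 * p))).
  by move: (2 ^ t.+1) (2 ^ (2 * p)) lt lp => A B; nia.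
by rewrite -expnD leq_exp2l //; nia.
Qed.

Lemma verify_correct w :
  language ordered_erasibility_expansion_height w <->
  exists2 g, size g = guesses (nat_of_bits (leading_bits w)) (size w) &
    verify g w (nat_of_bits (leading_bits w)).
Proof.
set p := nat_of_bits _; pose f (Fb : seq (seq (seq bool))) x := index (bits_of_nat x) (flatten Fb).
have flat F : flatten (map (map bits_of_nat) F) = map bits_of_nat (flatten F).
  by elim: F => //= s F ->; rewrite map_cat.
have f_inj F : {in flatten F &, injective (f (map (map bits_of_nat) F))}.
  move=> x y xF yF; rewrite /f flat => /index_inj H; apply: (can_inj bits_of_natK).
  by apply: H; first exact: [::]; apply: map_f.
have ren F : renamed (map (map bits_of_nat) F) =
    map (map (f (map (map bits_of_nat) F))) F.
  rewrite /renamed -map_comp; apply: eq_map => s /=; rewrite -map_comp.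
  by apply: eq_map => v; rewrite /= positionE.
split=> [[F [q [Ew HF Hq]]]|[g sg /and3P []]].
  have Ep : p = q by rewrite /p Ew; apply: (parameter_encode F q).
  rewrite encode_unparse in Ew; rewrite -{}Ep in Ew Hq *.
  have [HF1 Hq1] := iffLR (rename_instance p (f_inj F)) (conj HF Hq).
  have sw := size_unparse (bits_of_nat p) [::] (map (map bits_of_nat) F); rewrite -Ew in sw.
  have sF : 0 < size F.
    by case: HF => _ H0 _; case: (F) H0 => // /eqP []; apply/fsetP => s; apply/complex_ofP => -[].
  have sb : 0 < size (bits_of_nat p).
    by have := canonical_bits p; case: (bits_of_nat p).
  rewrite size_map in sw.
  (* An instance has a digit of [p] and at least one face, so the logarithm of its length is
     positive. *)
  have w1 : 1 < size w.
    by apply: leq_trans (leq_trans (leq_add sF sb) _) sw; rewrite leq_add2r leq_addr.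
  have [|||g sg Hg] := search_complete_fresh (l := guess_length p (size w))
     (n := size (flatten (map (map bits_of_nat) F))) HF1 Hq1.
  - move=> v [s /complex_ofP [t /mapP [t' t'F ->] ->]].
    rewrite in_face_of => /mapP [x xt ->]; rewrite /f index_mem flat.
    by apply: map_f; apply/flattenP; exists t'.
  - apply: guess_length_large => //; rewrite size_map leq_add2r.
    by apply: leq_trans sw; rewrite -addnA leq_addr.
  - apply: guess_length_large => //; apply: leq_add; last by rewrite leq_pmull.
    by apply: leq_trans sw; rewrite addnAC leq_addl.
  exists g => //; rewrite /verify Ew parse_unparse -Ew /= ren Hg andbT.
  apply/andP; split; last exact/two_dimensionalP.
  rewrite /well_formed /= canonical_bits /=; apply/allP => s /mapP [t _ ->].
  by apply/allP => v /mapP [x _ ->]; apply: canonical_bits.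
case Ew: (parse w) => [ok [cur [face Fb]]]; rewrite /well_formed /=.
case/and4P => Hok /nilP E0 Hc HF; rewrite {face}E0 in Ew.
have {}Ew := parse_sound Ew Hok.
pose F := map (map nat_of_bits) Fb.
have EF : map (map bits_of_nat) F = Fb.
  rewrite -map_comp -[RHS]map_id; apply/eq_in_map => s sF /=.
  rewrite -map_comp -[RHS]map_id; apply/eq_in_map => v vs /=.
  by apply: bits_of_nat_canonical; move/allP: HF => /(_ s sF) /allP; apply.
have Ew' : w = encode F p.
  rewrite encode_unparse EF {1}Ew; congr unparse.
  rewrite /p Ew /unparse; have -> : leading_bits ([seq Bit x | x <- cur] ++
     flatten [seq numeral_code b | b <- [::]] ++ flatten [seq face_code s | s <- Fb]) = cur.
    by elim: (cur) => [|b s /= ->] //; case: (Fb).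
  by rewrite bits_of_nat_canonical.
rewrite -EF ren => /two_dimensionalP H2 /(search_sound H2) He.
have [HF' He'] := iffRL (rename_instance p (f_inj F)) (conj H2 He).
by exists F, p.
Qed.

(** * Computability of the bounds *)

(** The constructors produce functions of a fixed shape; extensionality admits other expressions of
    the same function. *)
Lemma gr_ext n (f g : n.-tuple nat -> nat) :
  general_recursive f -> f =1 g -> general_recursive g.
Proof. by move=> Hf E; have <- : f = g by apply: functional_extensionality. Qed.

Lemma gr_proj_nth n i : i < n -> general_recursive (fun v : n.-tuple nat => nth 0 v i).
Proof. by move=> lt; apply: gr_ext (gr_proj (Ordinal lt)) _ => v; rewrite (tnth_nth 0). Qed.

Lemma gr_succ' n (f : n.-tuple nat -> nat) :
  general_recursive f -> general_recursive (fun v => (f v).+1).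
Proof.
move=> Hf; apply: gr_ext (gr_comp gr_succ (h := fun=> f) (fun=> Hf)) _ => v.
by rewrite /thead tnth_mktuple.
Qed.

Lemma gr_const n c : general_recursive (fun _ : n.-tuple nat => c).
Proof. by elim: c => [|c IH]; [apply: gr_zero | apply: gr_succ' IH]. Qed.

Lemma gr_comp2 n (g : nat -> nat -> nat) (a b : n.-tuple nat -> nat) :
  general_recursive (fun v : 2.-tuple nat => g (nth 0 v 0) (nth 0 v 1)) ->
  general_recursive a -> general_recursive b -> general_recursive (fun v => g (a v) (b v)).
Proof.
move=> Hg Ha Hb.
have H (i : 'I_2) : general_recursive (if i == ord0 then a else b) by case: ifP.
apply: gr_ext (gr_comp Hg H) _ => v.
rewrite -[0]/(nat_of_ord (@ord0 1)) -[1]/(nat_of_ord (@ord_max 1)).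
by rewrite -!tnth_nth !tnth_mktuple.
Qed.

Lemma gr_addn n (a b : n.-tuple nat -> nat) :
  general_recursive a -> general_recursive b -> general_recursive (fun v => a v + b v).
Proof.
apply: gr_comp2.
apply: (@gr_prec 1 (fun v => nth 0 v 0) (fun v => (nth 0 v 1).+1)) => //.
- exact: gr_proj_nth.
- by apply: gr_succ'; apply: gr_proj_nth.
Qed.

Lemma gr_muln n (a b : n.-tuple nat -> nat) :
  general_recursive a -> general_recursive b -> general_recursive (fun v => a v * b v).
Proof.
apply: gr_comp2.
apply: (@gr_prec 1 (fun=> 0) (fun v => nth 0 v 2 + nth 0 v 1)) => //.
- exact: gr_const.
- by apply: gr_addn; apply: gr_proj_nth.
Qed.

Lemma computable_exp c k : computable (fun n => (n + c) ^ k).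
Proof.
rewrite /computable; have H : general_recursive (fun v : 1.-tuple nat => thead v).
  by apply: gr_ext (gr_proj_nth (isT : 0 < 1)) _ => v; rewrite /thead (tnth_nth 0).
elim: k => [|k IH]; first exact: gr_const.
apply: gr_ext (gr_muln (gr_addn H (gr_const 1 c)) IH) _ => v.
by rewrite expnS.
Qed.

Definition guess_factor (p : nat) : nat := 7 * (p + p + 2) * p.

Lemma computable_guess_factor : computable guess_factor.
Proof.
rewrite /computable; have H : general_recursive (fun v : 1.-tuple nat => thead v).
  by apply: gr_ext (gr_proj_nth (isT : 0 < 1)) _ => v; rewrite /thead (tnth_nth 0).
by do ![apply: gr_muln | apply: gr_addn | apply: gr_const].
Qed.

Lemma guessesE p n : guesses p n = guess_factor p * trunc_log 2 n.
Proof. by rewrite /guesses /guess_length floor_logE /guess_factor; lia. Qed.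

(** * The machine *)

Notation param := (parameter ordered_erasibility_expansion_height).

Definition prepared (x : seq symbol) : nat * (seq symbol * nat) :=
  (guesses (param x) (size x), (x, param x)).

Definition measure (x : seq symbol) : nat := size x + param x.

Lemma nat_of_bits_cat s t : nat_of_bits s <= nat_of_bits (s ++ t).
Proof.
rewrite /nat_of_bits foldl_cat; set n := foldl _ 0 s.
by elim: t n => //= b t IH n; apply: leq_trans (IH _); rewrite -addnn -addnA leq_addr.
Qed.

Lemma PTm_PT A B (EA : encoding A) (EB : encoding B) mu (f : A -> B) :
  poly_bounded mu (@sz A EA) -> PT f -> PTm mu f.
Proof.
move=> Hmu [c [t [H1 H2 H3]]]; exists c, t; split=> //.
  exact: (pb_comp (f := id) H2 Hmu).
exact: (pb_comp (f := id) H3 Hmu).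
Qed.

(** The unary parameter may be exponential in the length of the word, so the bound is in terms of
    [measure]; all later computation takes the parameter as part of its input. *)
Lemma PTm_prepared : PTm measure prepared.
Proof.
have Hsz : poly_bounded measure (@sz (seq symbol) _).
  apply: (pb_le (u := fun x => 6 * measure x + 1)).
    by do ![apply: pb_mu | apply: pb_add | apply: pb_mul | apply: pb_const].
  move=> x; rewrite /measure mulnDr -addnA (addnC (6 * param x)) addnA; apply: leq_trans (leq_addr _ _).
  elim: x => // a x IH; rewrite sz_cons /= mulnS.
  have : sz a <= 5 by case: a => [[]| |].
  by lia.
have Hbits : PT leading_bits.
  apply: PT_eq (PT_foldr (X := seq symbol) (T := seq bool)
    (F := fun _ a s => if a == Bit true then true :: s else
            if a == Bit false then false :: s else [::])
    (i := fun=> [::]) (l := id) _ _ PT_id _) _.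
  - have Ha (b : bool) : PT (fun q : seq symbol * seq bool * symbol => q.2 == Bit b).
      exact: PT_comp (PT_is_bit b) (@PT_snd _ _ _ _).
    by apply: PT_if => //; [pt | apply: PT_if => //; pt].
  - by pt.
  - exists (fun x => 1 + 4 * sz x).
      by do ![apply: pb_mu | apply: pb_add | apply: pb_mul | apply: pb_const].
    move=> x u v ->; apply: (@leq_trans (1 + 4 * sz v)).
      elim: v => //= a v IH; apply: (@leq_trans (1 + 4 * sz v + 4)).
        by case: ifP => _; last case: ifP => _ //; rewrite sz_cons addnC -addnS leq_add.
      by rewrite sz_cons; lia.
    by rewrite leq_add2l leq_mul2l /= sz_catr.
  - by elim=> // -[[]| |] x //= ->.
have Hp : PTm measure param.
  apply: PTm_eq (PTm_fold (F := fun (n : nat) (b : bool) => n.*2 + b) (l := leading_bits)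
    (i := fun=> 0) Hsz _ _ _ _) _ => //.
  - have Hb : PT (fun p : bool * nat => nat_of_bool p.1) by apply: PTm_retype (PT_fst) _ => -[[]].
    apply: PT_eq (PT_addn (PT_addn (PT_snd (A := bool) (B := nat)) PT_snd) Hb) _ => -[b n] /=.
    by rewrite addnn.
  - exact: PTm_PT Hbits.
  - exact: PTm_PT (PT_const 0).
  (* The values of prefixes of a numeral do not exceed its final value, the parameter. *)
  - exists (fun x => 2 * measure x + 1).
      by do ![apply: pb_mu | apply: pb_add | apply: pb_mul | apply: pb_const].
    move=> x u v E; rewrite sz_nat leq_add2r leq_mul2l /=.
    by apply: leq_trans (leq_addl _ _); rewrite /= E; apply: nat_of_bits_cat.
have Hw : PTm measure (fun x : seq symbol => (x, param x)).
  exact: PTm_pair Hsz (PTm_PT Hsz PT_id) Hp.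
have Hg : PT (fun q : seq symbol * nat => (guesses q.2 (size q.1), q)).
  by rewrite /guesses; pt; apply: PT_guess_length; pt.
exact: PTm_comp Hw Hg.
Qed.

Lemma guessed_letters bs s (t : seq bool) :
  foldl (fun s b => Nd_letter :: bit_letters b ++ s) (code (enc t) ++ s) bs =
  code (enc (catrev bs t)) ++ s.
Proof.
elim: bs t => //= b bs IH t; rewrite -IH /=; congr foldl.
by rewrite -catA; case: b.
Qed.

Lemma sz_bits (bs : seq bool) : sz bs <= 4 * size bs + 1.
Proof.
elim: bs => // b bs IH; rewrite sz_cons /= mulnS.
by have := sz_bool b; lia.
Qed.

Theorem theorem13 : in_WP ordered_erasibility_expansion_height.
Proof.
have [c1 [t1 [H1 B1 Bp]]] := PTm_prepared.
have [c3 [t3 [H3 [k3 B3] _]]] := PT_verify.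
pose P1 := Seq read_cmd (Seq c1 prepare_cmd).
(* The pushed [Node] joins the list of guesses and the instance below it to one pair, the argument
   of the verifier. *)
pose P3 := Seq (Push RM Nd_letter) c3.
pose g x := guesses (param x) (size x).
pose inst x : tree := @enc _ (enc_prod (enc_seq enc_symbol) enc_nat) (x, param x).
pose S1 x := Store [::] (Lf_letter :: code (inst x)) (nseq (g x) Nd_letter) [::] [::].
pose T1 x := 26 * size x + 4 + (t1 x + (6 * g x + 2)).
pose T3 x := 2 + (4 * g x + 1 + tsize (inst x) + 1 + 2) ^ k3.
have P1_ok x : ex P1 (Store [seq inl a | a <- x] [::] [::] [::] [::]) (T1 x) (S1 x).
  apply: ex_seq (ex_read x) (ex_seq _ (ex_prepare (g x) _)).
  by have := H1 x [::] [::] [::] [::] [::]; rewrite !cats0.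
have S1_size x : size (stA (S1 x)) = g x by rewrite size_nseq.
have P3_ok x bs : size bs = g x -> exists S,
    ex P3 (guessed bs (S1 x)) (T3 x) S /\
    (ohead (stM S) == Some Nd_letter) = verify (rev bs) x (param x).
  move=> sb; exists (Store [::] (code (enc (verify (rev bs) x (param x)))) [::] [::] [::]).
  split; last by case: (verify _ _ _).
  have Eg : guessed bs (S1 x) = Store [::] (code (enc (rev bs)) ++
      code (inst x)) [::] [::] [::].
    by rewrite /guessed /S1 /= (guessed_letters bs _ [::]).
  rewrite Eg; apply: ex_le (ex_seq (ex_push _ _ _) _) _.
    by have := H3 (rev bs, (x, param x)) [::] [::] [::] [::] [::]; rewrite !cats0; apply.
  rewrite leq_add2l; apply: leq_trans (B3 _) _.
  case: (k3) => // k; rewrite leq_exp2r // leq_add2r sz_pair addn1 ltnS leq_add2r.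
  by have := sz_bits (rev bs); rewrite size_rev sb.
pose M := guess_ntm P1 P3; exists M; split; last first.
  move=> x; rewrite (guess_ntm_accepts P1_ok S1_size P3_ok) verify_correct.
  (* The stack delivers the guesses in reverse order, and reversal is a bijection on bit lists of
     the given length. *)
  split=> -[bs sb Hb]; exists (rev bs); rewrite ?size_rev //.
  by rewrite revK.
have Bsum : poly_bounded measure (fun x => sz (prepared x)) by [].
have Bg : poly_bounded measure g.
  apply: pb_le Bsum _ => x; rewrite sz_pair sz_nat -/(g x); lia.
have Bi : poly_bounded measure (fun x => tsize (inst x)).
  by apply: pb_le Bsum _ => x; rewrite sz_pair /sz -/(inst x); lia.
have Bs : poly_bounded measure (size : seq symbol -> nat).
  by apply: pb_le (pb_mu measure) _ => x; apply: leq_addr.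
have [K HK] : poly_bounded measure (fun x => T1 x + T3 x + 12 * g x + 2).
  have P : poly_bounded id (fun n => (n + 2) ^ k3) by exists k3.
  have Q : poly_bounded measure (fun x => 4 * g x + 1 + tsize (inst x) + 1).
    by do ![done | apply: pb_add | apply: pb_mul | apply: pb_const].
  have R := pb_comp P Q.
  by do ![done | apply: pb_add | apply: pb_mul | apply: pb_const].
(* The two variables are separated by [|x| + p + 2 <= (p + 2) (|x| + 2)]. *)
exists (fun p => (p + 2) ^ K), guess_factor,  (('X + 2%:P) ^+ K)%R; split.
- exact: computable_exp.
- exact: computable_guess_factor.
- move=> x n m c Hr.
  have [le1 le2 _] := guess_ntm_bounded P1_ok S1_size P3_ok Hr; split.
    apply: leq_trans le1 (leq_trans (HK x) _).
    have -> : ((('X + 2%:P) ^+ K).[size x])%R = (size x + 2) ^ K.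
      by rewrite horner_exp hornerD hornerX hornerC.
    rewrite -expnMn; case: (K) => // k; rewrite leq_exp2r // /measure -/(param x).
    by move: (size x) (param x) => a b; nia.
  by apply: leq_trans le2 _; rewrite /g guessesE.
Qed.
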